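(* In the setting of the context (with $\mu=-1$), let $h=(h_t)_{t\ge1}$ be such that $h_t$ is $\mathcal{Y}_t$-measurable for every $t\ge1$. The conditional mean $\overline{\pi}_{t-1}(X_t)$ and the variance of the one-step prediction error $\overline{\gamma}_t=\mathbb{E}[X_t-\overline{\pi}_{t-1}(X_t)]^2$ are given by $$\overline{\pi}_{t-1}(X_t)=m_t+\sum_{s=1}^{t-1}\frac{\overline{\gamma}(t,s)}{1+(A_s^2+Q_s)\overline{\gamma}_s}\Big[A_s\big(Y_s-A_s\overline{\pi}_{s-1}(X_s)\big)+\big(Y^{(2)}_s-Q_s(\overline{\pi}_{s-1}(X_s)-h_s)\big)\Big],\quad t\ge1,$$ $$\overline{\gamma}_t=\overline{\gamma}(t,t),\quad t\ge1,$$ where $\overline{\gamma}=(\overline{\gamma}(t,s),\,1\le s\le t)$ is the unique solution of $$\overline{\gamma}(t,s)=K(t,s)-\sum_{l=1}^{s-1}\overline{\gamma}(t,l)\,\overline{\gamma}(s,l)\,\frac{A_l^2+Q_l}{1+(A_l^2+Q_l)\overline{\gamma}(l,l)},\qquad 1\le s\le t.$$ Moreover, with $\overline{\gamma}_{X\xi}(1)=0$ and, for $t\ge2$, $$\overline{\gamma}_{X\xi}(t)=\mathbb{E}\big[(X_t-\overline{\pi}_{t-1}(X_t))(\xi_{t-1}-\overline{\pi}_{t-1}(\xi_{t-1}))/\overline{\mathcal{Y}}_{t-1}\big],$$ the difference $Z^h_t=\overline{\pi}_{t-1}(X_t)-\overline{\gamma}_{X\xi}(t)$ is the solution of $$Z^h_t=m_t+\sum_{l=1}^{t-1}\overline{\gamma}(t,l)\frac{Q_l}{1+(A_l^2+Q_l)\overline{\gamma}_l}(h_l-Z^h_l)+\sum_{l=1}^{t-1}\overline{\gamma}(t,l)\frac{A_l}{1+(A_l^2+Q_l)\overline{\gamma}_l}(Y_l-A_lZ^h_l),\quad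 t\ge1.$$
   Context: Setting: $X=(X_t)_{t\ge1}$ is an arbitrary real Gaussian sequence with mean $m_t=\mathbb{E}X_t$ and covariance $K(t,s)=\mathbb{E}(X_t-m_t)(X_s-m_s)$. The observations are $Y_t=A_tX_t+\varepsilon_t$, $t\ge 1$, where $(A_t)_{t\ge1}$ is a deterministic real sequence and $(\varepsilon_t)_{t\ge1}$ are i.i.d. $\mathcal{N}(0,1)$, independent of $X$. $\mathcal{Y}_t=\sigma(Y_u,\,1\le u\le t)$. $(Q_t)_{t\ge1}$ is a fixed sequence of nonnegative real numbers. Auxiliary processes: let $(\bar\varepsilon_t)_{t\ge1}$ be i.i.d. $\mathcal{N}(0,1)$, independent of $(X,\varepsilon)$, and set $$Y^{(2)}_t=Q_t(X_t-h_t)+\sqrt{Q_t}\,\bar\varepsilon_t,\qquad \xi_t=\sum_{s=1}^t(X_s-h_s)Y^{(2)}_s$$ (the superscript $(2)$ is a label, not a power). Let $\overline{\mathcal{Y}}_t=\sigma(Y_s,Y^{(2)}_s,\,1\le s\le t)$, with $\overline{\mathcal{Y}}_0$ trivial, and $\overline{\pi}_t(\eta)=\mathbb{E}(\eta/\overline{\mathcal{Y}}_t)$, where $\mathbb{E}(\cdot/\mathcal{G})$ denotes conditional expectation given $\mathcal{G}$. *)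

(* Defs.v *)
From mathcomp Require Import all_boot all_order all_algebra finmap.
From mathcomp Require Import all_classical all_reals all_analysis measurable_realfun.

Set Implicit Arguments.
Unset Strict Implicit.
Unset Printing Implicit Defensive.

Import Order.TTheory GRing.Theory Num.Theory.

Local Open Scope classical_set_scope.
Local Open Scope ring_scope.

(* Sequences are indexed by nat, but time starts at 1: the terms of index 0 are
   never used. *)

Definition times_from1 : set nat := [set t | (1 <= t)%N].

Definition times_upto (t : nat) : set nat := [set s | (1 <= s <= t)%N].

(* The generating events {Z_t \in B}, t \in D, so that sigma(Z_t, t \in D) is
   <<s events Z D >> and sigma(Z_t, Z'_t, t \in D) is
   <<s events Z D `|` events Z' D >>. *)
Definition events d (T : measurableType d) (R : realType)
    (Z : nat -> T -> R) (D : set nat) : set (set T) :=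
  \bigcup_(t in D) preimage_set_system setT (Z t) measurable.

Definition measurable_wrt (T : Type) d' (U : measurableType d')
    (G : set (set T)) (f : T -> U) : Prop :=
  preimage_set_system setT f measurable `<=` G.

Definition independent_sets d (T : measurableType d) (R : realType)
    (P : probability T R) (G H : set (set T)) : Prop :=
  forall A B, G A -> H B -> P (A `&` B) = (P A * P B)%E.

Definition mutually_independent d (T : measurableType d) (R : realType)
    (P : probability T R) (Z : nat -> {RV P >-> R}) : Prop :=
  forall (J : {fset nat}) (B : nat -> set R),
    (forall t, t \in J -> (1 <= t)%N) -> (forall t, measurable (B t)) ->
    P (\bigcap_(t in [set` J]) (Z t @^-1` B t)) =
    (\prod_(t <- J) P (Z t @^-1` B t))%E.

Definition iid_std_normal d (T : measurableType d) (R : realType)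
    (P : probability T R) (Z : nat -> {RV P >-> R}) : Prop :=
  (forall t, (1 <= t)%N -> forall B : set R, measurable B ->
     distribution P (Z t) B = normal_prob 0 1 B) /\
  mutually_independent Z.

(* Gaussian variables may be degenerate.  The case s = 0 has to be separated
   because normal_prob m 0 is by convention the uniform law on [0, 1]. *)
Definition gaussian_variable d (T : measurableType d) (R : realType)
    (P : probability T R) (Z : T -> R) : Prop :=
  exists m s : R, 0 <= s /\
    forall B : set R, measurable B ->
      P (Z @^-1` B) = if s == 0 then \d_m B else normal_prob m s B.

Definition gaussian_sequence d (T : measurableType d) (R : realType)
    (P : probability T R) (X : nat -> {RV P >-> R}) : Prop :=
  forall (n : nat) (a : nat -> R),
    gaussian_variable P (fun w => \sum_(1 <= t < n.+1) a t * X t w).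

Definition is_cond_exp_ge0 d (T : measurableType d) (R : realType)
    (P : probability T R) (G : set (set T)) (f g : T -> \bar R) : Prop :=
  [/\ measurable_wrt G g, (forall w, 0 <= g w)%E &
      forall B, G B -> (\int[P]_(w in B) g w = \int[P]_(w in B) f w)%E].

(* g is a finite version of E(eta / G) = E(eta^+ / G) - E(eta^- / G), where both
   terms are almost surely finite.  eta need not be integrable: this matters
   because h, hence aux_sum, may be non-integrable.  Finiteness of the two terms is
   implied by the last equality, since an infinite term makes the difference
   infinite in \bar R. *)
Definition is_cond_exp d (T : measurableType d) (R : realType)
    (P : probability T R) (G : set (set T)) (eta g : T -> R) : Prop :=
  measurable_wrt G g /\
  exists gp gm : T -> \bar R,
    [/\ is_cond_exp_ge0 P G (EFin \o eta^\+) gp,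
        is_cond_exp_ge0 P G (EFin \o eta^\-) gm &
        {ae P, forall w, (g w)%:E = (gp w - gm w)%E}].

(* A chosen version; the default 0 is only used if there is no version. *)
Definition cond_exp d (T : measurableType d) (R : realType)
    (P : probability T R) (G : set (set T)) (eta : T -> R) : T -> R :=
  xget (cst 0) [set g | is_cond_exp P G eta g].

Definition obs d (T : measurableType d) (R : realType) (P : probability T R)
    (A : nat -> R) (X eps : nat -> {RV P >-> R}) (t : nat) (w : T) : R :=
  A t * X t w + eps t w.

Definition aux_obs d (T : measurableType d) (R : realType)
    (P : probability T R) (Q : nat -> R) (h : nat -> T -> R)
    (X epsbar : nat -> {RV P >-> R}) (t : nat) (w : T) : R :=
  Q t * (X t w - h t w) + Num.sqrt (Q t) * epsbar t w.

Definition aux_sum d (T : measurableType d) (R : realType)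
    (P : probability T R) (h : nat -> T -> R) (X : nat -> {RV P >-> R})
    (Y2 : nat -> T -> R) (t : nat) (w : T) : R :=
  \sum_(1 <= s < t.+1) (X s w - h s w) * Y2 s w.

(* The division is total, but the denominators are at least 1 at the solution
   since its diagonal consists of variances. *)
Definition error_cov_equation (R : realType) (K : nat -> nat -> R)
    (A Q : nat -> R) (gam : nat -> nat -> R) : Prop :=
  forall t s, (1 <= s <= t)%N ->
    gam t s = K t s - \sum_(1 <= l < s)
      gam t l * gam s l *
      ((A l ^+ 2 + Q l) / (1 + (A l ^+ 2 + Q l) * gam l l)).

(* Main.v *)
Require Import Defs.
From HB Require Import structures.
From mathcomp Require Import all_boot all_order all_algebra finmap.
From mathcomp Require Import all_classical all_reals all_analysis measurable_realfun.
From mathcomp Require Import ring lra.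

Set Implicit Arguments.
Unset Strict Implicit.
Unset Printing Implicit Defensive.

Import Order.TTheory GRing.Theory Num.Theory.
Import numFieldNormedType.Exports.

Local Open Scope classical_set_scope.
Local Open Scope ring_scope.

(** Put W_t = Q_t X_t + sqrt(Q_t) epsbar_t, so that Y2_t = W_t - Q_t h_t.  As h is
    adapted to Y, the observations (Y_s, Y2_s)_{s < t} are measurable functions of
    (Y_s, W_s)_{s < t}, and conversely; the latter are jointly Gaussian with X.  In
    this Gaussian space the innovations
      nu_s = A_s Y_s + W_s - D_s p_s,   D_s = A_s^2 + Q_s,
    where p_s is the linear predictor of X_s, suffice to project X: the residuals
    X_s - (projection at time t) are uncorrelated with Y_r and W_r for r < t, hence
    independent of them.  Two weighted laws with the same cosine transforms are
    equal (smooth by a Gaussian kernel, then let its width tend to 0), which yields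
    independence from lack of correlation one coordinate at a time.

    Conditional expectations are then computed by freezing the past and integrating
    the residuals out; this needs no integrability of h.  It gives the formula for
    the prediction, and shows that the covariance term with xi is
      sum_{s < t} gam(s,t) Y2_s,
    where gam(s,t) with s < t is given by the same recursion as gam(t,s).  The
    equation for Z follows from
      gam(s,t) = gam(t,s)/den_s - sum_{s < l < t} gam(t,l) gam(s,l) D_l/den_l. *)

(** As [h] is an arbitrary measurable function of the past of [Y], neither Y2 nor xi is Gaussian.
    The linear theory therefore never sees [h], which re-enters only in coefficients frozen by the
    conditioning: (X_s - h_s) Y2_s is a past-measurable term plus Y2_s times the residual of X_s, so
    given the past xi is affine in the residuals. One scalar innovation per time suffices for two
    observations: A_s Y_s + W_s is D_s X_s plus a noise of variance D_s, and the noise of each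
    component has with that combined noise a covariance equal to the coefficient of X_s in the
    component (A_s for Y_s, Q_s for W_s). The variance D_s den_s of the innovation and its
    covariance D_s gam(t,s) with X_t share the factor D_s; once it is cancelled, the gain
    gam(t,s)/den_s still makes sense when A_s and Q_s vanish. A Gaussian sequence is given only by
    the laws of its finite linear combinations, so independence has to be recovered from
    one-dimensional transforms. Cosines with a free phase carry both the real and the imaginary part
    of a characteristic function while all integrals stay real. *)

Section sub_sigma_algebra.
Context d (T : measurableType d) (R : realType) (P : probability T R).

Lemma sub_measurable (E : set (set T)) :
  E `<=` measurable -> <<s E >> `<=` measurable.
Proof. by move=> mE; apply: smallest_sub => //; exact: sigma_algebra_measurable. Qed.

Lemma independent_setsS (G G' H H' : set (set T)) : G `<=` G' -> H `<=` H' ->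
  independent_sets P G' H' -> independent_sets P G H.
Proof. by move=> sG sH iGH A B /sG GA /sH HB; exact: iGH. Qed.

Lemma independent_setsC (G H : set (set T)) :
  independent_sets P G H -> independent_sets P H G.
Proof. by move=> iGH A B HA GB; rewrite setIC muleC iGH. Qed.

(** For a fixed [B] both sides are finite measures in [A]: the restriction of [P] to [B], and [P]
    scaled by the mass of [B]. They agree on a pi-system containing the whole space, hence on what
    it generates. *)
Lemma independent_sets_sigmal (E H : set (set T)) :
  E `<=` measurable -> H `<=` measurable -> setI_closed E -> E setT ->
  independent_sets P E H -> independent_sets P <<s E >> H.
Proof.
move=> mE mH EI ET iEH A B sA HB.
have mB := mH _ HB.
have PB0 : 0 <= fine (P B) by rewrite fine_ge0.
pose m2 : {measure set T -> \bar R} := mscale (NngNum PB0) P.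
suff -> : P (A `&` B) = mrestr P mB A.
  have -> : (P A * P B = m2 A)%E.
    by rewrite /m2 /= /mscale /= fineK ?fin_num_measure// muleC.
  apply: (g_sigma_algebra_measure_unique E mE (fun=> setT)) => //.
  - by rewrite bigcup_const.
  - move=> C EC /=; rewrite /mrestr iEH// /m2 /= /mscale /=.
    by rewrite fineK ?fin_num_measure// muleC.
  - by move=> _; rewrite /= /mrestr; rewrite -ge0_fin_numE// fin_num_measure//; exact: measurableI.
by [].
Qed.

Lemma independent_sets_sigma (E F : set (set T)) :
  E `<=` measurable -> F `<=` measurable -> setI_closed E -> setI_closed F ->
  E setT -> F setT ->
  independent_sets P E F -> independent_sets P <<s E >> <<s F >>.
Proof.
move=> mE mF EI FI ET FT iEF.
apply: independent_sets_sigmal => //; first exact: sub_measurable.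
apply: independent_setsC; apply: independent_sets_sigmal => //.
exact: independent_setsC.
Qed.

Section sub_id.
Variables (E : set (set T)) (mE : E `<=` measurable).

(** The image of [P] under this map is [P] restricted to [<<s E >>]. The inclusion is kept as an
    argument so that the measurability instance below can be attached. *)
Definition sub_id of E `<=` measurable : T -> g_sigma_algebraType E := id.

Lemma measurable_sub_id : measurable_fun setT (sub_id mE).
Proof. by move=> _ B mB; rewrite setTI; exact: (sub_measurable mE). Qed.

HB.instance Definition _ := isMeasurableFun.Build _ _ _ _ (sub_id mE) measurable_sub_id.

End sub_id.

Section diagonal.
Variables (E F : set (set T)) (mE : E `<=` measurable) (mF : F `<=` measurable).
Hypothesis iEF : independent_sets P <<s E >> <<s F >>.

Let TE := g_sigma_algebraType E.
Let TF := g_sigma_algebraType F.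
Let PE := distribution P (sub_id mE).
Let PF := distribution P (sub_id mF).

Let diag (w : T) : TE * TF := (w, w).

Let measurable_diag : measurable_fun setT diag.
Proof.
by apply: measurable_fun_pair; [exact: (measurable_sub_id mE)|exact: (measurable_sub_id mF)].
Qed.

HB.instance Definition _ := isMeasurableFun.Build _ _ _ _ diag measurable_diag.

(** Independence says that the diagonal map, with its first coordinate seen through [E] and its
    second through [F], sends [P] to the product of the two restricted laws; Tonelli does the
    rest. *)
Lemma ge0_independent_fubini (f : TE * TF -> \bar R) :
  measurable_fun setT f -> (forall x, 0 <= f x)%E ->
  (\int[P]_w f (w, w) = \int[P]_w \int[P]_w' f (w, w'))%E.
Proof.
move=> mf f0.
transitivity (\int[distribution P diag]_x f x)%E.
  by rewrite ge0_integral_distribution.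
transitivity (\int[PE \x PF]_x f x)%E.
  apply: eq_measure_integral => X mX _.
  symmetry; exact: product_measure_unique.
rewrite fubini_tonelli1// ge0_integral_distribution//.
- apply: eq_integral => w _ /=; rewrite /fubini_F ge0_integral_distribution//.
  exact: measurableT_comp.
- exact: measurable_fun_fubini_tonelli_F.
- by move=> w; exact: integral_ge0.
Qed.

End diagonal.
End sub_sigma_algebra.

(** * Conditional expectations computed by freezing the past *)

Section cond_exp_theory.
Context d (T : measurableType d) (R : realType) (P : probability T R).

Lemma measurable_wrtP (E : set (set T)) d' (U : measurableType d') (f : T -> U) :
  measurable_wrt <<s E >> f <->
  measurable_fun [set: g_sigma_algebraType E] (f : g_sigma_algebraType E -> U).
Proof.
split=> [mf _ B mB|mf _ [B mB <-]]; first by apply: mf; exists B.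
exact: (mf measurableT B mB).
Qed.

Lemma measurable_wrt_sub (E : set (set T)) d' (U : measurableType d') (f : T -> U) :
  E `<=` measurable -> measurable_wrt <<s E >> f -> measurable_fun setT f.
Proof.
move=> mE mf _ B mB; apply: (sub_measurable mE); apply: mf; by exists B.
Qed.

Lemma measurable_fine_sub d' (U : measurableType d') (D : set U) (f g : U -> \bar R) :
  measurable_fun D f -> measurable_fun D g ->
  measurable_fun D (fun w => fine (f w) - fine (g w)).
Proof.
by move=> mf mg; apply: measurable_funB; exact: measurableT_comp.
Qed.

Section freezing.
Variables (E F : set (set T)) (mE : E `<=` measurable) (mF : F `<=` measurable).
Hypothesis iEF : independent_sets P <<s E >> <<s F >>.

Let TE := g_sigma_algebraType E.
Let TF := g_sigma_algebraType F.

Lemma measurable_section d' (U : measurableType d') (f : TE * TF -> U) (w : TE) :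
  measurable_fun setT f -> measurable_fun [set: T] (fun x => f (w, x)).
Proof.
move=> mf; have mfw : measurable_fun [set: TF] (fun x => f (w, x)).
  exact: measurableT_comp.
exact: (measurableT_comp mfw (measurable_sub_id mF)).
Qed.

Lemma measurable_diagonal d' (U : measurableType d') (f : TE * TF -> U) :
  measurable_fun setT f -> measurable_fun [set: T] (fun w => f (w, w)).
Proof.
move=> mf; exact: (measurableT_comp mf
  (measurable_fun_pair (measurable_sub_id mE) (measurable_sub_id mF))).
Qed.

Lemma measurable_partial_integral (f : TE * TF -> \bar R) :
  measurable_fun setT f -> (forall x, 0 <= f x)%E ->
  measurable_fun [set: TE] (fun w : TE => \int[P]_w' f (w, w'))%E.
Proof.
move=> mf f0.
have := measurable_fun_fubini_tonelli_F (m2 := distribution P (sub_id mF)) _ mf f0.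
apply: eq_measurable_fun => w _; rewrite /fubini_F.
by rewrite ge0_integral_distribution//; exact: measurableT_comp.
Qed.

(** The indicator of a test event in [<<s E >>] depends on the first coordinate alone: it is
    absorbed into [f] before applying the diagonal formula and taken out of the inner integral
    afterwards. *)
Lemma is_cond_exp_ge0_freezing (f : TE * TF -> \bar R) :
  measurable_fun setT f -> (forall x, 0 <= f x)%E ->
  is_cond_exp_ge0 P <<s E >> (fun w => f (w, w)) (fun w => \int[P]_w' f (w, w'))%E.
Proof.
move=> mf f0; split.
- by apply/measurable_wrtP; exact: measurable_partial_integral.
- by move=> w; exact: integral_ge0.
move=> B EB.
have mB : measurable B by exact: sub_measurable EB.
rewrite integral_mkcond [RHS]integral_mkcond.
pose f1 (x : TE * TF) := (f x * (EFin \o \1_B) x.1)%E.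
have mf1 : measurable_fun setT f1.
  apply: emeasurable_funM => //; apply/measurable_EFinP.
  apply: (measurableT_comp (f := (\1_B : TE -> R))); last exact: measurable_fst.
  exact: measurable_indic.
have f10 x : (0 <= f1 x)%E by rewrite mule_ge0// lee_fin.
have := ge0_independent_fubini mE mF iEF mf1 f10; rewrite /f1/= => f1E.
rewrite [RHS](_ : _ = \int[P]_w (f (w, w) * (\1_B w)%:E))%E; last first.
  by apply: eq_integral => w _; rewrite (epatch_indic (fun w => f (w, w))).
rewrite f1E; apply: eq_integral => w _; rewrite (epatch_indic (fun w => \int[P]_w' f (w, w'))%E)/=.
by rewrite ge0_integralZr//; exact: measurable_section.
Qed.

(** Integrability is asked of each section, not on the diagonal: the partial integrals of the
    positive and negative parts are then finite at every point, which is what [is_cond_exp] asks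
    for. This accommodates a non-integrable [h]. *)
Lemma is_cond_exp_freezing (f : TE * TF -> R) (g : T -> R) :
  measurable_fun setT f ->
  (forall w, P.-integrable setT (fun w' => (f (w, w'))%:E)) ->
  (forall w, \int[P]_w' (f (w, w'))%:E = (g w)%:E)%E ->
  is_cond_exp P <<s E >> (fun w => f (w, w)) g.
Proof.
move=> mf intf fg.
pose fp := (EFin \o f^\+) : TE * TF -> \bar R.
pose fm := (EFin \o f^\-) : TE * TF -> \bar R.
have mfp : measurable_fun setT fp by apply/measurable_EFinP; exact: measurable_funrpos.
have mfm : measurable_fun setT fm by apply/measurable_EFinP; exact: measurable_funrneg.
have fp0 x : (0 <= fp x)%E by rewrite lee_fin funrpos_ge0.
have fm0 x : (0 <= fm x)%E by rewrite lee_fin funrneg_ge0.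
have gE w : (g w)%:E = (\int[P]_w' fp (w, w') - \int[P]_w' fm (w, w'))%E.
  rewrite -fg integralE; congr (_ - _)%E; apply: eq_integral => w' _.
    by rewrite /fp /= funeposE EFin_max.
  by rewrite /fm /= funenegE EFin_max.
split.
  apply/measurable_wrtP.
  have := measurable_fine_sub (measurable_partial_integral mfp fp0)
                              (measurable_partial_integral mfm fm0).
  apply: eq_measurable_fun => w _.
  have : (g w)%:E \is a fin_num by [].
  rewrite gE fin_numB => /andP[h1 h2].
  by apply: EFin_inj; rewrite gE EFinB !fineK.
exists (fun w => \int[P]_w' fp (w, w'))%E, (fun w => \int[P]_w' fm (w, w'))%E; split.
- exact: is_cond_exp_ge0_freezing.
- exact: is_cond_exp_ge0_freezing.
- by apply: aeW => w; rewrite gE.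
Qed.

Lemma integral_independent_fubini (f : TE * TF -> R) :
  measurable_fun setT f ->
  (forall w, P.-integrable setT (fun w' => (f (w, w'))%:E)) ->
  (\int[P]_w \int[P]_w' `|(f (w, w'))%:E| < +oo)%E ->
  P.-integrable setT (fun w => (f (w, w))%:E) /\
  (\int[P]_w (f (w, w))%:E = \int[P]_w \int[P]_w' (f (w, w'))%:E)%E.
Proof.
move=> mf intf foo.
have mEf : measurable_fun setT (EFin \o f) by apply/measurable_EFinP.
have mfp : measurable_fun setT ((EFin \o f)^\+)%E by exact: measurable_funepos.
have mfm : measurable_fun setT ((EFin \o f)^\-)%E by exact: measurable_funeneg.
have intd : P.-integrable setT (fun w => (f (w, w))%:E).
  apply/integrableP; split; first exact: (measurable_diagonal mEf).
  have := ge0_independent_fubini mE mF iEF (f := abse \o (EFin \o f)).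
  by move=> /= ->//; exact: measurableT_comp.
split => //.
have intI (g : TE * TF -> \bar R) : measurable_fun setT g -> (forall x, 0 <= g x)%E ->
    (forall x, g x <= `|(f x)%:E|)%E ->
    P.-integrable setT (fun w => \int[P]_w' g (w, w'))%E.
  move=> mg g0 gf; apply/integrableP; split.
    exact: (measurableT_comp (measurable_partial_integral mg g0) (measurable_sub_id mE)).
  apply: le_lt_trans foo; apply: ge0_le_integral => //.
  - apply: measurableT_comp => //.
    exact: (measurableT_comp (measurable_partial_integral mg g0) (measurable_sub_id mE)).
  - have h : measurable_fun setT (abse \o (EFin \o f)) by exact: measurableT_comp.
    have h0 x : (0 <= (abse \o (EFin \o f)) x)%E by rewrite /=.
    exact: (measurableT_comp (measurable_partial_integral h h0) (measurable_sub_id mE)).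
  - move=> w _; rewrite gee0_abs; last exact: integral_ge0.
    apply: ge0_le_integral => //; first exact: measurable_section.
    by apply: (measurable_section (f := abse \o (EFin \o f))); exact: measurableT_comp.
transitivity (\int[P]_w (\int[P]_w' ((EFin \o f)^\+ (w, w')) -
                         \int[P]_w' ((EFin \o f)^\- (w, w'))))%E; last first.
  apply: eq_integral => w _; rewrite [RHS]integralE.
  by congr (_ - _)%E; apply: eq_integral => w' _; rewrite ?funeposE ?funenegE.
rewrite integralB//.
- rewrite -!(ge0_independent_fubini mE mF iEF)//.
  rewrite [LHS]integralE.
  by congr (_ - _)%E; apply: eq_integral => w _; rewrite ?funeposE ?funenegE.
- apply: intI => // x; rewrite -[leRHS]/((abse \o (EFin \o f)) x) fune_abse.
  by rewrite leeDl.
- apply: intI => // x; rewrite -[leRHS]/((abse \o (EFin \o f)) x) fune_abse.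
  by rewrite leeDr.
Qed.

Lemma independent_integralM (f g : T -> R) :
  measurable_wrt <<s E >> f -> measurable_wrt <<s F >> g ->
  P.-integrable setT (EFin \o f) -> P.-integrable setT (EFin \o g) ->
  P.-integrable setT (fun w => (f w * g w)%:E) /\
  (\int[P]_w (f w * g w)%:E = \int[P]_w (f w)%:E * \int[P]_w (g w)%:E)%E.
Proof.
move=> /measurable_wrtP mf /measurable_wrtP mg intf intg.
pose h (x : TE * TF) := f x.1 * g x.2.
have mh : measurable_fun setT h.
  by apply: measurable_funM; [exact: (measurableT_comp mf)|exact: (measurableT_comp mg)].
have inth w : P.-integrable setT (fun w' => (h (w, w'))%:E).
  by rewrite /h/=; under eq_fun do rewrite EFinM; exact: integrableZl.
have inE w : (\int[P]_w' (h (w, w'))%:E = (f w)%:E * \int[P]_w (g w)%:E)%E.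
  by rewrite /h/=; under eq_integral do rewrite EFinM; rewrite integralZl.
have gfin : (\int[P]_w (g w)%:E)%E \is a fin_num by exact: integrable_fin_num.
have [] := @integral_independent_fubini h mh inth.
  rewrite [ltLHS](_ : _ = \int[P]_w (`|(f w)%:E| * \int[P]_w `|(g w)%:E|))%E; last first.
    apply: eq_integral => w _; rewrite /h /=; under eq_integral do rewrite normrM EFinM.
    by rewrite integralZl//; exact: (integrable_abse intg).
  have /integrableP[_ fo] := intf; have /integrableP[_ go] := intg.
  rewrite ge0_integralZr//; last exact: integral_ge0.
    by rewrite lte_mul_pinfty// ?integral_ge0// ge0_fin_numE// integral_ge0.
  by apply: measurableT_comp => //; have /integrableP[] := intf.
move=> ? ->; split => //.
under eq_integral do rewrite inE.
by rewrite -(fineK gfin) integralZr.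
Qed.

End freezing.
End cond_exp_theory.

(** * Almost sure uniqueness of conditional expectations *)

Section cond_exp_unique.
Context d (T : measurableType d) (R : realType) (P : probability T R).
Variables (E : set (set T)) (mE : E `<=` measurable).

Let TE := g_sigma_algebraType E.

Lemma ge0_integral_sub (g : T -> \bar R) (B : set T) :
  measurable_wrt <<s E >> g -> (forall w, 0 <= g w)%E -> <<s E >> B ->
  (\int[distribution P (sub_id mE)]_(w in B) g w = \int[P]_(w in B) g w)%E.
Proof.
move=> /measurable_wrtP mg g0 EB.
rewrite /distribution ge0_integral_pushforward//; exact: measurable_funTS.
Qed.

Lemma ae_sub (Q : T -> Prop) :
  {ae distribution P (sub_id mE), forall w, Q w} -> {ae P, forall w, Q w}.
Proof.
by move=> [N [mN PN QN]]; exists N; split => //; exact: (sub_measurable mE).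
Qed.

(** The usual uniqueness argument is run in the restricted probability space, on the events [D n]
    where both functions are at most [n] and hence integrable; these events exhaust the points where
    both are finite. *)
Lemma ge0_integral_sub_ae_eq (g g' : T -> \bar R) :
  measurable_wrt <<s E >> g -> measurable_wrt <<s E >> g' ->
  (forall w, 0 <= g w)%E -> (forall w, 0 <= g' w)%E ->
  {ae P, forall w, g w \is a fin_num} -> {ae P, forall w, g' w \is a fin_num} ->
  (forall B, <<s E >> B -> \int[P]_(w in B) g w = \int[P]_(w in B) g' w)%E ->
  {ae P, forall w, g w = g' w}.
Proof.
move=> wg wg' g0 g'0 gfin g'fin gg'.
have mg := (measurable_wrtP _ _).1 wg; have mg' := (measurable_wrtP _ _).1 wg'.
pose D (n : nat) : set TE := [set w | g w <= n%:R%:E]%E `&` [set w | g' w <= n%:R%:E]%E.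
have mD n : measurable (D n).
  by apply: measurableI; rewrite -[X in measurable X]setTI; exact: emeasurable_fun_infty_c.
have Dn n : {ae P, forall w, D n w -> g w = g' w}.
  apply: ae_sub; apply: integral_ae_eq => //.
  - apply/integrableP; split; first exact: measurable_funTS.
    apply: (@le_lt_trans _ _ (\int[distribution P (sub_id mE)]_(w in D n) (cst n%:R%:E w)))%E.
      apply: ge0_le_integral => //.
      + by apply: measurableT_comp => //; exact: measurable_funTS.
      + by move=> w [/= gn _]; rewrite gee0_abs.
    by rewrite integral_cst// lte_mul_pinfty// ?lee_fin// ltey_eq fin_num_measure.
  - exact: measurable_funTS.
  - move=> B BD mB; rewrite !ge0_integral_sub//; exact: gg'.
move/ae_foralln : Dn => Dn.
apply: filterS3 gfin g'fin Dn => w gw g'w Dw.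
apply: (Dw (Num.truncn (Num.max (fine (g w)) (fine (g' w)))).+1).
have /ltW := truncnS_gt (Num.max (fine (g w)) (fine (g' w))).
by rewrite ge_max -!lee_fin !fineK// => /andP[].
Qed.

Lemma ae_eq_is_cond_exp_ge0 (f f' g : T -> \bar R) :
  measurable_fun setT f -> measurable_fun setT f' ->
  (forall w, 0 <= f w)%E -> (forall w, 0 <= f' w)%E ->
  {ae P, forall w, f w = f' w} ->
  is_cond_exp_ge0 P <<s E >> f g -> is_cond_exp_ge0 P <<s E >> f' g.
Proof.
move=> mf mf' f0 f'0 ff' [mg g0 fg]; split => // B EB.
have mB := sub_measurable mE EB.
rewrite fg//; apply: ge0_ae_eq_integral => //.
- exact: measurable_funTS.
- exact: measurable_funTS.
- by apply: filterS ff' => w ->.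
Qed.

Lemma ae_eq_is_cond_exp (eta eta' g : T -> R) :
  measurable_fun setT eta -> measurable_fun setT eta' ->
  {ae P, forall w, eta w = eta' w} ->
  is_cond_exp P <<s E >> eta g -> is_cond_exp P <<s E >> eta' g.
Proof.
move=> me me' ee' [mg [gp [gm [gpE gmE ggpm]]]]; split => //.
exists gp, gm; split => //.
- apply: ae_eq_is_cond_exp_ge0 gpE.
  + by apply/measurable_EFinP; exact: measurable_funrpos.
  + by apply/measurable_EFinP; exact: measurable_funrpos.
  + by move=> w; rewrite lee_fin funrpos_ge0.
  + by move=> w; rewrite lee_fin funrpos_ge0.
  + by apply: filterS ee' => w; rewrite /= /funrpos => ->.
- apply: ae_eq_is_cond_exp_ge0 gmE.
  + by apply/measurable_EFinP; exact: measurable_funrneg.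
  + by apply/measurable_EFinP; exact: measurable_funrneg.
  + by move=> w; rewrite lee_fin funrneg_ge0.
  + by move=> w; rewrite lee_fin funrneg_ge0.
  + by apply: filterS ee' => w; rewrite /= /funrneg => ->.
Qed.

Lemma is_cond_exp_unique (eta g g' : T -> R) :
  is_cond_exp P <<s E >> eta g -> is_cond_exp P <<s E >> eta g' ->
  {ae P, forall w, g w = g' w}.
Proof.
move=> [mg [gp [gm [[mgp gp0 gpE] [mgm gm0 gmE] gE]]]].
move=> [mg' [gp' [gm' [[mgp' gp'0 gp'E] [mgm' gm'0 gm'E] g'E]]]].
have fin (u v : T -> \bar R) (a : T -> R) : {ae P, forall w, (a w)%:E = (u w - v w)%E} ->
    {ae P, forall w, u w \is a fin_num} /\ {ae P, forall w, v w \is a fin_num}.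
  move=> auv; split; apply: filterS auv => w auv.
    by have : (a w)%:E \is a fin_num by []; rewrite auv fin_numB => /andP[].
  by have : (a w)%:E \is a fin_num by []; rewrite auv fin_numB => /andP[].
have [gpf gmf] := fin _ _ _ gE; have [gpf' gmf'] := fin _ _ _ g'E.
have pE : {ae P, forall w, gp w = gp' w}.
  by apply: ge0_integral_sub_ae_eq => // B EB; rewrite gpE// gp'E.
have mE' : {ae P, forall w, gm w = gm' w}.
  by apply: ge0_integral_sub_ae_eq => // B EB; rewrite gmE// gm'E.
apply: filterS2 (filterI gE g'E) (filterI pE mE') => w [gw g'w] [pw mw].
by apply: EFin_inj; rewrite gw g'w pw mw.
Qed.

(** The choice made by [cond_exp] is a genuine version as soon as one exists. The almost surely
    equal [eta'] serves for the conditional covariance, whose integrand contains conditional means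
    known only almost surely. *)
Lemma cond_exp_ae (eta eta' g : T -> R) :
  measurable_fun setT eta -> measurable_fun setT eta' ->
  {ae P, forall w, eta w = eta' w} ->
  is_cond_exp P <<s E >> eta' g ->
  measurable_wrt <<s E >> (cond_exp P <<s E >> eta) /\
  {ae P, forall w, cond_exp P <<s E >> eta w = g w}.
Proof.
move=> me me' ee' gE.
have hE : is_cond_exp P <<s E >> eta g.
  by apply: ae_eq_is_cond_exp gE => //; apply: filterS ee' => w ->.
have cE : is_cond_exp P <<s E >> eta (cond_exp P <<s E >> eta).
  by apply: (@xgetPex _ (cst 0) [set g | is_cond_exp P <<s E >> eta g]); exists g.
by split; [case: cE|exact: is_cond_exp_unique cE hE].
Qed.

End cond_exp_unique.

(** * Integrals of derivatives over the whole line *)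

Section integral_derivative.
Context (R : realType).
Notation mu := (@lebesgue_measure R).

(** By the fundamental theorem of calculus the integral over [-n, n] is F(n) - F(-n), which tends to
    0 because [F] decays like C / |x - m|; dominated convergence identifies the limit. *)
Lemma integral_derive_eq0 (F f : R -> R) (m C : R) :
  (forall x : R, is_derive x 1 F (f x)) -> continuous f ->
  mu.-integrable setT (EFin \o f) ->
  (forall x, `|x - m| * `|F x| <= C) ->
  (\int[mu]_x (f x)%:E = 0)%E.
Proof.
move=> dF cf intf FC.
have C0 : 0 <= C by apply: le_trans (FC m); rewrite subrr normr0 mul0r.
have mf : measurable_fun setT f by exact: continuous_measurable_fun.
have F0 (e : R) (e0 : 0 < e) : \forall n \near \oo, `|F n%:R| < e /\ `|F (- n%:R)| < e.
  (* From this rank on, |x| = n forces |x - m| > C / e, and the decay bound gives |F x| < e. *)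
  exists (Num.truncn (`|m| + C / e)).+1 => // n /= nN.
  have nlt : `|m| + C / e < n%:R.
    by apply: lt_le_trans (truncnS_gt _) _; rewrite ler_nat.
  suff bnd x : `|x| = n%:R -> `|F x| < e.
    by split; apply: bnd; rewrite ?normrN ger0_norm.
  move=> xn; have xm : C / e < `|x - m|.
    rewrite -(ltrD2l `|m|); apply: lt_le_trans nlt _.
    by rewrite -xn -[X in `|X| <= _](subrK m) addrC ler_normD.
  have xm0 : 0 < `|x - m| by apply: le_lt_trans xm; rewrite divr_ge0// ltW.
  rewrite -(ltr_pM2l xm0); apply: le_lt_trans (FC x) _.
  by rewrite -ltr_pdivrMr.
pose g (n : nat) (x : R) := ((f x)%:E * (\1_`[- n%:R, n%:R] x)%:E)%E.
have gE (n : nat) : (0 < n)%N -> (\int[mu]_x g n x = (F n%:R - F (- n%:R))%:E)%E.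
  move=> n0; rewrite /g.
  pose D : set R := [set` `[- n%:R, n%:R]].
  transitivity (\int[mu]_(x in D) (EFin \o f) x)%E.
    by rewrite [RHS]integral_mkcond; apply: eq_integral => x _; rewrite epatch_indic.
  rewrite /D /= (@continuous_FTC2 _ f F)//.
  - by rewrite gtrN// ltr0n.
  - exact: continuous_subspaceT.
  - have cF : continuous F by move=> x; apply: differentiable_continuous; apply/derivable1_diffP;
      exact: ex_derive.
    split.
    + by move=> x _; exact: ex_derive.
    + apply: cvg_at_right_filter; exact: cF.
    + apply: cvg_at_left_filter; exact: cF.
  - by move=> x _; rewrite derive1E; exact: derive_val.
have [] := @dominated_convergence _ _ _ mu setT measurableT g (EFin \o f) (abse \o (EFin \o f)).
- move=> n; rewrite /g; apply: emeasurable_funM; apply/measurable_EFinP => //.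
- exact/measurable_EFinP.
- apply: aeW => x _.
  apply: cvg_near_cst; exists (Num.truncn `|x|).+1 => // n /= nN.
  rewrite /g indicE mem_set ?mule1//= in_itv/= -ler_norml ltW//.
  by apply: lt_le_trans (truncnS_gt _) _; rewrite ler_nat.
- exact: integrable_abse.
- apply: aeW => x n _; rewrite /g -EFinM /= lee_fin indicE.
  by case: (_ \in _); rewrite ?mulr1// mulr0 normr0.
move=> _ _ cv.
apply/esym; apply: (cvg_unique _ _ cv) => //=.
rewrite -[0%E]/(0%:E).
apply: (@cvg_trans _ ((fun n : nat => (F n%:R - F (- n%:R))%:E) @ \oo)).
  apply: near_eq_cvg; exists 1%N => // n /= n1.
  by rewrite gE.
apply: cvg_EFin; first by apply: nearW.
apply/cvgr0Pnorm_lt => e e0.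
have e20 : 0 < e / 2 by rewrite divr_gt0.
apply: filterS (F0 _ e20) => n [h1 h2] /=.
apply: le_lt_trans (ler_normB _ _) _.
by rewrite (splitr e) ltrD.
Qed.

End integral_derivative.

(** * Moments and cosine transforms of normal densities *)

Section gaussian_integrals.
Context (R : realType).
Notation mu := (@lebesgue_measure R).
Variables (m s : R).
Hypothesis s0 : s != 0.

Let s20 : 0 < s ^+ 2.
Proof. by rewrite exprn_even_gt0. Qed.

Lemma is_derive_normal_pdf (x : R) :
  is_derive x 1 (normal_pdf m s) (- ((x - m) / s ^+ 2) * normal_pdf m s x).
Proof.
rewrite normal_pdfE//.
have h : is_derive x 1 (fun x : R => - (x - m) ^+ 2 / (s ^+ 2 *+ 2)) (- ((x - m) / s ^+ 2)).
  apply: is_derive_eq.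
  rewrite /GRing.scale /=; field. exact: s0.
rewrite /normal_fun.
have h2 := @is_derive1_comp R expR (fun x : R => - (x - m) ^+ 2 / (s ^+ 2 *+ 2)) x _ _
  (is_derive_expR _) h.
apply: is_derive_eq.
by rewrite /GRing.scale /=; ring.
Qed.

(** Doubling the width leaves a factor exp(-u) with u = (3/8) (x - m)^2 / s^2, since 1/2 - 1/8 =
    3/8; then u exp(-u) <= 1 produces the constant 8/3. The bound yields both integrability and
    boundedness of the left side. *)
Lemma sqr_normal_pdf_le (x : R) : (x - m) ^+ 2 * normal_pdf m s x <=
  (8 / 3 * s ^+ 2) * (normal_peak s / normal_peak (2 * s)) * normal_pdf m (2 * s) x.
Proof.
have s20' : 2 * s != 0 by rewrite mulf_neq0.
rewrite !normal_pdfE//.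
set p := normal_peak s; set q := normal_peak _.
have q0 : q != 0 by rewrite gt_eqF// normal_peak_gt0.
have -> : 8 / 3 * s ^+ 2 * (p / q) * (q * normal_fun m (2 * s) x) =
   p * (8 / 3 * s ^+ 2 * normal_fun m (2 * s) x) by field.
rewrite mulrCA ler_pM2l ?normal_peak_gt0//.
set y := x - m.
pose u := 3 / 8 * (y ^+ 2 / s ^+ 2).
have -> : normal_fun m s x = normal_fun m (2 * s) x * expR (- u).
  rewrite /normal_fun -expRD; congr expR; rewrite /u /y; field; exact: s0.
have -> : y ^+ 2 = 8 / 3 * s ^+ 2 * u by rewrite /u; field; exact: s0.
have h : u * expR (- u) <= 1.
  rewrite expRN ler_pdivrMr ?expR_gt0// mul1r.
  by apply: le_trans (expR_ge1Dx u); rewrite lerDr.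
rewrite [leLHS](_ : _ = 8 / 3 * s ^+ 2 * normal_fun m (2 * s) x * (u * expR (- u))); last by ring.
apply: ler_piMr => //; rewrite mulr_ge0 ?normal_fun_ge0//.
by rewrite mulr_ge0 ?sqr_ge0.
Qed.

Lemma integrable_sqr_normal_pdf :
  mu.-integrable setT (fun x => ((x - m) ^+ 2 * normal_pdf m s x)%:E).
Proof.
pose C := (8 / 3 * s ^+ 2) * (normal_peak s / normal_peak (2 * s)).
have C0 : 0 <= C.
  apply: mulr_ge0; first by rewrite mulr_ge0 ?sqr_ge0.
  by rewrite mulr_ge0 ?invr_ge0 ?normal_peak_ge0.
apply: (@le_integrable _ _ _ mu _ measurableT _ (fun x => (C * normal_pdf m (2 * s) x)%:E)).
- apply/measurable_EFinP; apply: measurable_funM; last exact: measurable_normal_pdf.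
  by apply: measurable_funX; exact: measurable_funB.
- move=> x _; rewrite !abse_EFin lee_fin ger0_norm; last first.
    by rewrite mulr_ge0 ?sqr_ge0 ?normal_pdf_ge0.
  rewrite ger0_norm; first exact: sqr_normal_pdf_le.
  by rewrite mulr_ge0 ?normal_pdf_ge0.
- by under eq_fun do rewrite EFinM; apply: integrableZl => //; exact: integrable_normal_pdf.
Qed.

Lemma integrableM_normal_pdf (f : R -> R) (c : R) : measurable_fun setT f ->
  (forall x, `|f x| <= c * (1 + (x - m) ^+ 2)) ->
  mu.-integrable setT (fun x => (f x * normal_pdf m s x)%:E).
Proof.
move=> mf fc.
apply: (@le_integrable _ _ _ mu _ measurableT _
  (fun x => c%:E * ((normal_pdf m s x)%:E + ((x - m) ^+ 2 * normal_pdf m s x)%:E))%E).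
- apply/measurable_EFinP; apply: measurable_funM; last exact: measurable_normal_pdf.
  exact: mf.
- move=> x _; rewrite -EFinD -EFinM !abse_EFin lee_fin.
  apply: (le_trans _ (ler_norm _)); rewrite normrM; rewrite (ger0_norm (normal_pdf_ge0 _ _ _)).
  rewrite [leRHS](_ : _ = c * (1 + (x - m) ^+ 2) * normal_pdf m s x); last by ring.
  by rewrite ler_wpM2r ?normal_pdf_ge0.
- apply: integrableZl => //; apply: integrableD => //; first exact: integrable_normal_pdf.
  exact: integrable_sqr_normal_pdf.
Qed.

(** Stein's identity: [g] times the density has derivative (g' - (x - m) g / s^2) times the density,
    and the integral of this derivative vanishes. Taking [g] linear, constant or a sine gives the
    variance, the mean and the cosine transform. *)
Lemma integral_derive_normal_pdf (g g' : R -> R) (c : R) :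
  (forall x : R, is_derive x 1 g (g' x)) -> continuous g' ->
  (forall x, `|g x| * `|x - m| <= c * (1 + (x - m) ^+ 2)) ->
  mu.-integrable setT (fun x => (g' x * normal_pdf m s x)%:E) ->
  (\int[mu]_x ((x - m) * g x * normal_pdf m s x)%:E =
   (s ^+ 2)%:E * \int[mu]_x (g' x * normal_pdf m s x)%:E)%E.
Proof.
move=> dg cg' gc intg'.
have cg : continuous g.
  by move=> x; apply: differentiable_continuous; apply/derivable1_diffP; exact: ex_derive.
have intg : mu.-integrable setT (fun x => ((x - m) * g x * normal_pdf m s x)%:E).
  apply: (@integrableM_normal_pdf (fun x => (x - m) * g x) c).
    apply: continuous_measurable_fun => x; apply: cvgM; last exact: cg.
    by apply: cvgB; [exact: cvg_id|exact: cvg_cst].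
  by move=> x; rewrite normrM mulrC.
(* [C1] bounds (1 + (x - m)^2) times the density, so that [c * C1] is the decay constant of [g]
   times the density. *)
pose C1 := normal_peak s + (8 / 3 * s ^+ 2) * (normal_peak s / normal_peak (2 * s)) *
  normal_peak (2 * s).
have pdfC x : (1 + (x - m) ^+ 2) * normal_pdf m s x <= C1.
  rewrite mulrDl mul1r lerD ?normal_pdf_ub//; apply: le_trans (sqr_normal_pdf_le x) _.
  rewrite ler_wpM2l ?normal_pdf_ub ?mulf_neq0//.
  apply: mulr_ge0; first by rewrite mulr_ge0 ?sqr_ge0.
  by rewrite mulr_ge0 ?invr_ge0 ?normal_peak_ge0.
have c0 : 0 <= c.
  have := gc m; rewrite subrr normr0 mulr0 expr0n addr0 mulr1; exact.
pose F x := g x * normal_pdf m s x.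
pose f x := g' x * normal_pdf m s x - (s ^+ 2)^-1 * ((x - m) * g x * normal_pdf m s x).
have cpdf : continuous (normal_pdf m s) by exact: continuous_normal_pdf.
have cid : continuous (fun x : R => x - m).
  by move=> x; apply: cvgB; [exact: cvg_id|exact: cvg_cst].
have fE : (\int[mu]_x (f x)%:E = 0)%E.
  apply: (@integral_derive_eq0 R F f m (c * C1)).
  - move=> x; have h := is_derive_normal_pdf x; apply: is_derive_eq.
    by rewrite /f /GRing.scale /=; ring.
  - move=> x; apply: cvgB; first by apply: cvgM; [exact: cg'|exact: cpdf].
    apply: cvgM; first exact: cvg_cst.
    by apply: cvgM; [apply: cvgM; [exact: cid|exact: cg]|exact: cpdf].
  - rewrite /f /comp; under eq_fun do rewrite EFinB EFinM.
    by apply: integrableB => //; under eq_fun do rewrite EFinM; exact: integrableZl.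
  - move=> x; rewrite normrM (ger0_norm (normal_pdf_ge0 _ _ _)) mulrA (mulrC `|x - m|).
    apply: le_trans (ler_wpM2r (normal_pdf_ge0 _ _ _) (gc x)) _.
    by rewrite -mulrA ler_wpM2l.
have : (\int[mu]_x (f x)%:E = \int[mu]_x (g' x * normal_pdf m s x)%:E -
   ((s ^+ 2)^-1)%:E * \int[mu]_x ((x - m) * g x * normal_pdf m s x)%:E)%E.
  rewrite -integralZl// -integralB//; last exact: integrableZl.
rewrite fE.
have : (\int[mu]_x (g' x * normal_pdf m s x)%:E)%E \is a fin_num by exact: integrable_fin_num.
have : (\int[mu]_x ((x - m) * g x * normal_pdf m s x)%:E)%E \is a fin_num by exact:
  integrable_fin_num.
case: (integral _ _ _) => // a _; case: (integral _ _ _) => // b _ [] abE.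
rewrite -EFinM; congr EFin; have -> : b = (s ^+ 2)^-1 * a by lra.
by rewrite mulVKf// gt_eqF.
Qed.
Lemma integral_sqr_normal_pdf :
  (\int[mu]_x ((x - m) ^+ 2 * normal_pdf m s x)%:E = (s ^+ 2)%:E)%E.
Proof.
have d1 (x : R) : is_derive x 1 (fun x => x - m) 1.
  by apply: is_derive_eq; rewrite subr0.
have b1 x : `|x - m| * `|x - m| <= 1 * (1 + (x - m) ^+ 2).
  by rewrite mul1r -normrM -expr2 ger0_norm ?sqr_ge0// lerDr.
have i1 : mu.-integrable setT (fun x => ((cst 1 : R -> R) x * normal_pdf m s x)%:E).
  by under eq_fun do rewrite mul1r; exact: integrable_normal_pdf.
have := integral_derive_normal_pdf d1 (fun x => cvg_cst _) b1 i1.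
under [in RHS]eq_integral do rewrite mul1r.
by rewrite integral_normal_pdf mule1 => <-; apply: eq_integral => x _; rewrite expr2.
Qed.

Lemma integral_center_normal_pdf :
  (\int[mu]_x ((x - m) * normal_pdf m s x)%:E = 0)%E.
Proof.
have d1 (x : R) : is_derive x 1 (cst 1 : R -> R) (0 : R) by exact: is_derive_cst.
have b1 x : `|(cst 1 : R -> R) x| * `|x - m| <= 1 * (1 + (x - m) ^+ 2).
  rewrite normr1 !mul1r -[X in _ <= _ + X]real_normK ?num_real//.
  by have := sqr_ge0 (`|x - m| - 1); nra.
have i1 : mu.-integrable setT (fun x => ((cst 0 : R -> R) x * normal_pdf m s x)%:E).
  by under eq_fun do rewrite mul0r; exact: integrable0.
have := integral_derive_normal_pdf d1 (fun x => cvg_cst _) b1 i1.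
rewrite [X in (_ * X)%E]integral0_eq ?mule0; last by move=> x _; rewrite mul0r.
by move=> <-; apply: eq_integral => x _; rewrite mulr1.
Qed.

Section fourier.
Variable theta : R.

Let f (a x : R) := cos (a * (x - m) - theta) * normal_pdf m s x.
Let df (a x : R) := - ((x - m) * sin (a * (x - m) - theta) * normal_pdf m s x).
Let C (a : R) := \int[mu]_x f a x.

Let is_derive_f (a x : R) : is_derive a 1 (f ^~ x) (df a x).
Proof.
rewrite /f.
have h : is_derive a 1 (fun a => a * (x - m) - theta) (x - m).
  by apply: is_derive_eq; rewrite /GRing.scale /=; ring.
have h2 := @is_derive1_comp R cos (fun a : R => a * (x - m) - theta) a _ _
  (is_derive_cos _) h.
by apply: is_derive_eq; rewrite /df /GRing.scale /=; ring.
Qed.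

Let cf (a : R) : continuous (fun x => a * (x - m) - theta).
Proof.
move=> x; apply: cvgB; last exact: cvg_cst.
apply: cvgM; first exact: cvg_cst.
by apply: cvgB; [exact: cvg_id|exact: cvg_cst].
Qed.

Let ccos (a : R) : continuous (fun x => cos (a * (x - m) - theta)).
Proof. by move=> x; apply: continuous_comp; [exact: cf|exact: continuous_cos]. Qed.

Let csin (a : R) : continuous (fun x => sin (a * (x - m) - theta)).
Proof. by move=> x; apply: continuous_comp; [exact: cf|exact: continuous_sin]. Qed.

Let le_1D (x c : R) : `|c| <= 1 -> `|c| <= 1 * (1 + (x - m) ^+ 2).
Proof. by move=> c1; rewrite mul1r; apply: le_trans c1 _; rewrite lerDl sqr_ge0. Qed.

Let int_f (a : R) : mu.-integrable setT (EFin \o f a).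
Proof.
apply: (@integrableM_normal_pdf _ 1); first exact: continuous_measurable_fun.
by move=> x; apply: le_1D; rewrite ler_norml cos_geN1 cos_le1.
Qed.

(** Differentiation under the integral sign, dominated by |x - m| times the density, followed by
    Stein's identity for the sine: the transform solves C' = - a s^2 C. *)
Let derive_C (a : R) : is_derive a 1 C (- (a * s ^+ 2) * C a).
Proof.
pose G x := `|x - m| * normal_pdf m s x.
have intG : mu.-integrable setT (EFin \o G).
  apply: (@integrableM_normal_pdf (fun x => `|x - m|) 1).
    by apply: measurableT_comp => //; exact: measurable_funB.
  move=> x; rewrite normr_id mul1r -[X in _ <= _ + X]real_normK ?num_real//.
  by have := sqr_ge0 (`|x - m| - 1); nra.
have d1f x y : partial1of2 f x y = df x y.
  by rewrite /partial1of2 derive1E; exact: derive_val.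
have Ia : `]a - 1, a + 1[%classic a by rewrite /= in_itv/=; apply/andP; split; lra.
have If x : `]a - 1, a + 1[%classic x -> mu.-integrable setT (EFin \o f x) by [].
have df1 x y : `]a - 1, a + 1[%classic x -> setT y -> derivable (f ^~ y) x 1.
  by move=> _ _; exact: ex_derive.
have G0 y : 0 <= G y by rewrite mulr_ge0 ?normal_pdf_ge0.
have Gub x y : `]a - 1, a + 1[%classic x -> setT y -> `|partial1of2 f x y| <= G y.
  move=> _ _; rewrite d1f /df normrN !normrM (ger0_norm (normal_pdf_ge0 _ _ _)).
  rewrite ler_wpM2r ?normal_pdf_ge0// ler_piMr//.
  by rewrite ler_norml sin_geN1 sin_le1.
have dC := derivable_under_integral measurableT Ia If df1 G0 intG Gub.
have dCE := differentiation_under_integral measurableT Ia If df1 G0 intG Gub.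
apply: DeriveDef; first exact: dC.
rewrite -derive1E dCE /=.
under eq_Rintegral do rewrite d1f.
rewrite /Rintegral /df.
have d1 (x : R) : is_derive x 1 (fun x => sin (a * (x - m) - theta))
    (a * cos (a * (x - m) - theta)).
  have h : is_derive x 1 (fun x => a * (x - m) - theta) a.
    by apply: is_derive_eq; rewrite /GRing.scale /=; ring.
  have h2 := @is_derive1_comp R sin (fun x : R => a * (x - m) - theta) x _ _
    (is_derive_sin _) h.
  by apply: is_derive_eq; rewrite mulrC.
have c1 : continuous (fun x => a * cos (a * (x - m) - theta)).
  by move=> x; apply: cvgM; [exact: cvg_cst|exact: ccos].
have b1 x : `|sin (a * (x - m) - theta)| * `|x - m| <= 1 * (1 + (x - m) ^+ 2).
  apply: (@le_trans _ _ `|x - m|).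
    by rewrite ler_piMl// ler_norml sin_geN1 sin_le1.
  rewrite mul1r -[X in _ <= _ + X]real_normK ?num_real//.
  by have := sqr_ge0 (`|x - m| - 1); nra.
have i1 : mu.-integrable setT
    (fun x => (a * cos (a * (x - m) - theta) * normal_pdf m s x)%:E).
  under eq_fun do rewrite -mulrA EFinM.
  by apply: integrableZl => //; exact: int_f.
have E1 := integral_derive_normal_pdf d1 c1 b1 i1.
have i2 : mu.-integrable setT
    (fun x => ((x - m) * sin (a * (x - m) - theta) * normal_pdf m s x)%:E).
  apply: (@integrableM_normal_pdf _ 1).
    apply: continuous_measurable_fun => x; apply: cvgM; last exact: csin.
    by apply: cvgB; [exact: cvg_id|exact: cvg_cst].
  by move=> x; rewrite normrM mulrC.
under eq_integral do rewrite -mulN1r EFinM.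
rewrite integralZl//.
rewrite E1; under eq_integral do rewrite -mulrA EFinM.
rewrite integralZl//; last exact: int_f.
rewrite -(@fineK _ (\int[mu]_x (f a x)%:E)) ?integrable_fin_num//; last exact: int_f.
by rewrite -!EFinM /= -[X in _ * (a * X)]/(C a); ring.
Qed.

Lemma integral_cos_normal_pdf (a : R) :
  \int[mu]_x (cos (a * (x - m) - theta) * normal_pdf m s x) = cos theta * expR (- (a ^+ 2 *
    s ^+ 2) / 2).
Proof.
rewrite -[LHS]/(C a).
(* The integrating factor makes the product constant; its value at 0 is cos theta. *)
pose g (a : R) := C a * expR (a ^+ 2 * s ^+ 2 / 2).
have dg (b : R) : is_derive b 1 g 0.
  have h : is_derive b 1 (fun b => b ^+ 2 * s ^+ 2 / 2) (b * s ^+ 2).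
    by apply: is_derive_eq; rewrite /GRing.scale /=; field.
  have h2 := @is_derive1_comp R expR (fun b : R => b ^+ 2 * s ^+ 2 / 2) b _ _
    (is_derive_expR _) h.
  have h3 := derive_C b.
  by apply: is_derive_eq; rewrite /GRing.scale /=; ring.
have := is_derive_0_is_cst a 0 dg.
rewrite /g expr0n /= !mul0r expR0 mulr1 => gE.
have -> : C a = C 0 * expR (- (a ^+ 2 * s ^+ 2) / 2).
  by rewrite -gE -mulrA -expRD [X in expR X](_ : _ = 0) ?expR0 ?mulr1//; field.
congr (_ * _); rewrite /C /f.
under eq_Rintegral do rewrite mul0r sub0r cosN.
rewrite /Rintegral; under eq_integral do rewrite EFinM.
by rewrite integralZl ?integral_normal_pdf ?mule1//; exact: integrable_normal_pdf.
Qed.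

End fourier.

End gaussian_integrals.

(** * Integration against a measure given by a density *)

Section density.
Context d (T : measurableType d) (R : realType).
Variables (mu nu : {measure set T -> \bar R}) (g : T -> R).
Hypotheses (mg : measurable_fun setT g) (g0 : forall x, 0 <= g x).
Hypothesis nuE : forall A, measurable A -> (nu A = \int[mu]_(x in A) (g x)%:E)%E.

Import HBNNSimple.

Let nnsfun_density (h : {nnsfun T >-> R}) :
  (\int[nu]_x (h x)%:E = \int[mu]_x ((h x)%:E * (g x)%:E))%E.
Proof.
rewrite integralT_nnsfun sintegralE.
under [in RHS]eq_integral => x _.
  rewrite (fimfunE h x) -fsumEFin// ge0_mule_fsuml; last first.
    by move=> y; exact: nnfun_muleindic_ge0.
  over.
have mh y : measurable (h @^-1` [set y]) by [].
rewrite ge0_integral_fsum//; last 2 first.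
- move=> y; apply/measurable_EFinP.
  by apply: measurable_funM => //; apply: measurable_funM.
- by move=> y x _; rewrite mule_ge0 ?lee_fin//; exact: nnfun_muleindic_ge0.
apply: eq_fsbigr => y /set_mem[w _ <-].
rewrite nuE// integral_mkcond -ge0_integralZl//.
- by apply: eq_integral => x _; rewrite epatch_indic /= EFinM -muleA [(_ * (\1__ _)%:E)%E]muleC.
- apply/(measurable_restrictT _ _).1 => //.
  by apply/measurable_EFinP; exact: measurable_funTS.
- by move=> x _; apply: erestrict_ge0 => z _; rewrite lee_fin.
- by rewrite lee_fin.
Qed.

Lemma ge0_integral_density (f : T -> \bar R) :
  measurable_fun setT f -> (forall x, 0 <= f x)%E ->
  (\int[nu]_x f x = \int[mu]_x (f x * (g x)%:E))%E.
Proof.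
move=> mf f0.
pose h := nnsfun_approx measurableT mf.
have hf x : (EFin \o h ^~ x) @ \oo --> f x by apply: cvg_nnsfun_approx.
have ndh x : {homo (fun n => h n x) : a b / (a <= b)%N >-> a <= b}.
  by move=> a b ab; exact/lefP/nd_nnsfun_approx.
have -> : (\int[nu]_x f x = limn (fun n => \int[nu]_x (h n x)%:E))%E.
  under eq_integral do rewrite -(cvg_lim _ (hf _))//.
  apply: monotone_convergence => //.
  - by move=> n; apply/measurable_EFinP.
  - by move=> n x _; rewrite lee_fin.
  - by move=> x _ a b ab; rewrite lee_fin; exact: ndh.
have hfg x : ((h n x)%:E * (g x)%:E)%E @[n --> \oo] --> (f x * (g x)%:E)%E.
  by apply: cvgeZr => //; exact: hf.
have -> : (\int[mu]_x (f x * (g x)%:E) = limn (fun n => \int[mu]_x ((h n x)%:E * (g x)%:E)))%E.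
  under eq_integral do rewrite -(cvg_lim _ (hfg _))//.
  apply: monotone_convergence => //.
  - by move=> n; apply: emeasurable_funM; apply/measurable_EFinP.
  - by move=> n x _; rewrite mule_ge0// lee_fin.
  - by move=> x _ a b ab; rewrite lee_wpmul2r ?lee_fin//; exact: ndh.
by congr (limn _); apply/funext => n; exact: nnsfun_density.
Qed.

Lemma integral_density (f : T -> R) :
  measurable_fun setT f -> mu.-integrable setT (fun x => (f x * g x)%:E) ->
  nu.-integrable setT (EFin \o f) /\
  (\int[nu]_x (f x)%:E = \int[mu]_x (f x * g x)%:E)%E.
Proof.
move=> mf intf.
have intn : nu.-integrable setT (EFin \o f).
  apply/integrableP; split; first exact/measurable_EFinP.
  have /integrableP[_] := intf; rewrite ge0_integral_density//.
    congr (_ < _)%E; apply: eq_integral => x _.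
    by rewrite !abse_EFin normrM (ger0_norm (g0 _)).
  by apply: measurableT_comp => //; exact/measurable_EFinP.
split => //.
rewrite [LHS]integralE [RHS]integralE; congr (_ - _)%E.
- rewrite ge0_integral_density//; last by apply: measurable_funepos; exact/measurable_EFinP.
  apply: eq_integral => x _; rewrite !funeposE -!EFin_max -EFinM; congr EFin.
  by rewrite maxr_pMl// mul0r.
- rewrite ge0_integral_density//; last by apply: measurable_funeneg; exact/measurable_EFinP.
  apply: eq_integral => x _; rewrite !funenegE -!EFinN -!EFin_max -EFinM; congr EFin.
  by rewrite maxr_pMl// mul0r mulNr.
Qed.

End density.

(** * Gaussian variables through their moments and transforms *)

Section gaussian_variable_moments.
Context d (T : measurableType d) (R : realType) (P : probability T R).

(** What is used of a Gaussian law. The variance may be 0, so degenerate variables are covered; the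
    free phase makes the last clause equivalent to the formula for the characteristic function,
    sines being cosines at a phase pi/2. *)
Definition gaussian_moments (Z : T -> R) (m v : R) : Prop :=
  [/\ P.-integrable setT (EFin \o Z),
      (\int[P]_w (Z w)%:E = m%:E)%E,
      P.-integrable setT (fun w => ((Z w - m) ^+ 2)%:E),
      (\int[P]_w ((Z w - m) ^+ 2)%:E = v%:E)%E &
      forall a theta, (\int[P]_w (cos (a * Z w - theta))%:E =
                       (cos (a * m - theta) * expR (- (a ^+ 2 * v) / 2))%:E)%E].

Lemma integrable_bounded (f : T -> R) (c : R) : measurable_fun setT f ->
  (forall w, `|f w| <= c) -> P.-integrable setT (EFin \o f).
Proof.
move=> mf fc; apply: measurable_bounded_integrable => //.
  by rewrite ltey_eq fin_num_measure.
exists c; split; first exact: num_real.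
by move=> x cx w _; apply: le_trans (fc w) (ltW cx).
Qed.

Lemma measurable_cosB (a theta : R) : measurable_fun setT (fun x : R => cos (a * x - theta)).
Proof.
apply: continuous_measurable_fun => x; apply: continuous_comp; last exact: continuous_cos.
apply: cvgB; last exact: cvg_cst.
by apply: cvgM; [exact: cvg_cst|exact: cvg_id].
Qed.

Lemma gaussian_momentsP (Z : {RV P >-> R}) (m s : R) :
  (forall B : set R, measurable B ->
     P (Z @^-1` B) = if s == 0 then \d_m B else normal_prob m s B) ->
  gaussian_moments Z m (s ^+ 2).
Proof.
move=> law.
have [s00|sn0] := eqVneq s 0.
  rewrite s00 eqxx in law.
  have Zm : {ae P, forall w, Z w = m}.
    exists (Z @^-1` [set~ m]); split => //.
      rewrite -[X in measurable X]setTI; apply: (@measurable_funPT _ _ _ _ Z) => //.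
      exact: measurableC.
    rewrite law; last exact: measurableC.
    by rewrite diracE memNset//= => /(_ erefl).
  have tr (f : R -> R) : measurable_fun setT f ->
      P.-integrable setT (fun w => (f (Z w))%:E) /\ (\int[P]_w (f (Z w))%:E = (f m)%:E)%E.
    move=> mf.
    have mfZ : measurable_fun setT (fun w => (f (Z w))%:E).
      by apply/measurable_EFinP; exact: measurableT_comp.
    have aeE : {ae P, forall w, setT w -> (f (Z w))%:E = (f m)%:E}.
      by apply: filterS Zm => w -> _.
    have intc : P.-integrable setT (cst (f m)%:E).
      exact: finite_measure_integrable_cst.
    split; last first.
      rewrite (ae_eq_integral (cst (f m)%:E))//.
      by rewrite integral_cst// [X in (_ * X)%E](_ : _ = 1%E) ?mule1//; exact: probability_setT.
    apply/integrableP; split => //.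
    rewrite (ae_eq_integral (abse \o cst (f m)%:E))//.
    - by have /integrableP[] := intc.
    - exact: measurableT_comp.
    - exact: measurable_cst.
    - by apply: filterS aeE => w h _; have [/= ->] := h I.
  have [i1 e1] := tr id (@measurable_id _ _ _).
  have mq : measurable_fun setT (fun x : R => (x - m) ^+ 2).
    by apply: measurable_funX; exact: measurable_funB.
  have [i2 e2] := tr _ mq.
  split => //; first by rewrite e2 subrr s00.
  move=> a theta; have [_ ->] := tr _ (measurable_cosB a theta).
  by rewrite s00 expr0n mulr0 oppr0 mul0r expR0 mulr1.
rewrite (negbTE sn0) in law.
(* Repackaging [Z] with values in [measurableTypeR R] lets its law be compared with [normal_prob]
   and its Lebesgue density. *)
have mZ : measurable_fun setT (Z : T -> measurableTypeR R) by exact: (@measurable_funPT _ _ _ _ Z).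
pose Z' : {RV P >-> measurableTypeR R} :=
  HB.pack (Z : T -> measurableTypeR R) (isMeasurableFun.Build _ _ _ _ _ mZ).
have tr (f : R -> R) (c : R) : measurable_fun setT f ->
    (forall x, `|f x| <= c * (1 + (x - m) ^+ 2)) ->
      P.-integrable setT (fun w => (f (Z w))%:E) /\
      (\int[P]_w (f (Z w))%:E = \int[lebesgue_measure]_x (f x * normal_pdf m s x)%:E)%E.
  move=> mf fc; have intf := integrableM_normal_pdf sn0 mf fc.
  have [|||] := @integral_density _ _ R lebesgue_measure (distribution P Z') (normal_pdf m s) _ _
    _ f mf intf.
  - exact: measurable_normal_pdf.
  - by move=> x; exact: normal_pdf_ge0.
  - by move=> A mA; rewrite -[RHS]/(normal_prob m s A) -law.
  move=> i1 e1.
  have mEf : measurable_fun [set: measurableTypeR R] (EFin \o f) by exact/measurable_EFinP.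
  have i2 : P.-integrable setT (fun w => (f (Z w))%:E).
    apply/integrableP; split; first by apply/measurable_EFinP; exact: measurableT_comp.
    have /integrableP[_] := i1; rewrite ge0_integral_distribution//.
    exact: measurableT_comp.
  split => //; rewrite -e1; symmetry; exact: (@integral_distribution _ _ _ _ _ P Z').
(* Quadratic growth bounds, under which [tr] transfers each of the three integrals to the line. *)
have [x1 x2 x3] : [/\ forall x, `|x| <= (1 + `|m|) * (1 + (x - m) ^+ 2),
   forall x, `|(x - m) ^+ 2| <= 1 * (1 + (x - m) ^+ 2) &
   forall a theta x, `|cos (a * x - theta)| <= 1 * (1 + (x - m) ^+ 2)].
  split => [x|x|a theta x].
  - have h : `|x| <= `|x - m| + `|m| by rewrite -[X in `|X| <= _](subrK m) ler_normD.
    have := sqr_ge0 (`|x - m| - 1); have : `|x - m| ^+ 2 = (x - m) ^+ 2 by rewrite real_normK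
      ?num_real.
    by have := normr_ge0 m; have := normr_ge0 (x - m); have := sqr_ge0 (x - m); nra.
  - by rewrite mul1r ger0_norm ?sqr_ge0// lerDr.
  - rewrite mul1r; apply: (@le_trans _ _ 1); last by rewrite lerDl sqr_ge0.
    by rewrite ler_norml cos_geN1 cos_le1.
have mq : measurable_fun setT (fun x : R => (x - m) ^+ 2).
  by apply: measurable_funX; exact: measurable_funB.
have [i1 e1] := tr id _ (@measurable_id _ _ _) x1.
have [i2 e2] := tr _ _ mq x2.
split => //.
- rewrite e1 (_ : (fun x => _) = (fun x => ((x - m) * normal_pdf m s x)%:E +
    m%:E * (normal_pdf m s x)%:E)%E); last first.
    by apply/funext => x; rewrite -EFinM -EFinD -mulrDl subrK.
  have ic : (@lebesgue_measure R).-integrable setT (fun x => ((x - m) * normal_pdf m s x)%:E).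
    apply: (@integrableM_normal_pdf _ _ _ sn0 (fun x => x - m) 1); first exact: measurable_funB.
    move=> x; rewrite mul1r; have := sqr_ge0 (`|x - m| - 1).
    by have : `|x - m| ^+ 2 = (x - m) ^+ 2 by [rewrite real_normK ?num_real]; nra.
  have ip := integrable_normal_pdf m s.
  rewrite integralD//; last exact: integrableZl.
  by rewrite integral_center_normal_pdf// add0e integralZl// integral_normal_pdf mule1.
- by rewrite e2 integral_sqr_normal_pdf.
- move=> a theta; have [i3 ->] := tr _ _ (measurable_cosB a theta) (x3 a theta).
  (* Centring the variable moves the mean into the phase. *)
  have E x : a * (x - m) - (theta - a * m) = a * x - theta by ring.
  have -> : cos (a * m - theta) = cos (theta - a * m) by rewrite -cosN opprB.
  have := @integral_cos_normal_pdf R m s sn0 (theta - a * m) a.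
  move=> <-; rewrite /Rintegral; under [in RHS]eq_integral do rewrite E.
  rewrite fineK//; apply: integrable_fin_num => //.
  by apply: (@integrableM_normal_pdf _ _ _ sn0 (fun x => cos (a * x - theta)) 1) => //;
    exact: measurable_cosB.
Qed.

Lemma gaussian_variableP (Z : {RV P >-> R}) :
  gaussian_variable P Z -> exists m v, gaussian_moments Z m v.
Proof. by move=> [m [s [_ law]]]; exists m, (s ^+ 2); exact: gaussian_momentsP. Qed.

End gaussian_variable_moments.

(** * Smoothed indicators of half-lines *)

Section normal_concentration.
Context (R : realType).
Notation mu := (@lebesgue_measure R).

(** Chebyshev's inequality, from the second moment of the normal density. *)
Lemma normal_prob_far_le (u s r : R) (A : set (measurableTypeR R)) :
  measurable A -> s != 0 -> 0 < r -> (forall x, A x -> r <= `|x - u|) ->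
  (normal_prob u s A <= (s ^+ 2 / r ^+ 2)%:E)%E.
Proof.
move=> mA s0 r0 Ar.
have mpdf : measurable_fun setT (normal_pdf u s) by exact: measurable_normal_pdf.
have mq : measurable_fun setT (fun x : measurableTypeR R => (x - u) ^+ 2).
  by apply: measurable_funX; exact: measurable_funB.
have mg : measurable_fun setT (fun x : measurableTypeR R => ((x - u) ^+ 2 * normal_pdf u s x)%:E).
  by apply/measurable_EFinP; exact: measurable_funM.
have mgr : measurable_fun setT (fun x : measurableTypeR R =>
    ((r ^+ 2)^-1)%:E * ((x - u) ^+ 2 * normal_pdf u s x)%:E)%E.
  by apply/measurable_EFinP; apply: measurable_funM => //; exact: measurable_funM.
have g0 x : 0 <= (x - u) ^+ 2 * normal_pdf u s x by rewrite mulr_ge0 ?sqr_ge0 ?normal_pdf_ge0.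
have r20 : 0 < r ^+ 2 by rewrite exprn_gt0.
apply: (@le_trans _ _ (\int[mu]_(x in A) (((r ^+ 2)^-1)%:E * ((x - u) ^+ 2 *
  normal_pdf u s x)%:E))%E).
  apply: ge0_le_integral => //.
  - by move=> x _; rewrite lee_fin normal_pdf_ge0.
  - by apply: measurable_funTS; exact/measurable_EFinP.
  - exact: measurable_funTS.
  - move=> x Ax; rewrite -EFinM lee_fin mulrA ler_peMl ?normal_pdf_ge0//.
    rewrite mulrC ler_pdivlMr// mul1r -[leRHS]real_normK ?num_real//.
    by rewrite ler_pXn2r ?nnegrE ?(ltW r0)//; exact: Ar.
apply: (@le_trans _ _ (\int[mu]_x (((r ^+ 2)^-1)%:E * ((x - u) ^+ 2 * normal_pdf u s x)%:E))%E).
  apply: ge0_subset_integral => //.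
  by move=> x _; rewrite -EFinM lee_fin mulr_ge0// invr_ge0 ltW.
rewrite ge0_integralZl//.
- by rewrite integral_sqr_normal_pdf// -EFinM lee_fin mulrC.
- by move=> x _; rewrite lee_fin.
- by rewrite lee_fin invr_ge0 ltW.
Qed.

(* The width is negligible with respect to the shift of the threshold, so that the
   limit is the indicator also at u = b. *)
Definition smooth_step (b : R) (n : nat) (u : R) : \bar R :=
  normal_prob u (harmonic n ^+ 2) [set` `[b - harmonic n, +oo[].

Lemma cvg_smooth_step (b u : R) :
  smooth_step b n u @[n --> \oo] --> (\1_[set` `[b, +oo[] u)%:E.
Proof.
have h0 n : 0 < harmonic n :> R by exact: harmonic_gt0.
have h1 n : harmonic n <= 1 :> R by rewrite /= invf_le1 ?ler1n ?ltr0n.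
have hn0 n : harmonic n ^+ 2 != 0 :> R by rewrite gt_eqF ?exprn_gt0.
have ch : @harmonic R @ \oo --> 0 by exact: cvg_harmonic.
have mY n : measurable ([set` `[b - harmonic n,
  +oo[] : set (measurableTypeR R)) by exact: measurable_itv.
have fin n : smooth_step b n u = (fine (smooth_step b n u))%:E.
  by rewrite fineK// /smooth_step fin_num_measure.
rewrite (funext fin); apply: cvg_EFin; first exact: nearW.
rewrite indicE; have [bu|ub] := leP b u.
  have far1 (y k : R) : 0 < k -> y < b - k -> k <= `|y - u|.
    by move=> k0 yk; rewrite ler0_norm; lra.
  rewrite mem_set /=; last by rewrite in_itv/= bu.
  (* With k = [harmonic n], the missing mass lies at distance at least k from [u] while the width is
     k^2: Chebyshev gives k^4 / k^2 = k^2 <= k. *)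
  apply: (@squeeze_cvgr _ _ _ _ (fun n => 1 - harmonic n) (cst 1)).
  - apply: nearW => n; rewrite -!lee_fin -fin; apply/andP; split; last exact: probability_le1.
    have := @probability_setC _ _ _ (normal_prob u (harmonic n ^+ 2)) _ (measurableC (mY n)).
    rewrite setCK => E1; rewrite /smooth_step E1 EFinB; apply: leeB => //.
    apply: le_trans (normal_prob_far_le (measurableC (mY n)) (hn0 n) (h0 n) _) _.
      move=> x /=; rewrite in_itv/= andbT => /negP; rewrite -ltNge => xb.
      exact: (far1 x _ (h0 n) xb).
    rewrite lee_fin; move: (h0 n) (h1 n); move: (harmonic n) => x x0 x1.
    have -> : (x ^+ 2) ^+ 2 / x ^+ 2 = x ^+ 2 by field; rewrite gt_eqF.
    by nra.
  - by rewrite -[X in _ --> X]subr0; apply: cvgB => //; exact: cvg_cst.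
  - exact: cvg_cst.
rewrite memNset /=; last by rewrite in_itv/= andbT leNgt ub.
(* Once [harmonic n] is below half the gap between [u] and [b], the shifted half-line stays at
   distance at least [r] from [u]. *)
pose r := (b - u) / 2; have r0 : 0 < r by rewrite /r; lra.
have far2 (y k : R) : k < r -> b - k <= y -> r <= `|y - u|.
  by rewrite /r => kr yk; rewrite ger0_norm; lra.
apply: (@squeeze_cvgr _ _ _ _ (cst 0) (fun n => harmonic n / r ^+ 2)).
- have hrn : \forall n \near \oo, harmonic n < r by exact: (cvgr_lt _ ch).
  apply: filterS hrn => n hr; rewrite -!lee_fin -fin; apply/andP; split.
    exact: measure_ge0.
  apply: le_trans (normal_prob_far_le (mY n) (hn0 n) r0 _) _.
    move=> x /=; rewrite in_itv/= andbT => xb.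
    exact: (far2 x _ hr xb).
  rewrite lee_fin ler_pM2r ?invr_gt0 ?exprn_gt0//.
  move: (h0 n) (h1 n); move: (harmonic n) => x x0 x1.
  by rewrite expr2 (@le_trans _ _ (x ^+ 2 * 1)) ?ler_wpM2l ?sqr_ge0//; nra.
- exact: cvg_cst.
- by rewrite -[X in _ --> X](mul0r (r ^+ 2)^-1); apply: cvgM => //; exact: cvg_cst.
Qed.

End normal_concentration.

(** * Weighted laws and their smoothing by a Gaussian kernel *)

Section weighted_law.
Context d (T : measurableType d) (R : realType) (P : probability T R).
Variables (U G : T -> R) (mU : measurable_fun setT U) (mG : measurable_fun setT G).
Variables (c : R) (G0 : forall w, 0 <= G w) (Gc : forall w, G w <= c).
Notation mu := (@lebesgue_measure R).

(** The hypotheses on [U] and [G] are arguments so that the measure instance below can be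
    attached. *)
Definition weighted_law of measurable_fun setT U & measurable_fun setT G
    & (forall w, 0 <= G w) : set R -> \bar R :=
  fun B => (\int[P]_(w in U @^-1` B) (G w)%:E)%E.

Let law := weighted_law mU mG G0.

Let law0 : law set0 = 0%E.
Proof. by rewrite /law /weighted_law preimage_set0 integral_set0. Qed.

Let law_ge0 B : (0 <= law B)%E.
Proof. by apply: integral_ge0 => w _; rewrite lee_fin. Qed.

Let law_sigma_additive : semi_sigma_additive law.
Proof.
move=> F mF tF mUF; rewrite /law /weighted_law preimage_bigcup ge0_integral_bigcup//.
- apply: is_cvg_ereal_nneg_natsum_cond => n _ _.
  by apply: integral_ge0 => w _; rewrite lee_fin.
- by move=> n; rewrite -[X in measurable X]setTI; exact: mU.
- by apply: measurable_funTS; exact/measurable_EFinP.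
- by move=> w _; rewrite lee_fin.
- apply/trivIsetP => i j _ _ ij; rewrite -preimage_setI.
  by move/trivIsetP : tF => ->//; rewrite preimage_set0.
Qed.

HB.instance Definition _ := isMeasure.Build _ _ _ law law0 law_ge0 law_sigma_additive.

Let bounded_G (f : T -> R) (k : R) : measurable_fun setT f -> (forall w, `|f w| <= k) ->
  P.-integrable setT (fun w => (G w * f w)%:E).
Proof.
move=> mf fk; apply: (@integrable_bounded _ _ _ _ _ (c * k)); first exact: measurable_funM.
by move=> w; rewrite normrM (ger0_norm (G0 w)) ler_pM.
Qed.

Lemma measurable_cos : measurable_fun setT (@cos R).
Proof. by apply: continuous_measurable_fun; exact: continuous_cos. Qed.

(** A Gaussian function of width [s] is the cosine transform of the normal density of width 1/s,
    taken at U w - x; Fubini then expresses the left side through the cosine transforms of the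
    weighted law. *)
Lemma integral_weight_normal_fun (x s : R) : 0 < s ->
  (\int[P]_w (G w * normal_fun x s (U w))%:E =
   \int[mu]_t ((normal_pdf 0 s^-1 t)%:E * \int[P]_w (G w * cos (t * U w - t * x))%:E))%E.
Proof.
move=> s0; have sn0 : s != 0 by rewrite gt_eqF.
have sVn0 : s^-1 != 0 by rewrite invr_eq0.
pose f (z : T * measurableTypeR R) := (G z.1 * cos (z.2 * U z.1 - z.2 * x) * normal_pdf 0 s^-1 z.2).
have mcos := measurable_cos.
have mf : measurable_fun setT f.
  apply: measurable_funM.
    apply: measurable_funM; first exact: (measurableT_comp mG).
    apply: (measurableT_comp mcos); apply: measurable_funB.
      apply: measurable_funM; first exact: measurable_snd.
      exact: (measurableT_comp mU).
    by apply: measurable_funM => //; exact: measurable_snd.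
  by apply: (measurableT_comp (measurable_normal_pdf 0 s^-1)); exact: measurable_snd.
have mEf : measurable_fun setT (EFin \o f) by exact/measurable_EFinP.
have intf : (P \x mu)%E.-integrable setT (EFin \o f).
  apply: (integrable12ltyP _ _ mEf).2.
  have c0 : 0 <= c by apply: le_trans (G0 point) (Gc point).
  apply: (@le_lt_trans _ _ (\int[P]_w c%:E)%E); last first.
    by rewrite integral_cst// lte_mul_pinfty// ?lee_fin// ltey_eq fin_num_measure.
  apply: ge0_le_integral => //.
  - by move=> w _; exact: integral_ge0.
  - apply: (measurable_fun_fubini_tonelli_F (abse \o (EFin \o f))).
      exact: measurableT_comp.
    by move=> z /=.
  - move=> w _; rewrite -[leRHS]mule1 -(integral_normal_pdf 0 s^-1) -integralZl//;
      last exact: integrable_normal_pdf.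
    apply: ge0_le_integral => //.
    + by apply: measurableT_comp => //; apply: (measurableT_comp mEf).
    + by apply: measurable_funeM; apply/measurable_EFinP; exact: measurable_normal_pdf.
    + move=> t _; rewrite /f /= -EFinM lee_fin normrM (ger0_norm (normal_pdf_ge0 _ _ _)).
      rewrite ler_wpM2r ?normal_pdf_ge0// normrM (ger0_norm (G0 _)) -[leRHS]mulr1.
      by rewrite ler_pM// ler_norml cos_geN1 cos_le1.
transitivity (\int[P]_w \int[mu]_t (f (w, t))%:E)%E.
  apply: eq_integral => w _; rewrite /f /=.
  have E1 := @integral_cos_normal_pdf R 0 s^-1 sVn0 0 (U w - x).
  have intc : mu.-integrable setT
      (fun t => (cos ((U w - x) * (t - 0) - 0) * normal_pdf 0 s^-1 t)%:E).
    apply: (@integrableM_normal_pdf _ _ _ sVn0 _ 1).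
      apply: (measurableT_comp mcos); apply: measurable_funB => //.
      by apply: measurable_funM => //; exact: measurable_funB.
    move=> t; rewrite mul1r; apply: (@le_trans _ _ 1); last by rewrite lerDl sqr_ge0.
    by rewrite ler_norml cos_geN1 cos_le1.
  transitivity ((G w)%:E * \int[mu]_t (cos ((U w - x) * (t - 0) - 0) * normal_pdf 0 s^-1 t)%:E)%E.
    rewrite -[X in (_ * X)%E]fineK; last exact: integrable_fin_num.
    rewrite -[fine _]/(Rintegral _ _ _) E1 cos0 mul1r -EFinM /normal_fun.
    by congr (_ * expR _)%:E; field.
  rewrite -integralZl//; apply: eq_integral => t _; rewrite -EFinM; congr EFin.
  by rewrite mulrA; congr (_ * cos _ * _); ring.
rewrite (Fubini intf); apply: eq_integral => t _; rewrite /f/=.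
under eq_integral do rewrite EFinM.
rewrite integralZr 1?muleC//; apply: (@bounded_G _ 1) => [|w].
- apply: (measurableT_comp mcos); apply: measurable_funB => //.
  exact: measurable_funM.
- by rewrite ler_norml cos_geN1 cos_le1.
Qed.

End weighted_law.

Section weighted_smoothing.
Context d (T : measurableType d) (R : realType) (P : probability T R).
Variables (U G : T -> R) (mU : measurable_fun setT U) (mG : measurable_fun setT G).
Variables (c : R) (G0 : forall w, 0 <= G w) (Gc : forall w, G w <= c).
Notation mu := (@lebesgue_measure R).

Section smoothed.
Variables (s : R) (Y : set (measurableTypeR R)).
Hypotheses (mY : measurable Y) (s0 : s != 0).

Let g (z : T * measurableTypeR R) : R := expR (- (z.2 - U z.1) ^+ 2 / (s ^+ 2 *+ 2)).
Let f (z : T * measurableTypeR R) := (normal_peak s * \1_Y z.2 * (G z.1 * g z))%:E.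

Let mf : measurable_fun setT f.
Proof.
apply/measurable_EFinP; apply: measurable_funM.
  apply: measurable_funM => //.
  exact: (measurableT_comp (@measurable_indic _ _ _ _ Y mY) measurable_snd).
apply: measurable_funM => //; first exact: (measurableT_comp mG).
apply: (measurableT_comp (@measurable_expR R)); apply: measurable_funM => //.
apply: measurableT_comp => //; apply: measurable_funX.
apply: measurable_funB; first exact: measurable_snd.
exact: (measurableT_comp mU).
Qed.

Let f0 z : (0 <= f z)%E.
Proof.
rewrite lee_fin mulr_ge0//; first by rewrite mulr_ge0 ?normal_peak_ge0.
by rewrite mulr_ge0// expR_ge0.
Qed.

Let fE w : ((G w)%:E * normal_prob (U w) s Y = \int[mu]_x f (w, x))%E.
Proof.
rewrite /normal_prob [in LHS]integral_mkcond -ge0_integralZl_EFin//; last 2 first.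
- by move=> x _; apply: erestrict_ge0 => z _; rewrite lee_fin normal_pdf_ge0.
- apply/(measurable_restrictT _ _).1 => //.
  by apply: measurable_funTS; apply/measurable_EFinP; exact: measurable_normal_pdf.
apply: eq_integral => x _; rewrite epatch_indic /f /g /= normal_pdfE// /normal_fun.
by rewrite -!EFinM; congr EFin; ring.
Qed.

Lemma measurable_weight_normal_prob :
  measurable_fun setT (fun w => (G w)%:E * normal_prob (U w) s Y)%E.
Proof. by rewrite (funext fE); exact: (measurable_fun_fubini_tonelli_F f). Qed.

(** Tonelli, the kernel being read first as a density centred at [U w], then by symmetry as a
    function of [U w] centred at [x]; in this second form it is determined by the cosine
    transforms. *)
Lemma integral_weight_normal_prob :
  (\int[P]_w ((G w)%:E * normal_prob (U w) s Y) =
   \int[mu]_x ((normal_peak s * \1_Y x)%:E * \int[P]_w (G w * normal_fun x s (U w))%:E))%E.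
Proof.
under eq_integral do rewrite fE.
rewrite (fubini_tonelli f mf f0); apply: eq_integral => x _.
have mgx : measurable_fun setT (fun w => (G w * normal_fun x s (U w))%:E).
  apply/measurable_EFinP; apply: measurable_funM => //.
  exact: (measurableT_comp (measurable_normal_fun x s)).
transitivity (\int[P]_w ((normal_peak s * \1_Y x)%:E * (G w * normal_fun x s (U w))%:E))%E.
  apply: eq_integral => w _; rewrite /f /g /normal_fun -EFinM /=.
  by rewrite -(opprB x) sqrrN.
rewrite (@ge0_integralZl_EFin _ _ _ P setT measurableT (fun w => (G w *
  normal_fun x s (U w))%:E))//.
- by move=> w _; rewrite lee_fin mulr_ge0 ?normal_fun_ge0.
- by rewrite mulr_ge0 ?normal_peak_ge0.
Qed.

End smoothed.

Lemma cvg_weight_smooth_step (b : R) :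
  (\int[P]_w ((G w)%:E * smooth_step b n (U w)) @[n --> \oo] -->
   \int[P]_(w in U @^-1` [set` `[b, +oo[]) (G w)%:E)%E.
Proof.
rewrite integral_mkcond.
have mY : measurable ([set` `[b, +oo[] : set R) by exact: measurable_itv.
have sfin n u : (smooth_step b n u) \is a fin_num by rewrite /smooth_step fin_num_measure.
have ms n : measurable_fun setT (fun w => (G w)%:E * smooth_step b n (U w))%E.
  apply: measurable_weight_normal_prob; first exact: measurable_itv.
  by rewrite gt_eqF// exprn_gt0// harmonic_gt0.
pose A := U @^-1` [set` `[b, +oo[].
have mA : measurable A by rewrite -[X in measurable X]setTI; exact: mU.
have [] := @dominated_convergence _ _ _ P setT measurableT
  (fun n w => (G w)%:E * smooth_step b n (U w))%E
  ((fun w => (G w)%:E) \_ A) (cst c%:E) ms.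
- apply/(measurable_restrictT _ _).1 => //.
  by apply: measurable_funTS; exact/measurable_EFinP.
- apply: aeW => w _.
  rewrite (epatch_indic (fun w => (G w)%:E)) /=.
  by apply: cvgeZl => //; exact: cvg_smooth_step.
- exact: finite_measure_integrable_cst.
- apply: aeW => w n _.
  have s0 : (0 <= smooth_step b n (U w))%E by exact: measure_ge0.
  rewrite gee0_abs ?mule_ge0 ?lee_fin//.
  rewrite -[leRHS]mule1; apply: lee_pmul; rewrite ?lee_fin//.
  exact: probability_le1.
by [].
Qed.

End weighted_smoothing.

(** * Equality of weighted laws from their cosine transforms *)

Section fourier_unique.
Context d (T : measurableType d) (R : realType) (P : probability T R).
Variables (U G1 G2 : T -> R) (mU : measurable_fun setT U).
Variables (mG1 : measurable_fun setT G1) (mG2 : measurable_fun setT G2).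
Variable c : R.
Hypotheses (G10 : forall w, 0 <= G1 w) (G1c : forall w, G1 w <= c).
Hypotheses (G20 : forall w, 0 <= G2 w) (G2c : forall w, G2 w <= c).
Hypothesis G12 : forall a y,
  (\int[P]_w (G1 w * cos (a * U w - y))%:E = \int[P]_w (G2 w * cos (a * U w - y))%:E)%E.

(** Equality passes from cosines to Gaussian functions, to smoothed half-lines and, in the limit, to
    closed half-lines, which form a pi-system generating the Borel sets. *)
Lemma fourier_unique (B : set R) : measurable B ->
  (\int[P]_(w in U @^-1` B) (G1 w)%:E = \int[P]_(w in U @^-1` B) (G2 w)%:E)%E.
Proof.
have nf x s : 0 < s -> (\int[P]_w (G1 w * normal_fun x s (U w))%:E =
    \int[P]_w (G2 w * normal_fun x s (U w))%:E)%E.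
  move=> s0; have -> := integral_weight_normal_fun P mU mG1 G10 G1c x s0.
  have -> := integral_weight_normal_fun P mU mG2 G20 G2c x s0.
  by apply: eq_integral => t _; rewrite G12.
have step b n : (\int[P]_w ((G1 w)%:E * smooth_step b n (U w)) =
    \int[P]_w ((G2 w)%:E * smooth_step b n (U w)))%E.
  have s0 : 0 < harmonic n ^+ 2 :> R by rewrite exprn_gt0// harmonic_gt0.
  have mY : measurable ([set` `[b - harmonic n,
    +oo[] : set (measurableTypeR R)) by exact: measurable_itv.
  have sn0 : harmonic n ^+ 2 != 0 :> R by rewrite gt_eqF.
  have -> := integral_weight_normal_prob P mU mG1 G10 mY sn0.
  have -> := integral_weight_normal_prob P mU mG2 G20 mY sn0.
  by apply: eq_integral => x _; rewrite nf.
have tail b : (\int[P]_(w in U @^-1` [set` `[b, +oo[]) (G1 w)%:E =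
    \int[P]_(w in U @^-1` [set` `[b, +oo[]) (G2 w)%:E)%E.
  have h1 := @cvg_weight_smooth_step _ _ _ P _ _ mU mG1 c G10 G1c b.
  have h2 := @cvg_weight_smooth_step _ _ _ P _ _ mU mG2 c G20 G2c b.
  rewrite (funext (step b)) in h1.
  exact: (cvg_unique _ h1 h2).
move=> mB.
pose m1 : {measure set R -> \bar R} := weighted_law P mU mG1 G10.
pose m2 : {measure set R -> \bar R} := weighted_law P mU mG2 G20.
have intG1 : P.-integrable setT (EFin \o G1).
  by apply: (@integrable_bounded _ _ _ _ _ c) => // w; rewrite ger0_norm.
apply: (measure_unique (@RGenCInfty.G R) (fun n => [set` `[(- n%:R), +oo[]) _ _ _ _
  m1 m2) => //.
- exact: RGenCInfty.measurableE.
- move=> _ _ [x ->] [y ->]; exists (Num.max x y).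
  by apply/seteqP; split => z /=; rewrite !in_itv/= !andbT ge_max => /andP.
- by move=> n; exists (- n%:R).
- apply/seteqP; split => // x _; exists (Num.truncn `|x|).+1 => //=.
  rewrite in_itv/= andbT lerNl; apply: le_trans (ltW (truncnS_gt _)).
  by rewrite -normrN ler_norm.
- by move=> _ [x ->]; exact: tail.
- move=> n; rewrite /m1 /= /weighted_law.
  have mI : measurable ([set` `[(- n%:R), +oo[] : set R) by exact: measurable_itv.
  have mA : measurable (U @^-1` [set` `[(- n%:R), +oo[]).
    by rewrite -[X in measurable X]setTI; exact: mU.
  have /integrableP[_] := integrableS measurableT mA (@subsetT _ _) intG1.
  by under eq_integral do rewrite /= ger0_norm//.
Qed.

End fourier_unique.

Lemma EFin_addI (R : realType) (r : R) (x y : \bar R) :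
  (r%:E + x = r%:E + y)%E -> x = y.
Proof. by case: x y => [x| |] [y| |]// [] /addrI ->. Qed.

(** * Several coordinates: a weighted Cramer-Wold argument *)

Section cramer_wold.
Context d (T : measurableType d) (R : realType) (P : probability T R).

Lemma measurable_lin_comb n (a : nat -> R) (U : nat -> T -> R) :
  (forall i, measurable_fun setT (U i)) ->
  measurable_fun setT (fun w => \sum_(i < n) a i * U i w).
Proof. by move=> mU; apply: measurable_sum => i; exact: measurable_funM. Qed.

Lemma measurable_cos_comp (f : T -> R) (y : R) : measurable_fun setT f ->
  measurable_fun setT (fun w => cos (f w - y)).
Proof.
move=> mf; have := measurableT_comp (measurable_cosB 1 y) mf.
by apply: eq_measurable_fun => w _ /=; rewrite mul1r.
Qed.

Lemma norm_cos_le1 (x : R) : `|cos x| <= 1.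
Proof. by rewrite ler_norml cos_geN1 cos_le1. Qed.

Lemma integralDZ (f g : T -> R) (k : R) :
  P.-integrable setT (EFin \o f) -> P.-integrable setT (EFin \o g) ->
  (\int[P]_w (f w + k * g w)%:E = \int[P]_w (f w)%:E + k%:E * \int[P]_w (g w)%:E)%E.
Proof.
move=> intf intg; rewrite -integralZl// -integralD//; last exact: integrableZl.
Qed.

Lemma integral_mul_indic (f : T -> R) (A : set T) :
  (\int[P]_(w in A) (f w)%:E = \int[P]_w (f w * \1_A w)%:E)%E.
Proof.
rewrite integral_mkcond; apply: eq_integral => w _.
by rewrite (epatch_indic (fun w => (f w)%:E)).
Qed.

Lemma cosM (x y : R) : cos x * cos y = 2^-1 * (cos (x + y) + cos (x - y)).
Proof. by rewrite cosD cosB; field. Qed.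

(* By induction on n: the last coordinate is absorbed in the weights, after
   replacing cos by 1 + cos to keep them nonnegative. *)
Lemma cramer_wold n (U : nat -> T -> R) (mU : forall i, measurable_fun setT (U i)) :
  forall (G1 G2 : T -> R) (c : R), measurable_fun setT G1 -> measurable_fun setT G2 ->
  (forall w, 0 <= G1 w <= c) -> (forall w, 0 <= G2 w <= c) ->
  (forall (a : nat -> R) y, \int[P]_w (G1 w * cos (\sum_(i < n) a i * U i w - y))%:E =
               \int[P]_w (G2 w * cos (\sum_(i < n) a i * U i w - y))%:E)%E ->
  forall B : nat -> set R, (forall i, measurable (B i)) ->
  (\int[P]_(w in \bigcap_(i in `I_n) (U i @^-1` B i)) (G1 w)%:E =
   \int[P]_(w in \bigcap_(i in `I_n) (U i @^-1` B i)) (G2 w)%:E)%E.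
Proof.
elim: n => [|n IH] G1 G2 c mG1 mG2 G1c G2c G12 B mB.
  have := G12 (fun=> 0) 0; rewrite II0 bigcap_set0.
  by under eq_integral do rewrite big_ord0 subr0 cos0 mulr1;
     under [in RHS]eq_integral do rewrite big_ord0 subr0 cos0 mulr1.
have mA : measurable (U n @^-1` B n) by rewrite -[X in measurable X]setTI; exact: mU.
set A := U n @^-1` B n in mA *.
have mc (a : nat -> R) y : measurable_fun setT (fun w => cos (\sum_(i < n) a i * U i w - y)).
  by apply: measurable_cos_comp; exact: measurable_lin_comb.
have mUn b z : measurable_fun setT (fun w => cos (b * U n w - z)).
  by apply: measurable_cos_comp; exact: measurable_funM.
have intG (G f : T -> R) (k : R) : measurable_fun setT G -> measurable_fun setT f ->
    (forall w, 0 <= G w <= c) -> (forall w, `|f w| <= k) ->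
    P.-integrable setT (EFin \o (fun w => G w * f w)).
  move=> mG mf Gc fk; apply: (@integrable_bounded _ _ _ _ _ (c * k)).
    exact: measurable_funM.
  by move=> w; have /andP[g0 gc] := Gc w; rewrite normrM (ger0_norm g0) ler_pM.
have ext (a : nat -> R) b y : exists a' : nat -> R, forall w,
    \sum_(i < n) a i * U i w + b * U n w - y = \sum_(i < n.+1) a' i * U i w - y.
  exists (fun i => if (i < n)%N then a i else b) => w; rewrite big_ord_recr /= ltnn.
  by congr (_ + _ - _); apply: eq_bigr => i _; rewrite ltn_ord.
have G12n b z : (\int[P]_w (G1 w * cos (b * U n w - z))%:E =
                 \int[P]_w (G2 w * cos (b * U n w - z))%:E)%E.
  have [a' a'E] := ext (fun=> 0) b z.
  have E0 w : cos (b * U n w - z) = cos (\sum_(i < n.+1) a' i * U i w - z).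
    by rewrite -a'E big1 ?add0r// => i _; rewrite mul0r.
  under eq_integral do rewrite E0; under [in RHS]eq_integral do rewrite E0.
  exact: G12.
have A1 : (\int[P]_(w in A) (G1 w)%:E = \int[P]_(w in A) (G2 w)%:E)%E.
  apply: (@fourier_unique _ _ _ P (U n) G1 G2 _ _ _ c) => //.
  - by move=> w; case/andP: (G1c w).
  - by move=> w; case/andP: (G1c w).
  - by move=> w; case/andP: (G2c w).
  - by move=> w; case/andP: (G2c w).
(* The weights G (1 + cos S) lie between 0 and 2c. Times a cosine of the last coordinate, they split
   by [cosM] into cosines of combinations of n + 1 coordinates, to which [G12] applies. *)
have A2 (a : nat -> R) y : (\int[P]_(w in A) (G1 w * (1 + cos (\sum_(i < n) a i * U i w - y)))%:E =
               \int[P]_(w in A) (G2 w * (1 + cos (\sum_(i < n) a i * U i w - y)))%:E)%E.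
  pose H (G : T -> R) w := G w * (1 + cos (\sum_(i < n) a i * U i w - y)).
  have mH (G : T -> R) : measurable_fun setT G -> measurable_fun setT (H G).
    by move=> mG; apply: measurable_funM => //; exact: measurable_funD.
  have Hc (G : T -> R) : (forall w, 0 <= G w <= c) -> forall w, 0 <= H G w <= c * 2.
    move=> Gc w; have /andP[g0 gc] := Gc w; rewrite /H.
    have := cos_geN1 (\sum_(i < n) a i * U i w - y); have := cos_le1 (\sum_(i < n) a i * U i w - y).
    move: (cos _) => x x1 xN1; apply/andP; split; first by apply: mulr_ge0 => //; lra.
    by apply: ler_pM => //; lra.
  apply: (@fourier_unique _ _ _ P (U n) (H G1) (H G2) _ _ _ (c * 2)) => //; do ?exact: mH.
  - by move=> w; case/andP: (Hc _ G1c w).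
  - by move=> w; case/andP: (Hc _ G1c w).
  - by move=> w; case/andP: (Hc _ G2c w).
  - by move=> w; case/andP: (Hc _ G2c w).
  move=> b z.
  have [ap apE] := ext a b (y + z); have [am amE] := ext a (- b) (y - z).
  have HE (G : T -> R) : measurable_fun setT G -> (forall w, 0 <= G w <= c) ->
    (\int[P]_w (H G w * cos (b * U n w - z))%:E =
     \int[P]_w (G w * cos (b * U n w - z))%:E + 2^-1%:E *
      (\int[P]_w (G w * cos (\sum_(i < n.+1) ap i * U i w - (y + z)))%:E + 1%:E *
       \int[P]_w (G w * cos (\sum_(i < n.+1) am i * U i w - (y - z)))%:E))%E.
    move=> mG Gc; rewrite -integralDZ; last 2 first.
    - apply: intG => // [|w]; last exact: norm_cos_le1.
      by apply: measurable_cos_comp; exact: measurable_lin_comb.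
    - apply: intG => // [|w]; last exact: norm_cos_le1.
      by apply: measurable_cos_comp; exact: measurable_lin_comb.
    rewrite -integralDZ.
    - apply: eq_integral => w _; rewrite /H -apE -amE; congr EFin.
      set S := \sum_(i < n) _; rewrite mulrDr mulr1 mulrDl; congr (_ + _).
      rewrite -mulrA cosM mul1r -mulrDr mulrCA; congr (_ * (_ * (cos _ + cos _))); ring.
    - by apply: intG => // w; exact: norm_cos_le1.
    - rewrite (_ : _ \o _ = EFin \o (fun w => G w * (cos (\sum_(i < n.+1) ap i * U i w - (y +
        z)) + cos (\sum_(i < n.+1) am i * U i w - (y - z))))); last first.
        by apply/funext => w /=; rewrite mul1r mulrDr.
      apply: (intG _ _ 2) => // [|w].
        by apply: measurable_funD; apply: measurable_cos_comp; exact: measurable_lin_comb.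
      by apply: le_trans (ler_normD _ _) _; rewrite (_ : 2 = 1 + 1)// lerD ?norm_cos_le1.
  by rewrite !HE// G12n !G12.
(* The constant 1 in the weights is removed by means of [A1]; the subtraction is legitimate because
   the integrals over [A] are finite. *)
have A3 (a : nat -> R) y : (\int[P]_w ((G1 w * \1_A w) * cos (\sum_(i < n) a i * U i w - y))%:E =
               \int[P]_w ((G2 w * \1_A w) * cos (\sum_(i < n) a i * U i w - y))%:E)%E.
  have := A2 a y; rewrite !(integral_mul_indic _ A).
  have HE (G : T -> R) : measurable_fun setT G -> (forall w, 0 <= G w <= c) ->
    (\int[P]_w (G w * (1 + cos (\sum_(i < n) a i * U i w - y)) * \1_A w)%:E =
     \int[P]_w (G w * \1_A w)%:E + 1%:E *
     \int[P]_w ((G w * \1_A w) * cos (\sum_(i < n) a i * U i w - y))%:E)%E.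
    move=> mG Gc.
    rewrite -integralDZ.
    - by apply: eq_integral => w _; congr EFin; ring.
    - apply: (intG _ _ 1) => // w; rewrite indicE; case: (_ \in _); by rewrite ?normr1 ?normr0.
    - rewrite (_ : _ \o _ = EFin \o (fun w => G w * (\1_A w * cos (\sum_(i < n) a i *
        U i w - y)))); last first.
        by apply/funext => w /=; rewrite mulrA.
      apply: (intG _ _ 1) => // [|w]; first exact: measurable_funM.
      by rewrite indicE; case: (_ \in _); rewrite ?mul1r ?mul0r ?normr0 ?norm_cos_le1.
  rewrite !HE// !mul1e -!(integral_mul_indic _ A) A1.
  have : (\int[P]_(w in A) (G2 w)%:E)%E \is a fin_num.
    rewrite (integral_mul_indic _ A); apply: integrable_fin_num => //.
    apply: (intG _ _ 1) => // w; rewrite indicE; case: (_ \in _); by rewrite ?normr1 ?normr0.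
  move=> /fineK <-.
  exact: EFin_addI.
have indB (G : T -> R) : (forall w, 0 <= G w <= c) -> forall w, 0 <= G w * \1_A w <= c.
  move=> Gc w; have /andP[g0 gc] := Gc w; rewrite indicE.
  by case: (_ \in _); rewrite ?mulr1 ?mulr0 ?lexx/= ?g0// (le_trans g0 gc).
have := IH _ _ c _ _ (indB _ G1c) (indB _ G2c) A3 B mB.
have SE (G : T -> R) : (\int[P]_(w in \bigcap_(i in `I_n.+1) (U i @^-1` B i)) (G w)%:E =
    \int[P]_(w in \bigcap_(i in `I_n) (U i @^-1` B i)) (G w * \1_A w)%:E)%E.
  rewrite [LHS]integral_mul_indic [RHS]integral_mul_indic.
  apply: eq_integral => w _; congr EFin.
  have -> : \bigcap_(i in `I_n.+1) (U i @^-1` B i) = A `&` \bigcap_(i in `I_n) (U i @^-1` B i).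
    apply/seteqP; split => z /=.
      by move=> h; split => [|i /= ni]; apply: h => //=; exact: ltnW.
    by move=> [zA h] i /=; rewrite ltnS leq_eqVlt => /orP[/eqP->//|]; exact: h.
  by rewrite indicI /= mulrA.
by rewrite !SE; apply; exact: measurable_funM.
Qed.

End cramer_wold.

(** * From factorised transforms to independence *)

Section rectangles.
Context d (T : measurableType d) (R : realType) (P : probability T R).

(** Unlike preimages under single coordinates, these sets form a pi-system containing the whole
    space, while generating the sigma-algebra of the first [p] variables. *)
Definition rectangles (Z : nat -> T -> R) (p : nat) : set (set T) :=
  [set A | exists B : nat -> set R, (forall i, measurable (B i)) /\
     A = \bigcap_(i in `I_p) (Z i @^-1` B i)].

Lemma rectangles_measurable (Z : nat -> T -> R) p :
  (forall i, measurable_fun setT (Z i)) -> rectangles Z p `<=` measurable.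
Proof.
move=> mZ _ [B [mB ->]]; rewrite bigcap_mkcond; apply: bigcapT_measurable => i.
by case: ifP => // _; rewrite -[X in measurable X]setTI; exact: mZ.
Qed.

Lemma rectangles_setI (Z : nat -> T -> R) p : setI_closed (rectangles Z p).
Proof.
move=> _ _ [B [mB ->]] [C [mC ->]]; exists (fun i => B i `&` C i); split.
  by move=> i; exact: measurableI.
by rewrite -bigcapI.
Qed.

Lemma rectangles_setT (Z : nat -> T -> R) p : rectangles Z p setT.
Proof.
exists (fun=> setT); split => //.
by apply/seteqP; split.
Qed.

Lemma rectangles_preimage (Z : nat -> T -> R) p i (B : set R) : (i < p)%N ->
  measurable B -> rectangles Z p (Z i @^-1` B).
Proof.
move=> ip mB; exists (fun j => if j == i then B else setT); split.
  by move=> j; case: ifP.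
apply/seteqP; split => w /=.
  by move=> Zi j /= jp; case: ifPn => // /eqP ->.
by move=> /(_ i ip); rewrite eqxx.
Qed.

Lemma integral_probability_cst (c : R) : (\int[P]_w c%:E = c%:E)%E.
Proof. by rewrite integral_cst// -[RHS]mule1; congr (_ * _)%E; exact: probability_setT. Qed.

Section factorization.
Variables (Z V : nat -> T -> R) (p q : nat).
Hypotheses (mZ : forall i, measurable_fun setT (Z i)).
Hypotheses (mV : forall i, measurable_fun setT (V i)).
Hypothesis cosZV : forall (a b : nat -> R) x y,
  (\int[P]_w (cos (\sum_(i < p) a i * Z i w - x) * cos (\sum_(i < q) b i * V i w - y))%:E =
   \int[P]_w (cos (\sum_(i < p) a i * Z i w - x))%:E *
   \int[P]_w (cos (\sum_(i < q) b i * V i w - y))%:E)%E.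

Let int_bounded1 (f : T -> R) : measurable_fun setT f -> (forall w, `|f w| <= 1) ->
  P.-integrable setT (EFin \o f).
Proof. by move=> mf f1; exact: (@integrable_bounded _ _ _ _ _ 1). Qed.

Let mcosZ (a : nat -> R) x :
  measurable_fun setT (fun w => cos (\sum_(i < p) a i * Z i w - x)).
Proof. by apply: measurable_cos_comp; exact: measurable_lin_comb. Qed.

Let mcosV (b : nat -> R) y :
  measurable_fun setT (fun w => cos (\sum_(i < q) b i * V i w - y)).
Proof. by apply: measurable_cos_comp; exact: measurable_lin_comb. Qed.

Let norm_cosM (x y : R) : `|cos x * cos y| <= 1.
Proof. by rewrite normrM mulr_ile1// norm_cos_le1. Qed.

(** For a fixed cosine on the [V] side, of mean k, [cosZV] says that the weights 1 + cos and 1 + k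
    have the same transforms along [Z]. They thus have the same mass on [C], and the constant parts
    cancel. *)
Let factor_rectangle (C : set T) (b : nat -> R) y : rectangles Z p C ->
  (\int[P]_w (\1_C w * cos (\sum_(i < q) b i * V i w - y))%:E =
   \int[P]_w (fine (P C) * cos (\sum_(i < q) b i * V i w - y))%:E)%E.
Proof.
move=> rC; have mC := rectangles_measurable mZ rC; case: rC => B [mB CE].
pose k := fine (\int[P]_w (cos (\sum_(i < q) b i * V i w - y))%:E)%E.
have kE : (\int[P]_w (cos (\sum_(i < q) b i * V i w - y))%:E)%E = k%:E.
  rewrite fineK//; apply: integrable_fin_num => //.
  by apply: int_bounded1 => // w; exact: norm_cos_le1.
pose G1 w := 1 + cos (\sum_(i < q) b i * V i w - y).
have G1E : (\int[P]_w (G1 w)%:E)%E = (1 + k)%:E.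
  have := integralDZ 1 (finite_measure_integrable_cst P 1 measurableT) (int_bounded1 (mcosV b y)
    (fun w => norm_cos_le1 _)).
  rewrite kE [X in (X + _)%E](integral_probability_cst 1) mul1e => E1; rewrite EFinD -E1.
  by apply: eq_integral => w _; rewrite mul1r.
have G1c w : 0 <= G1 w <= 2.
  have := cos_geN1 (\sum_(i < q) b i * V i w - y); have := cos_le1 (\sum_(i < q) b i * V i w - y).
  by rewrite /G1; move: (cos _) => c c1 cN1; apply/andP; split; lra.
have k2 : 0 <= 1 + k <= 2.
  have mG1 : measurable_fun setT (EFin \o G1) by apply/measurable_EFinP; exact: measurable_funD.
  rewrite -!lee_fin -G1E; apply/andP; split.
    by apply: integral_ge0 => w _; rewrite lee_fin; case/andP: (G1c w).
  apply: (@le_trans _ _ (\int[P]_w (cst 2%:E w))%E).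
    apply: ge0_le_integral => //.
    - by move=> w _; rewrite lee_fin; case/andP: (G1c w).
    - by move=> w _; rewrite lee_fin; case/andP: (G1c w).
  by rewrite (integral_probability_cst 2).
have CW := @cramer_wold _ _ _ P p Z mZ G1 (cst (1 + k)) 2 _ _ G1c (fun=> k2) _ B mB.
have : (\int[P]_(w in C) (G1 w)%:E = \int[P]_(w in C) (cst (1 + k) w)%:E)%E.
  rewrite CE; apply: CW => //; first exact: measurable_funD.
  move=> a x.
  have iZ := int_bounded1 (mcosZ a x) (fun w => norm_cos_le1 _).
  under [in RHS]eq_integral do rewrite EFinM.
  rewrite integralZl// -[(1 + k)%:E]/(1%:E + k%:E)%E.
  have := cosZV a b x y; rewrite kE => E1.
  have mcc : measurable_fun setT (fun w => cos (\sum_(i < p) a i * Z i w - x) *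
      cos (\sum_(i < q) b i * V i w - y)) by exact: measurable_funM.
  have := integralDZ 1 iZ (int_bounded1 mcc (fun w => norm_cosM _ _)).
  rewrite E1 mul1e => E2.
  have fn : (\int[P]_w (cos (\sum_(i < p) a i * Z i w - x))%:E)%E \is a fin_num.
    exact: integrable_fin_num.
  rewrite muleDl ?fin_num_adde_defl// mul1e [(k%:E * _)%E]muleC -E2.
  by apply: eq_integral => w _; rewrite /G1; congr EFin; ring.
rewrite !(integral_mul_indic _ _ C).
have i1 : P.-integrable setT (EFin \o \1_C : T -> \bar R).
  by apply: int_bounded1 => // w; rewrite indicE; case: (_ \in _); rewrite ?normr1 ?normr0.
have mV1 : measurable_fun setT (fun w => \1_C w * cos (\sum_(i < q) b i * V i w - y)).
  exact: measurable_funM.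
have i2 := int_bounded1 mV1.
have i3 : P.-integrable setT (EFin \o (fun w => \1_C w * cos (\sum_(i < q) b i * V i w - y))).
  apply: i2 => w.
  by rewrite indicE; case: (_ \in _); rewrite ?mul1r ?mul0r ?normr0 ?norm_cos_le1.
have PC : P C \is a fin_num by rewrite fin_num_measure.
have E1 : (\int[P]_w (G1 w * \1_C w)%:E =
    P C + \int[P]_w (\1_C w * cos (\sum_(i < q) b i * V i w - y))%:E)%E.
  have := integralDZ 1 i1 i3; rewrite integral_indic// setIT mul1e => <-.
  by apply: eq_integral => w _; rewrite /G1; congr EFin; ring.
have E2 : (\int[P]_w (cst (1 + k) w * \1_C w)%:E = P C + k%:E * P C)%E.
  under eq_integral do rewrite EFinM.
  rewrite integralZl// integral_indic// setIT EFinD muleDl ?fin_num_adde_defl//.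
  by rewrite mul1e.
rewrite E1 E2 -(fineK PC) => h.
under [in RHS]eq_integral do rewrite EFinM.
rewrite integralZl//; last by apply: int_bounded1 => // w; exact: norm_cos_le1.
rewrite kE muleC; move: h.
exact: EFin_addI.
Qed.

(** The Cramer-Wold argument is used a second time, along [V], with the weights 1_C and P(C), whose
    transforms agree by [factor_rectangle]. *)
Lemma independent_rectangles :
  independent_sets P <<s rectangles Z p >> <<s rectangles V q >>.
Proof.
apply: independent_sets_sigma; try exact: rectangles_measurable;
  try exact: rectangles_setI; try exact: rectangles_setT.
move=> C D rC rD.
have mC := rectangles_measurable mZ rC; have mD := rectangles_measurable mV rD.
have PC : P C \is a fin_num by rewrite fin_num_measure.
have PC1 : 0 <= fine (P C) <= 1.
  by rewrite -!lee_fin fineK// measure_ge0 probability_le1.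
have := rD => -[B [mB DE]].
have : (\int[P]_(w in D) (\1_C w)%:E = \int[P]_(w in D) (cst (fine (P C)) w)%:E)%E.
  rewrite DE; apply: (@cramer_wold _ _ _ P q V mV (\1_C) (cst (fine (P C))) 1) => //.
  - by move=> w; rewrite indicE; case: (_ \in _); rewrite ?lexx ?ler01.
  - by move=> b y; exact: factor_rectangle.
rewrite integral_indic// => ->.
by rewrite -[LHS]/(\int[P]_(w in D) cst (fine (P C))%:E w)%E integral_cst// fineK.
Qed.

End factorization.
End rectangles.

(** * Sums of independent centred Gaussian variables *)

Section centered_gaussian.
Context d (T : measurableType d) (R : realType) (P : probability T R).

Lemma gaussian_moments_center (Z : T -> R) (m v : R) :
  gaussian_moments P Z m v -> gaussian_moments P (fun w => Z w - m) 0 v.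
Proof.
move=> [i1 e1 i2 e2 c1].
have ic : P.-integrable setT (EFin \o cst m) by exact: finite_measure_integrable_cst.
split.
- rewrite (_ : _ \o _ = (fun w => (Z w)%:E - (m)%:E)%E)//.
  exact: (integrableB measurableT i1 ic).
- transitivity (\int[P]_w ((Z w)%:E - (cst m w)%:E))%E => //.
  rewrite integralB// e1 (integral_probability_cst P m).
  by rewrite -EFinB subrr.
- by under eq_fun do rewrite subr0.
- by under eq_integral do rewrite subr0.
- move=> a theta; rewrite mulr0 sub0r.
  rewrite -(_ : a * m - (theta + a * m) = - theta); last by ring.
  by rewrite -c1; apply: eq_integral => w _; congr (cos _)%:E; ring.
Qed.

Lemma gaussian_moments_scale (Z : T -> R) (k v : R) :
  gaussian_moments P Z 0 v -> gaussian_moments P (fun w => k * Z w) 0 (k ^+ 2 * v).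
Proof.
move=> [i1 e1 i2 e2 c1].
have e2' : (\int[P]_w (Z w ^+ 2)%:E = v%:E)%E.
  by rewrite -e2; apply: eq_integral => w _; rewrite subr0.
have i2' : P.-integrable setT (fun w => (Z w ^+ 2)%:E).
  by under eq_fun do rewrite -[Z _]subr0.
split.
- rewrite (_ : _ \o _ = (fun w => k%:E * (Z w)%:E)%E)//.
  exact: integrableZl.
- under eq_integral do rewrite EFinM.
  by rewrite integralZl// e1 mule0.
- under eq_fun do rewrite subr0 exprMn EFinM.
  exact: integrableZl.
- under eq_integral do rewrite subr0 exprMn EFinM.
  by rewrite integralZl// e2'.
- move=> a theta; rewrite mulr0 -(mulr0 (a * k)) mulrA -exprMn -c1.
  by apply: eq_integral => w _; rewrite mulrA.
Qed.

Lemma integrableM_sqr (f g : T -> R) : measurable_fun setT f -> measurable_fun setT g ->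
  P.-integrable setT (fun w => (f w ^+ 2)%:E) ->
  P.-integrable setT (fun w => (g w ^+ 2)%:E) ->
  P.-integrable setT (fun w => (f w * g w)%:E).
Proof.
move=> mf mg f2 g2.
apply: (@le_integrable _ _ _ P _ measurableT _ (fun w => (f w ^+ 2)%:E + (g w ^+ 2)%:E)%E).
- by apply/measurable_EFinP; exact: measurable_funM.
- move=> w _; rewrite -EFinD !abse_EFin lee_fin.
  rewrite (ger0_norm (addr_ge0 (sqr_ge0 _) (sqr_ge0 _))) ler_norml.
  have := sqr_ge0 (f w - g w); have := sqr_ge0 (f w + g w).
  have := sqr_ge0 (f w); have := sqr_ge0 (g w).
  by move=> h1 h2 h3 h4; apply/andP; split; nra.
- exact: integrableD.
Qed.

Lemma integral_sqrD (f g : T -> R) (u v k : R) :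
  measurable_fun setT f -> measurable_fun setT g ->
  P.-integrable setT (fun w => (f w ^+ 2)%:E) ->
  P.-integrable setT (fun w => (g w ^+ 2)%:E) ->
  (\int[P]_w (f w ^+ 2)%:E = u%:E)%E -> (\int[P]_w (g w ^+ 2)%:E = v%:E)%E ->
  (\int[P]_w (f w * g w)%:E = k%:E)%E ->
  P.-integrable setT (fun w => ((f w + g w) ^+ 2)%:E) /\
  (\int[P]_w ((f w + g w) ^+ 2)%:E = (u + 2 * k + v)%:E)%E.
Proof.
move=> mf mg f2 g2 fu gv fgk.
have ifg := integrableM_sqr mf mg f2 g2.
have i2 : P.-integrable setT (fun w => 2%:E * (f w * g w)%:E)%E by exact: integrableZl.
have E w : ((f w + g w) ^+ 2)%:E =
    ((f w ^+ 2)%:E + 2%:E * (f w * g w)%:E + (g w ^+ 2)%:E)%E.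
  by rewrite -!EFinM -!EFinD; congr EFin; ring.
rewrite (funext E).
have i3 := integrableD measurableT f2 i2.
split; first exact: (integrableD measurableT i3 g2).
rewrite (integralD measurableT i3 g2) (integralD measurableT f2 i2).
by rewrite integralZl// fu gv fgk -EFinM -!EFinD.
Qed.

Section independent_sum.
Variables (E F : set (set T)) (mE : E `<=` measurable) (mF : F `<=` measurable).
Hypothesis iEF : independent_sets P <<s E >> <<s F >>.

Lemma gaussian_moments_add (f g : T -> R) (u v : R) :
  measurable_wrt <<s E >> f -> measurable_wrt <<s F >> g ->
  gaussian_moments P f 0 u -> gaussian_moments P g 0 v ->
  gaussian_moments P (fun w => f w + g w) 0 (u + v).
Proof.
move=> wf wg [f1 f1E f2 f2E fc] [g1 g1E g2 g2E gc].
have mf := measurable_wrt_sub mE wf; have mg := measurable_wrt_sub mF wg.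
have [fg fgE] := independent_integralM mE mF iEF wf wg f1 g1.
have f2' : P.-integrable setT (fun w => (f w ^+ 2)%:E).
  by under eq_fun do rewrite -[f _]subr0.
have g2' : P.-integrable setT (fun w => (g w ^+ 2)%:E).
  by under eq_fun do rewrite -[g _]subr0.
have f2'E : (\int[P]_w (f w ^+ 2)%:E = u%:E)%E.
  by rewrite -f2E; apply: eq_integral => w _; rewrite subr0.
have g2'E : (\int[P]_w (g w ^+ 2)%:E = v%:E)%E.
  by rewrite -g2E; apply: eq_integral => w _; rewrite subr0.
have fg0 : (\int[P]_w (f w * g w)%:E = 0%:E)%E by rewrite fgE f1E mul0e.
have [i2 e2] := integral_sqrD mf mg f2' g2' f2'E g2'E fg0.
split.
- rewrite (_ : _ \o _ = (fun w => (f w)%:E + (g w)%:E)%E)//.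
  exact: (integrableD measurableT f1 g1).
- under eq_integral do rewrite EFinD.
  by rewrite integralD// f1E g1E adde0.
- by under eq_fun do rewrite subr0.
- by under eq_integral do rewrite subr0; rewrite e2 mulr0 addr0.
- move=> a theta; rewrite mulr0 sub0r.
  have wc (E' : set (set T)) (h : T -> R) y : measurable_wrt <<s E' >> h ->
      measurable_wrt <<s E' >> (fun w => cos (a * h w - y)).
    move=> /measurable_wrtP mh; apply/measurable_wrtP.
    exact: (measurableT_comp (measurable_cosB a y) mh).
  have ic (h : T -> R) y : measurable_fun setT h ->
      P.-integrable setT (EFin \o (fun w => cos (a * h w - y))).
    move=> mh; apply: (@integrable_bounded _ _ _ _ _ 1).
      exact: (measurableT_comp (measurable_cosB a y) mh).
    by move=> w; exact: norm_cos_le1.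
  have [h1 h1E] := independent_integralM mE mF iEF (wc _ _ theta wf) (wc _ _ 0 wg) (ic _ theta mf)
    (ic _ 0 mg).
  (* The sines of the addition formula are cosines with phase shifted by pi/2. The one of [g]
     integrates to 0, as cos(pi/2) = 0, so only the product of cosines survives. *)
  have [h2 h2E] := independent_integralM mE mF iEF (wc _ _ (theta +
    pi / 2) wf) (wc _ _ (pi / 2) wg) (ic _ (theta + pi / 2) mf) (ic _ (pi / 2) mg).
  transitivity (\int[P]_w ((cos (a * f w - theta) * cos (a * g w - 0)) + -1 *
      (cos (a * f w - (theta + pi / 2)) * cos (a * g w - pi / 2)))%:E)%E.
    apply: eq_integral => w _; congr EFin.
    have sE x : sin x = cos (x - pi / 2) by rewrite cosB cos_pihalf sin_pihalf; ring.
    have -> : a * f w - (theta + pi / 2) = a * f w - theta - pi / 2 by ring.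
    rewrite -!sE subr0 mulN1r -cosD; congr cos; ring.
  rewrite integralDZ// h1E h2E !fc !gc !mulr0 !sub0r oppr0 cos0 !cosN cos_pihalf.
  rewrite -!EFinM -EFinD; congr EFin.
  by rewrite !(mul0r, mulr0) addr0 mul1r -mulrA -expRD; congr (_ * expR _); field.
Qed.

End independent_sum.
End centered_gaussian.

(** * Gaussian spaces: orthogonal families are independent *)

Section gaussian_space.
Context d (T : measurableType d) (R : realType) (P : probability T R).
Variables (V : lmodType R) (L : V -> T -> R) (q : V -> R).
Hypothesis linL : forall a u v w, L (a *: u + v) w = a * L u w + L v w.
Hypothesis gaussL : forall v, gaussian_moments P (L v) 0 (q v).

(** A covariance, as every [L v] is centred. It may be degenerate, since distinct vectors of [V] may
    represent the same variable. *)
Definition inner (u v : V) : R := fine (\int[P]_w (L u w * L v w)%:E).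

Local Notation B := inner.

Lemma gaussian_space0 w : L 0 w = 0.
Proof. by have := linL 1 0 0 w; rewrite scaler0 addr0 mul1r; lra. Qed.

Lemma gaussian_spaceD u v w : L (u + v) w = L u w + L v w.
Proof. by rewrite -[u]scale1r linL mul1r scale1r. Qed.

Lemma gaussian_spaceZ a u w : L (a *: u) w = a * L u w.
Proof. by rewrite -[a *: u]addr0 linL gaussian_space0 addr0. Qed.

Lemma gaussian_spaceN u w : L (- u) w = - L u w.
Proof. by rewrite -scaleN1r gaussian_spaceZ mulN1r. Qed.

Lemma gaussian_spaceB u v w : L (u - v) w = L u w - L v w.
Proof. by rewrite gaussian_spaceD gaussian_spaceN. Qed.

Lemma gaussian_space_sum (I : Type) (r : seq I) (p : pred I) (f : I -> V) w :
  L (\sum_(i <- r | p i) f i) w = \sum_(i <- r | p i) L (f i) w.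
Proof.
elim/big_rec2 : _ => [|i x y _ <-]; first exact: gaussian_space0.
by rewrite gaussian_spaceD.
Qed.

Lemma measurable_gaussian_space v : measurable_fun setT (L v).
Proof. by have [/integrableP[/measurable_EFinP]] := gaussL v. Qed.

Let mL := measurable_gaussian_space.

Let intL2 v : P.-integrable setT (fun w => (L v w ^+ 2)%:E).
Proof.
by have [_ _ i _ _] := gaussL v; move: i; under eq_fun do rewrite subr0.
Qed.

Let intL2E v : (\int[P]_w (L v w ^+ 2)%:E = (q v)%:E)%E.
Proof.
by have [_ _ _ <- _] := gaussL v; apply: eq_integral => w _; rewrite subr0.
Qed.

Lemma integrable_inner u v : P.-integrable setT (fun w => (L u w * L v w)%:E).
Proof. exact: integrableM_sqr. Qed.

Lemma integral_inner u v : (\int[P]_w (L u w * L v w)%:E = (B u v)%:E)%E.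
Proof. by rewrite /inner fineK//; apply: integrable_fin_num => //; exact: integrable_inner. Qed.

Lemma innerC u v : B u v = B v u.
Proof. by rewrite /inner; under eq_integral do rewrite mulrC. Qed.

Lemma inner_linear a u u' v : B (a *: u + u') v = a * B u v + B u' v.
Proof.
apply: EFin_inj; rewrite EFinD EFinM -!integral_inner addeC.
rewrite -(integralDZ a (integrable_inner u' v) (integrable_inner u v)).
by apply: eq_integral => w _; rewrite linL; congr EFin; ring.
Qed.

Lemma inner_norm v : B v v = q v.
Proof.
by apply: EFin_inj; rewrite -integral_inner -intL2E; apply: eq_integral => w _; rewrite expr2.
Qed.

Lemma inner_ge0 v : 0 <= q v.
Proof.
by rewrite -lee_fin -intL2E; apply: integral_ge0 => w _; rewrite lee_fin sqr_ge0.
Qed.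

Lemma inner_normD u v : q (u + v) = q u + 2 * B u v + q v.
Proof.
have [_ E1] := integral_sqrD (mL u) (mL v) (intL2 u) (intL2 v) (intL2E u) (intL2E v)
  (integral_inner u v).
apply: EFin_inj; rewrite -E1 -intL2E; apply: eq_integral => w _.
by rewrite gaussian_spaceD.
Qed.

Lemma inner0l v : B 0 v = 0.
Proof.
by apply: EFin_inj; rewrite -integral_inner integral0_eq// => w _; rewrite gaussian_space0 mul0r.
Qed.

Lemma innerNl u v : B (- u) v = - B u v.
Proof. by rewrite -[- u]addr0 -scaleN1r inner_linear inner0l addr0 mulN1r. Qed.

Lemma innerNr u v : B u (- v) = - B u v.
Proof. by rewrite innerC innerNl innerC. Qed.

Lemma inner_normB u v : q (u - v) = q u - 2 * B u v + q v.
Proof. by rewrite inner_normD -(inner_norm (- v)) !(innerNr, innerNl) inner_norm; ring. Qed.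

Lemma inner_polar u v : B u v = (q (u + v) - q (u - v)) / 4.
Proof. by rewrite inner_normD inner_normB; field. Qed.

Lemma inner_suml (I : Type) (r : seq I) (p : pred I) (c : I -> R) (f : I -> V) v :
  B (\sum_(i <- r | p i) c i *: f i) v = \sum_(i <- r | p i) c i * B (f i) v.
Proof.
elim/big_rec2 : _ => [|i x y _ <-]; first exact: inner0l.
by rewrite inner_linear.
Qed.

(** For orthogonal [al] and [be] the sum and the difference both have variance q al + q be. The two
    cosines of the product formula then share their exponential factor and recombine into a product
    of transforms. *)
Lemma gaussian_space_independent (z v : nat -> V) (p k : nat) :
  (forall i j, (i < p)%N -> (j < k)%N -> B (z i) (v j) = 0) ->
  independent_sets P <<s rectangles (fun i => L (z i)) p >>
                     <<s rectangles (fun i => L (v i)) k >>.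
Proof.
move=> zv0; apply: independent_rectangles => // a b x y.
pose al := \sum_(i < p) a i *: z i; pose be := \sum_(i < k) b i *: v i.
have aE w : \sum_(i < p) a i * L (z i) w = L al w.
  by rewrite gaussian_space_sum; apply: eq_bigr => i _; rewrite gaussian_spaceZ.
have bE w : \sum_(i < k) b i * L (v i) w = L be w.
  by rewrite gaussian_space_sum; apply: eq_bigr => i _; rewrite gaussian_spaceZ.
have Bab : B al be = 0.
  rewrite inner_suml big1// => i _; rewrite innerC inner_suml big1 ?mulr0// => j _.
  by rewrite innerC zv0 ?mulr0.
have cE u t : (\int[P]_w (cos (L u w - t))%:E = (cos t * expR (- q u / 2))%:E)%E.
  have [_ _ _ _ /(_ 1 t)] := gaussL u.
  rewrite mulr0 sub0r cosN expr1n mul1r => <-.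
  by apply: eq_integral => w _; rewrite mul1r.
under eq_integral do rewrite aE bE.
under [X in (_ = X * _)%E]eq_integral do rewrite aE.
under [X in (_ = _ * X)%E]eq_integral do rewrite bE.
have ic u t : P.-integrable setT (EFin \o (fun w => cos (L u w - t))).
  apply: (@integrable_bounded _ _ _ _ _ 1); first exact: measurable_cos_comp.
  by move=> w; exact: norm_cos_le1.
transitivity (\int[P]_w (2^-1%:E * (cos (L (al + be) w - (x + y)) +
  1 * cos (L (al - be) w - (x - y)))%:E))%E.
  apply: eq_integral => w _; rewrite cosM -EFinM; congr EFin;
    rewrite mul1r gaussian_spaceD gaussian_spaceB.
  by congr (_ * (cos _ + cos _)); ring.
rewrite integralZl//; last first.
  rewrite (_ : (fun w => _) = (fun w => (cos (L (al + be) w - (x + y)))%:E +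
    1%:E * (cos (L (al - be) w - (x - y)))%:E)%E)//.
  by apply: integrableD => //; [exact: ic|apply: integrableZl => //; exact: ic].
rewrite (integralDZ 1 (ic _ _) (ic _ _)) !cE mul1e -!EFinD -!EFinM; congr EFin.
have q1 : q (al + be) = q al + q be by rewrite inner_normD Bab mulr0 addr0.
have q2 : q (al - be) = q al + q be by rewrite inner_normB Bab mulr0 subr0.
by rewrite q1 q2 opprD mulrDl expRD cosD cosB; field.
Qed.

End gaussian_space.

(** [F t] reads only values before [t], so iteration fixes the value at [t] after t + 1 rounds; the
    solution is the diagonal of the iterates. *)
Lemma strong_recursion (X : Type) (x0 : X) (F : nat -> (nat -> X) -> X) :
  (forall t f f', (forall l, (l < t)%N -> f l = f' l) -> F t f = F t f') ->
  exists f, forall t, f t = F t f.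
Proof.
move=> FE; pose fs n := iter n (fun f t => F t f) (fun=> x0).
have stable n : forall k t, (t < n)%N -> (t < k)%N -> fs n t = fs k t.
  elim: n => // n IH [|k] t //= tn tk; apply: FE => l lt.
  by apply: IH; apply: leq_trans lt _.
exists (fun t => fs t.+1 t) => t; rewrite -[LHS]/(F t (fs t)).
by apply: FE => l lt; exact: (stable _ _ _ lt (ltnSn l)).
Qed.

(** * The error covariance recursion *)

Section riccati.
Context (R : realType).
Variables (K : nat -> nat -> R) (D : nat -> R).

(* Imposed for all pairs (t, s), not only for s <= t: both halves of g occur as
   covariances between states and residuals. *)
Definition riccati (g : nat -> nat -> R) : Prop := forall t s,
  g t s = K t s - \sum_(1 <= l < s) g t l * g s l * (D l / (1 + D l * g l l)).

Lemma riccati_exists : exists g, riccati g.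
Proof.
(* The recursion runs over columns: the entries (t, l), (s, l) and (l, l) all lie in columns l < s,
   whatever the order of t and s. *)
pose F (s : nat) (col : nat -> nat -> R) (t : nat) : R :=
  K t s - \sum_(1 <= l < s) col l t * col l s * (D l / (1 + D l * col l l)).
have [|f fE] := @strong_recursion (nat -> R) (fun=> 0) F.
  move=> s f f' ff'; apply/funext => t; rewrite /F; congr (_ - _).
  by apply: eq_big_nat => l /andP[_ ls]; rewrite ff'.
by exists (fun t s => f s t) => t s; rewrite {1}fE.
Qed.

Lemma riccati_unique (g g' : nat -> nat -> R) :
  (forall t s, (1 <= s <= t)%N -> g t s = K t s - \sum_(1 <= l < s) g t l * g s l * (D l / (1 +
    D l * g l l))) ->
  (forall t s, (1 <= s <= t)%N -> g' t s = K t s - \sum_(1 <= l < s) g' t l * g' s l *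
    (D l / (1 + D l * g' l l))) ->
  forall t s, (1 <= s <= t)%N -> g' t s = g t s.
Proof.
move=> gE g'E t s; elim/ltn_ind: s t => s IH t /andP[s1 st].
rewrite gE ?s1// g'E ?s1//; congr (_ - _); apply: eq_big_nat => l /andP[l1 ls].
have lt := leq_trans ls st.
by rewrite !IH ?l1 ?leqnn ?(ltnW lt) ?(ltnW ls).
Qed.

(** The equations at (s, t) and (t, s) share their terms below [s] and, by symmetry of [K], their
    leading term. The term l = s turns g t s into g t s / den_s, because 1 - D g / (1 + D g) = 1 /
    (1 + D g). *)
Lemma riccati_transpose (g : nat -> nat -> R) s t : riccati g ->
  (forall i j, (1 <= i)%N -> (1 <= j)%N -> K i j = K j i) ->
  (forall l, (1 <= l)%N -> 1 + D l * g l l != 0) ->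
  (1 <= s < t)%N ->
  g s t = g t s / (1 + D s * g s s) -
    \sum_(s.+1 <= l < t) g t l * g s l * (D l / (1 + D l * g l l)).
Proof.
move=> gE Ksym d0 /andP[s1 st].
pose f l := g t l * g s l * (D l / (1 + D l * g l l)).
have fE : \sum_(1 <= l < t) g s l * g t l * (D l / (1 + D l * g l l)) =
    \sum_(1 <= l < s) f l + (f s + \sum_(s.+1 <= l < t) f l).
  rewrite -big_ltn// -big_cat_nat//; last exact: ltnW.
  by apply: eq_bigr => l _; rewrite /f [g s l * _]mulrC.
have gts : K t s = g t s + \sum_(1 <= l < s) f l by rewrite (gE t s) subrK.
rewrite [LHS]gE fE -/(f _) (Ksym s t)//; last exact: leq_trans (ltnW st).
rewrite gts -/f /f; move: (\sum_(1 <= l < s) _) (\sum_(s.+1 <= l < t) _) => S1 S2.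
by field; exact: d0.
Qed.

End riccati.

(** * Innovations for an abstract covariance form *)

Section innovations.
Context (R : realType) (V : lmodType R) (B : V -> V -> R).
Hypothesis Blin : forall a u u' v, B (a *: u + u') v = a * B u v + B u' v.
Hypothesis BC : forall u v, B u v = B v u.
Hypothesis Bge0 : forall v, 0 <= B v v.
Variables (N : nat) (x n : nat -> V) (K : nat -> nat -> R) (D : nat -> R).
Let ok t := (1 <= t <= N)%N.
Hypothesis D0 : forall t, ok t -> 0 <= D t.
Hypothesis Bxx : forall t s, ok t -> ok s -> B (x t) (x s) = K t s.

(* eta is a component of the r-th observation noise; c is its covariance with the
   noise n r of the r-th innovation. *)
Definition noise_at (r : nat) (c : R) (eta : V) : Prop :=
  [/\ forall t, (1 <= t <= N)%N -> B (x t) eta = 0,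
      forall l, (1 <= l <= N)%N -> l != r -> B (n l) eta = 0 & B (n r) eta = c].

Hypothesis noise_n : forall r, ok r -> noise_at r (D r) (n r).

Variable g : nat -> nat -> R.
Hypothesis gE : riccati K D g.
Let den l := 1 + D l * g l l.

Variable nu : nat -> V.
(** These are regression coefficients: [x s] and [nu l] turn out to have covariance D l * g s l, and
    [nu l] variance D l * (1 + D l * g l l). With D l cancelled the formula still makes sense when D
    l = 0. *)
Definition residual (s k : nat) : V :=
  x s - \sum_(1 <= l < k) (g s l / (1 + D l * g l l)) *: nu l.
Hypothesis nuE : forall l, ok l -> nu l = D l *: residual l l + n l.

Let e := residual.

Let B0 v : B 0 v = 0.
Proof. by have := Blin 1 0 0 v; rewrite scaler0 addr0 mul1r; lra. Qed.

Let BD u u' v : B (u + u') v = B u v + B u' v.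
Proof. by rewrite -[u]scale1r Blin mul1r scale1r. Qed.

Let BZ a u v : B (a *: u) v = a * B u v.
Proof. by rewrite -[a *: u]addr0 Blin B0 addr0. Qed.

Let BN u v : B (- u) v = - B u v.
Proof. by rewrite -scaleN1r BZ mulN1r. Qed.

Let Bsum i j (c : nat -> R) (f : nat -> V) v :
  B (\sum_(i <= l < j) c l *: f l) v = \sum_(i <= l < j) c l * B (f l) v.
Proof.
elim/big_rec2 : _ => [|l u w _ <-]; first exact: B0.
by rewrite Blin.
Qed.

Let Be s k v : B (e s k) v = B (x s) v - \sum_(1 <= l < k) (g s l / den l) * B (nu l) v.
Proof. by rewrite /e /residual BD BN Bsum. Qed.

Let Bnu l v : ok l -> B (nu l) v = D l * B (e l l) v + B (n l) v.
Proof. by move=> okl; rewrite nuE// Blin. Qed.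

Let ok_lt l s : (1 <= l)%N -> (l < s)%N -> (s <= N.+1)%N -> ok l.
Proof. by move=> l1 ls sN; rewrite /ok l1 /= -ltnS; exact: leq_trans ls sN. Qed.

(** Pairing the expansion of [e s s] with [x t] reproduces the recursion of [g] term by term, for
    either order of [t] and [s]: as states and noises are uncorrelated, [nu l] contributes D l * g t
    l. *)
Lemma inner_state_residual t s : ok t -> ok s -> B (x t) (e s s) = g t s.
Proof.
move=> okt; elim/ltn_ind: s => s IH oks.
rewrite BC Be Bxx// gE; have /andP[s1 sN] := oks.
have -> : K s t = K t s by rewrite -!Bxx// BC.
congr (_ - _); apply: eq_big_nat => l /andP[l1 ls].
have okl : ok l by apply: ok_lt ls _; rewrite ?l1// leqW.
rewrite Bnu// (BC (e l l)) IH// (BC (n l)).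
have [h _ _] := noise_n okl; rewrite h// addr0 /den; ring.
Qed.

(** Causality: innovations before [r] are built from states and from noises of other times, all
    uncorrelated with the noise at [r]. *)
Lemma inner_future_noise r c eta : ok r -> noise_at r c eta ->
  forall l, ok l -> (l < r)%N -> B (nu l) eta = 0.
Proof.
move=> okr [hx hn _] l; elim/ltn_ind: l => l IH okl lr.
rewrite Bnu// hn ?(ltn_eqF lr)// addr0 Be hx// big_nat big1 ?subr0 ?mulr0//.
move=> i /andP[i1 il]; rewrite IH ?mulr0//; last exact: ltn_trans lr.
have /andP[_ lN] := okl; apply: ok_lt il _; rewrite ?i1//; exact: leqW.
Qed.

Lemma inner_residual_noise r c eta s k : ok r -> ok s -> noise_at r c eta ->
  (k <= r)%N -> B (e s k) eta = 0.
Proof.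
move=> okr oks hn kr; have [hx _ _] := hn.
have /andP[_ rN] := okr.
rewrite Be hx// big_nat big1 ?subr0// => l /andP[l1 lk].
rewrite (inner_future_noise okr hn) ?mulr0//; last exact: leq_trans kr.
by apply: ok_lt lk _; rewrite ?l1//; apply: leq_trans kr (leqW rN).
Qed.

(** [c *: e r r + eta] is the new part of the observation [c *: x r + eta]. In the expansion of
    [e s k], innovations before [r] contribute 0, the one at [r] cancels the contribution of [x s],
    and later ones vanish by induction. The variance of [e r r] belongs to the same induction
    because this cancellation uses it. *)
Lemma inner_residual_innovation k : (k <= N.+1)%N ->
  forall s r c eta, ok s -> ok r -> (r < k)%N -> noise_at r c eta ->
  B (e s k) (c *: e r r + eta) = 0 /\ B (e r r) (e r r) = g r r.
Proof.
elim/ltn_ind: k => k IH kN s r c eta oks okr rk hn.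
have /andP[r1 rN] := okr.
have BR u a v v' : B u (a *: v + v') = a * B u v + B u v'.
  by rewrite BC Blin !(BC u).
have nuer l : (1 <= l < r)%N -> B (nu l) (e r r) = 0.
  move=> /andP[l1 lr]; have okl : ok l by apply: ok_lt lr _; rewrite ?l1// leqW.
  have [h _] := IH r rk (leq_trans rN (leqnSn _)) r l (D l) (n l) okr okl lr (noise_n okl).
  by rewrite BC nuE.
have err : B (e r r) (e r r) = g r r.
  rewrite Be inner_state_residual// big_nat big1 ?subr0// => l lr.
  by rewrite nuer ?mulr0.
split => //.
have xw : B (x s) (c *: e r r + eta) = c * g s r.
  by have [hx _ _] := hn; rewrite BR inner_state_residual// hx// addr0.
have g0 : 0 <= g r r by rewrite -err.
have den0 : den r != 0.
  by rewrite gt_eqF// /den ltr_wpDr// mulr_ge0// D0.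
rewrite Be xw (bigD1_seq r) /=; [|by rewrite mem_index_iota r1|exact: iota_uniq].
rewrite big1_seq ?addr0.
  (* The residuals give c * D r * g r r and the noises give c; the factor [den r] appears because
     the covariance of [eta] with [n r] is the same c as the coefficient of the state. *)
  have -> : B (nu r) (c *: e r r + eta) = c * den r.
    rewrite Bnu// !BR err (inner_residual_noise okr okr hn)//.
    rewrite (BC (n r)) (inner_residual_noise okr okr (noise_n okr))//.
    by have [_ _ ->] := hn; rewrite /den; ring.
  by field.
move=> l /andP[lr]; rewrite mem_index_iota => /andP[l1 lk].
have okl : ok l by exact: ok_lt lk kN.
have [lltr|rltl|/eqP lr'] := ltngtP l r; last by rewrite lr' in lr.
  by rewrite BR nuer ?l1// (inner_future_noise okr hn)// mulr0 addr0 mulr0.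
rewrite Bnu//; have [-> _] := IH l lk (leq_trans (ltnW lk) kN) l r c eta okl okr rltl hn.
rewrite BR (BC (n l)) (inner_residual_noise okl okr (noise_n okl) (ltnW rltl)).
have [_ h _] := hn; rewrite h//.
by ring.
Qed.

Lemma inner_residual_nu s k l : (k <= N.+1)%N -> ok s -> (1 <= l < k)%N ->
  B (e s k) (nu l) = 0.
Proof.
move=> kN oks /andP[l1 lk]; have okl : ok l by exact: ok_lt lk kN.
have [h _] := inner_residual_innovation kN oks okl lk (noise_n okl).
by rewrite nuE.
Qed.

(** An observation is a combination of innovations before [r] plus its own new part, and the
    residual is orthogonal to both. So each component observed at [r] is covered, although [nu r]
    sees only a combination of them. *)
Lemma inner_residual_observation s k r c eta : (k <= N.+1)%N -> ok s ->
  (1 <= r < k)%N -> noise_at r c eta -> B (e s k) (c *: x r + eta) = 0.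
Proof.
move=> kN oks /andP[r1 rk] hn; have okr : ok r by exact: ok_lt rk kN.
have [h _] := inner_residual_innovation kN oks okr rk hn.
have -> : c *: x r + eta =
    c *: \sum_(1 <= l < r) (g r l / den l) *: nu l + (c *: e r r + eta).
  by rewrite addrA -scalerDr /e /residual addrCA subrr addr0.
rewrite BC Blin -!(BC (e s k)) h addr0 BC Bsum big_nat big1 ?mulr0// => l /andP[l1 lr].
by rewrite BC inner_residual_nu ?mulr0// l1 (ltn_trans lr).
Qed.

Lemma riccati_diag_ge0 r : ok r -> 0 <= g r r.
Proof.
move=> okr; have /andP[_ rN] := okr.
by have [_ <-] := @inner_residual_innovation r.+1 rN r r _ _ okr okr (ltnSn r) (noise_n okr).
Qed.

(** For [s < t] the second vector is a smoothing residual: this gives the entries [g s t] on the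
    other side of the diagonal their meaning as covariances. *)
Lemma inner_residuals t s : ok t -> ok s -> B (e t t) (e s t) = g s t.
Proof.
move=> okt oks; have /andP[_ tN] := okt.
rewrite BC Be inner_state_residual// big_nat big1 ?subr0// => l lt.
by rewrite BC inner_residual_nu ?mulr0// leqW.
Qed.

End innovations.

Lemma innovations_exist (R : realType) (V : lmodType R) (x n : nat -> V)
    (D : nat -> R) (g : nat -> nat -> R) :
  exists nu : nat -> V, forall l, nu l = D l *: residual x D g nu l l + n l.
Proof.
apply: (@strong_recursion V 0 (fun l nu => D l *: residual x D g nu l l + n l)).
move=> t f f' ff'; congr (_ *: _ + _); rewrite /residual; congr (_ - _).
by apply: eq_big_nat => l /andP[_ lt]; rewrite ff'.
Qed.

(** * Measurability with respect to generated sigma-algebras *)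

Section measurable_wrt_ops.
Context d (T : measurableType d) (R : realType) (E : set (set T)).

Lemma measurable_wrt_cst (c : R) : measurable_wrt <<s E >> (fun _ : T => c).
Proof. by apply/measurable_wrtP; exact: measurable_cst. Qed.

Lemma measurable_wrtD (f g : T -> R) : measurable_wrt <<s E >> f ->
  measurable_wrt <<s E >> g -> measurable_wrt <<s E >> (fun w => f w + g w).
Proof.
by move=> /measurable_wrtP mf /measurable_wrtP mg; apply/measurable_wrtP; exact: measurable_funD.
Qed.

Lemma measurable_wrtB (f g : T -> R) : measurable_wrt <<s E >> f ->
  measurable_wrt <<s E >> g -> measurable_wrt <<s E >> (fun w => f w - g w).
Proof.
by move=> /measurable_wrtP mf /measurable_wrtP mg; apply/measurable_wrtP; exact: measurable_funB.
Qed.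

Lemma measurable_wrtM (f g : T -> R) : measurable_wrt <<s E >> f ->
  measurable_wrt <<s E >> g -> measurable_wrt <<s E >> (fun w => f w * g w).
Proof.
by move=> /measurable_wrtP mf /measurable_wrtP mg; apply/measurable_wrtP; exact: measurable_funM.
Qed.

Lemma measurable_wrtZ (c : R) (f : T -> R) : measurable_wrt <<s E >> f ->
  measurable_wrt <<s E >> (fun w => c * f w).
Proof. by apply: measurable_wrtM; exact: measurable_wrt_cst. Qed.

Lemma measurable_wrt_sum i j (f : nat -> T -> R) :
  (forall l, (i <= l < j)%N -> measurable_wrt <<s E >> (f l)) ->
  measurable_wrt <<s E >> (fun w => \sum_(i <= l < j) f l w).
Proof.
move=> mf; rewrite (_ : (fun w => _) = (fun w => \sum_(l <- [seq l <- index_iota i j | i <= l <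
  j]%N) f l w)).
  have : all (fun l => i <= l < j)%N [seq l <- index_iota i j | i <= l < j]%N by exact: filter_all.
  elim: (seq.filter _ _) => [_|l r IH /= /andP[lij rij]].
    by under eq_fun do rewrite big_nil; exact: measurable_wrt_cst.
  by under eq_fun do rewrite big_cons; apply: measurable_wrtD; [exact: mf|exact: IH].
by apply/funext => w; rewrite big_filter -big_nat.
Qed.

Lemma measurable_wrt_sigma (E' : set (set T)) d' (U : measurableType d') (f : T -> U) :
  (forall B, measurable B -> <<s E' >> (f @^-1` B)) -> measurable_wrt <<s E' >> f.
Proof. by move=> h _ [B mB <-]; rewrite setTI; exact: h. Qed.

Lemma sigma_sub (E' : set (set T)) : E' `<=` <<s E >> -> <<s E' >> `<=` <<s E >>.
Proof. by move=> h; apply: smallest_sub => //; exact: smallest_sigma_algebra. Qed.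

End measurable_wrt_ops.

Lemma measurable_wrtS (T : Type) (R : realType) (G H : set (set T)) (f : T -> R) :
  G `<=` H -> measurable_wrt G f -> measurable_wrt H f.
Proof. by move=> GH mf; apply: subset_trans mf GH. Qed.

Lemma measurable_wrt_events d (T : measurableType d) (R : realType)
    (Z : nat -> T -> R) (D : set nat) (E : set (set T)) t :
  events Z D `<=` <<s E >> -> D t -> measurable_wrt <<s E >> (Z t).
Proof. by move=> h Dt A [B mB <-]; apply: h; exists t => //; exists B. Qed.

Lemma events_measurable d (T : measurableType d) (R : realType)
    (Z : nat -> T -> R) (D : set nat) :
  (forall t, D t -> measurable_fun setT (Z t)) -> events Z D `<=` measurable.
Proof. by move=> mZ _ [t Dt [B mB <-]]; exact: mZ. Qed.

(** * Linear combinations of independent standard normal variables *)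

Section iid_sum.
Context d (T : measurableType d) (R : realType) (P : probability T R).
Variables (Z : nat -> {RV P >-> R}) (iidZ : iid_std_normal Z).

Let times : nat -> {fset nat} := fix J n := if n is k.+1 then (k.+1 |` J k)%fset else fset0.

Let mem_times n t : (t \in times n) = (1 <= t <= n)%N.
Proof.
elim: n => [|n IH] /=; first by rewrite in_fset0; case: t.
rewrite in_fset1U IH; case: (eqVneq t n.+1) => [->|tn] /=; first by rewrite leqnn.
by rewrite [(t <= n.+1)%N]leq_eqVlt (negbTE tn) ltnS.
Qed.

Let prob_times n (B : nat -> set R) : (forall t, measurable (B t)) ->
  (P (\bigcap_(i in `I_n) (Z i.+1 @^-1` B i.+1)) = \prod_(t <- times n) P (Z t @^-1` B t))%E.
Proof.
move=> mB; have [_ indZ] := iidZ; rewrite -indZ//; last by move=> t; rewrite mem_times => /andP[].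
congr (P _); apply/seteqP; split => w h t /=.
  by rewrite mem_times => /andP[t1 tn]; have := h t.-1; rewrite /= prednK//; apply.
by move=> tn; apply: h; rewrite /= mem_times.
Qed.

Let last_event n := preimage_set_system setT (Z n.+1) (@measurable _ R).

Let independent_last n :
  independent_sets P <<s rectangles (fun i => Z i.+1 : T -> R) n >> <<s last_event n >>.
Proof.
apply: independent_sets_sigma.
- by apply: rectangles_measurable => i; exact: measurable_funPT.
- by move=> _ [B mB <-]; exact: (@measurable_funPT _ _ _ _ (Z n.+1)).
- exact: rectangles_setI.
- move=> _ _ [B mB <-] [C mC <-]; exists (B `&` C); first exact: measurableI.
  by rewrite !setTI preimage_setI.
- exact: rectangles_setT.
- by exists setT => //; rewrite preimage_setT setTI.
move=> _ _ [B [mB ->]] [C mC <-]; rewrite setTI.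
(* Rectangles count coordinates from 0 while times start at 1, hence the predecessor; the slot of
   time n + 1 receives [C]. *)
pose B' t := if t == n.+1 then C else B t.-1.
have mB' t : measurable (B' t) by rewrite /B'; case: ifP.
have -> : \bigcap_(i in `I_n) (Z i.+1 @^-1` B i) `&` Z n.+1 @^-1` C =
    \bigcap_(i in `I_n.+1) (Z i.+1 @^-1` B' i.+1).
  apply/seteqP; split => w /=.
    move=> [h hC] i /= iN; rewrite /B'; case: eqP => [[->]//|/eqP ni].
    by apply: h => /=; rewrite eqSS in ni; move: iN; rewrite ltnS leq_eqVlt (negbTE ni).
  move=> h; split => [i /= iN|].
    by have := h i (ltnW iN); rewrite /B' eqSS (ltn_eqF iN).
  by have := h n (ltnSn n); rewrite /B' eqxx.
have -> : \bigcap_(i in `I_n) (Z i.+1 @^-1` B i) =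
    \bigcap_(i in `I_n) (Z i.+1 @^-1` B' i.+1).
  apply: eq_bigcapr => i /= iN; by rewrite /B' eqSS (ltn_eqF iN).
rewrite !prob_times// /= big_fsetU1/=; last by rewrite mem_times ltnn andbF.
by rewrite muleC /B' eqxx.
Qed.

Lemma gaussian_moments0 : gaussian_moments P (fun _ : T => 0 : R) 0 0.
Proof.
have i0 : P.-integrable setT (cst 0%:E) by exact: finite_measure_integrable_cst.
have e0 : (\int[P]_w (0 : R)%:E = 0)%E by exact: (integral_probability_cst P 0).
split=> //.
- by under eq_fun do rewrite subr0 expr0n.
- by under eq_integral do rewrite subr0 expr0n.
- move=> a theta; rewrite mulr0 sub0r mulr0 oppr0 mul0r expR0 mulr1.
  exact: (integral_probability_cst P (cos (- theta))).
Qed.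

Lemma gaussian_moments_iid_sum n (b : nat -> R) :
  gaussian_moments P (fun w => \sum_(1 <= t < n.+1) b t * Z t w) 0
    (\sum_(1 <= t < n.+1) b t ^+ 2).
Proof.
elim: n => [|n IH].
  by rewrite big_geq//; under eq_fun do rewrite big_geq//; exact: gaussian_moments0.
rewrite big_nat_recr//=; under eq_fun do rewrite big_nat_recr//=.
have [lawZ _] := iidZ.
have mE : rectangles (fun i => Z i.+1 : T -> R) n `<=` measurable.
  by apply: rectangles_measurable => i; exact: measurable_funPT.
have mF : last_event n `<=` measurable.
  by move=> _ [B mB <-]; exact: (@measurable_funPT _ _ _ _ (Z n.+1)).
apply: (gaussian_moments_add mE mF (independent_last (n := n))) => //.
- apply: measurable_wrt_sum => t /andP[t1 tn]; apply: measurable_wrtZ.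
  apply: measurable_wrt_sigma => B mB; apply: sub_sigma_algebra.
  have := @rectangles_preimage _ T R (fun i => Z i.+1 : T -> R) n t.-1 B.
  by rewrite /= prednK//; apply.
- apply: measurable_wrtZ; apply: measurable_wrt_sigma => B mB; apply: sub_sigma_algebra.
  by exists B => //; rewrite setTI.
- rewrite -[X in gaussian_moments _ _ _ X]mulr1 -[X in _ * X](expr1n _ 2).
  apply: gaussian_moments_scale; apply: gaussian_momentsP => B mB.
  by rewrite oner_eq0 -(lawZ n.+1).
Qed.

End iid_sum.

Lemma sum_delta (R : realType) (N t : nat) (f : nat -> R) : (1 <= t <= N)%N ->
  \sum_(1 <= s < N.+1) (s == t)%:R * f s = f t.
Proof.
move=> tN; rewrite (bigD1_seq t) /=; [|by rewrite mem_index_iota ltnS|exact: iota_uniq].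
rewrite eqxx mul1r big1 ?addr0// => s st; by rewrite (negbTE st) mul0r.
Qed.

Definition observation_gain (R : realType) (A Q : nat -> R) (t : nat) : R := A t ^+ 2 + Q t.

(** * The joint Gaussian space of states and noises up to a horizon *)

Section observation_space.
Context d (T : measurableType d) (R : realType) (P : probability T R).
Variables (X eps epsbar : nat -> {RV P >-> R}) (m : nat -> R) (K : nat -> nat -> R).
Hypothesis X_gaussian : gaussian_sequence X.
Hypothesis X_mean : forall t, (1 <= t)%N -> 'E_P[X t]%E = (m t)%:E.
Hypothesis X_cov : forall t s, (1 <= t)%N -> (1 <= s)%N ->
  covariance P (X t) (X s) = (K t s)%:E.
Hypothesis eps_iid : iid_std_normal eps.
Hypothesis eps_indep : independent_sets P
  <<s events (fun t => X t) times_from1 >> <<s events (fun t => eps t) times_from1 >>.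
Hypothesis epsbar_iid : iid_std_normal epsbar.
Hypothesis epsbar_indep : independent_sets P
  <<s events (fun t => X t) times_from1 `|` events (fun t => eps t) times_from1 >>
  <<s events (fun t => epsbar t) times_from1 >>.
Variable N : nat.

Definition state_comb (a : nat -> R) (w : T) : R :=
  \sum_(1 <= t < N.+1) a t * (X t w - m t).

Definition noise_comb (Z : nat -> {RV P >-> R}) (b : nat -> R) (w : T) : R :=
  \sum_(1 <= t < N.+1) b t * Z t w.

Local Notation V := ((nat -> R) * (nat -> R) * (nat -> R))%type.

(** Vectors are formal coefficient sequences rather than random variables, so a degenerate
    covariance of the states causes no trouble. The horizon [N] keeps the sums finite; coefficients
    beyond it are ignored. *)
Definition joint_comb (v : V) (w : T) : R :=
  state_comb v.1.1 w + noise_comb eps v.1.2 w + noise_comb epsbar v.2 w.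

Lemma joint_comb_linear a (u v : V) w :
  joint_comb (a *: u + v) w = a * joint_comb u w + joint_comb v w.
Proof.
rewrite /joint_comb /state_comb /noise_comb.
have E (c c' : nat -> R) (f : nat -> R) : \sum_(1 <= t < N.+1) (a *: c + c') t * f t =
    a * (\sum_(1 <= t < N.+1) c t * f t) + \sum_(1 <= t < N.+1) c' t * f t.
  rewrite mulr_sumr -big_split /=; apply: eq_bigr => t _.
  by rewrite [in LHS]/GRing.add /= [in LHS]/GRing.scale /= mulrDl mulrA.
by rewrite /= !E; ring.
Qed.

Lemma integrable_state t : (1 <= t)%N -> P.-integrable setT (EFin \o X t).
Proof.
move=> t1; have gX := X_gaussian t (fun s => (s == t)%:R).
have XE : (fun w => \sum_(1 <= s < t.+1) (s == t)%:R * X s w) = X t.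
  by apply/funext => w; rewrite (sum_delta (fun s => X s w))// t1 leqnn.
rewrite XE in gX; have [mu [v [i _ _ _ _]]] := gaussian_variableP gX.
exact: i.
Qed.

Lemma integral_state_sum n (a : nat -> R) :
  P.-integrable setT (EFin \o (fun w => \sum_(1 <= t < n.+1) a t * X t w)) /\
  (\int[P]_w (\sum_(1 <= t < n.+1) a t * X t w)%:E = (\sum_(1 <= t < n.+1) a t * m t)%:E)%E.
Proof.
elim: n => [|n [IHi IHe]].
  rewrite (_ : (fun w => _) = cst 0); last by apply/funext => w; rewrite big_geq.
  split; first exact: finite_measure_integrable_cst.
  by under eq_integral do rewrite big_geq//; rewrite big_geq// (integral_probability_cst P 0).
have iX := @integrable_state n.+1 isT.
have eX := X_mean (ltn0Sn n); rewrite expectation_def in eX.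
have E w : \sum_(1 <= t < n.+2) a t * X t w = \sum_(1 <= t < n.+1) a t * X t w + a n.+1 * X n.+1 w.
  by rewrite big_nat_recr.
rewrite (funext E) big_nat_recr//=; split.
  rewrite (_ : _ \o _ = (fun w => (\sum_(1 <= t < n.+1) a t * X t w)%:E +
    (a n.+1)%:E * (X n.+1 w)%:E)%E)//.
  exact: (integrableD measurableT IHi (integrableZl measurableT _ iX)).
under eq_integral do rewrite E.
by have /= -> := integralDZ (a n.+1) IHi iX; rewrite IHe eX -EFinM.
Qed.

Lemma gaussian_state_comb a : exists v, gaussian_moments P (state_comb a) 0 v.
Proof.
have mS : measurable_fun setT (fun w => \sum_(1 <= t < N.+1) a t * X t w).
  by apply: measurable_sum => t; exact: measurable_funM.
pose S : {RV P >-> R} := HB.pack (fun w => \sum_(1 <= t < N.+1) a t * X t w)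
  (isMeasurableFun.Build _ _ _ _ _ mS).
have [mu [v gS]] := @gaussian_variableP _ _ _ P S (X_gaussian N a).
exists v; have := gaussian_moments_center gS.
have -> : mu = \sum_(1 <= t < N.+1) a t * m t.
  have [_ e1 _ _ _] := gS; have [_ e2] := integral_state_sum N a.
  by apply: EFin_inj; rewrite -e1 -e2.
congr gaussian_moments; apply/funext => w /=; rewrite /state_comb -sumrB.
by apply: eq_bigr => t _; rewrite mulrBr.
Qed.

Definition state_var (a : nat -> R) : R := fine (\int[P]_w (state_comb a w ^+ 2)%:E).

Lemma gaussian_state_var a : gaussian_moments P (state_comb a) 0 (state_var a).
Proof.
have [v gv] := gaussian_state_comb a.
rewrite (_ : state_var a = v)//; have [_ _ _ e _] := gv.
rewrite /state_var -[v]/(fine v%:E) -e; congr fine.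
by apply: eq_integral => w _; rewrite subr0.
Qed.

Definition joint_var (v : V) : R :=
  state_var v.1.1 + \sum_(1 <= t < N.+1) v.1.2 t ^+ 2 + \sum_(1 <= t < N.+1) v.2 t ^+ 2.

Let mX : events (fun t => X t : T -> R) times_from1 `<=` measurable.
Proof. by apply: events_measurable => t _; exact: measurable_funPT. Qed.
Let meps : events (fun t => eps t : T -> R) times_from1 `<=` measurable.
Proof. by apply: events_measurable => t _; exact: measurable_funPT. Qed.
Let mbar : events (fun t => epsbar t : T -> R) times_from1 `<=` measurable.
Proof. by apply: events_measurable => t _; exact: measurable_funPT. Qed.

Lemma gaussian_joint_comb v : gaussian_moments P (joint_comb v) 0 (joint_var v).
Proof.
have sums (E : set (set T)) (Z : nat -> T -> R) (b : nat -> R) :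
    events Z times_from1 `<=` <<s E >> ->
    measurable_wrt <<s E >> (fun w => \sum_(1 <= t < N.+1) b t * Z t w).
  move=> h; apply: measurable_wrt_sum => t /andP[t1 _]; apply: measurable_wrtZ.
  exact: (measurable_wrt_events h).
have state (E : set (set T)) (a : nat -> R) :
    events (fun t => X t : T -> R) times_from1 `<=` <<s E >> ->
    measurable_wrt <<s E >> (state_comb a).
  move=> h; apply: measurable_wrt_sum => t /andP[t1 _]; apply: measurable_wrtZ.
  apply: measurable_wrtB; last exact: measurable_wrt_cst.
  exact: (measurable_wrt_events h).
have mXeps : events (fun t => X t : T -> R) times_from1 `|`
    events (fun t => eps t : T -> R) times_from1 `<=` measurable.
  by rewrite subUset; split.
apply: (gaussian_moments_add mXeps mbar epsbar_indep).
- apply: measurable_wrtD.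
    by apply: state; apply: subset_trans (@sub_sigma_algebra _ _ _); exact: subsetUl.
  by apply: sums; apply: subset_trans (@sub_sigma_algebra _ _ _); exact: subsetUr.
- by apply: sums; exact: sub_sigma_algebra.
- apply: (gaussian_moments_add mX meps eps_indep).
  + by apply: state; exact: sub_sigma_algebra.
  + by apply: sums; exact: sub_sigma_algebra.
  + exact: gaussian_state_var.
  + exact: gaussian_moments_iid_sum.
- exact: gaussian_moments_iid_sum.
Qed.

Local Notation B := (inner P joint_comb).

Let polar := inner_polar joint_comb_linear gaussian_joint_comb.

Definition delta (t : nat) : nat -> R := fun s => (s == t)%:R.

Definition state_vec t : V := (delta t, 0, 0).

(** By polarisation: the variance does not change with the sign of the noise part. *)
Lemma inner_state_noise a b c : B (a, 0, 0) (0, b, c) = 0.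
Proof.
rewrite polar /joint_var /=.
have -> : a - 0 = a + 0 by rewrite subr0 addr0.
have E (f : nat -> R) : \sum_(1 <= t < N.+1) (0 - f) t ^+ 2 = \sum_(1 <= t < N.+1) (0 + f) t ^+ 2.
  apply: eq_bigr => t _; rewrite -[(0 - f) t]/(0 - f t) -[(0 + f) t]/(0 + f t).
  by rewrite !add0r sqrrN.
by rewrite !E subrr mul0r.
Qed.

Lemma inner_noise b c b' c' : B (0, b, c) (0, b', c') =
  \sum_(1 <= t < N.+1) b t * b' t + \sum_(1 <= t < N.+1) c t * c' t.
Proof.
rewrite polar /joint_var /= subr0 addr0.
have E (f g : nat -> R) : \sum_(1 <= t < N.+1) (f + g) t ^+ 2 =
    \sum_(1 <= t < N.+1) (f - g) t ^+ 2 + 4 * \sum_(1 <= t < N.+1) f t * g t.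
  rewrite mulr_sumr -big_split; apply: eq_bigr => t _ /=.
  by rewrite -[(f + g) t]/(f t + g t) -[(f - g) t]/(f t - g t); ring.
by rewrite (E b b') (E c c'); field.
Qed.

Lemma joint_comb_state t w : (1 <= t <= N)%N -> joint_comb (state_vec t) w = X t w - m t.
Proof.
move=> tN; rewrite /joint_comb /state_comb /noise_comb /= (sum_delta (fun s => X s w - m s))//.
by rewrite !big1 ?addr0// => s _; rewrite mul0r.
Qed.

Lemma inner_state t s : (1 <= t <= N)%N -> (1 <= s <= N)%N ->
  B (state_vec t) (state_vec s) = K t s.
Proof.
move=> tN sN; have /andP[t1 _] := tN; have /andP[s1 _] := sN.
rewrite /inner; under eq_integral do rewrite !joint_comb_state//.
have := X_cov t1 s1; rewrite unlock /covariance !X_mean// unlock => h.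
by rewrite -[RHS]/(fine (K t s)%:E) -h.
Qed.

Variables (A Q : nat -> R).
Hypothesis Q_ge0 : forall t, (1 <= t)%N -> 0 <= Q t.
Local Notation D := (observation_gain A Q).
Variables (g : nat -> nat -> R) (nu : nat -> T -> R).
Hypothesis gE : riccati K D g.

Definition aux_state (t : nat) (w : T) : R := Q t * X t w + Num.sqrt (Q t) * epsbar t w.

(** Covers the one-step prediction, [k = s], and the smoothing of an earlier state, [s < k], needed
    for the terms of xi. *)
Definition prediction (s k : nat) (w : T) : R :=
  m s + \sum_(1 <= l < k) g s l / (1 + D l * g l l) * nu l w.

Hypothesis nuE : forall l w, (1 <= l)%N ->
  nu l w = A l * obs A X eps l w + aux_state l w - D l * prediction l l w.

(** The noise of the combined observation; the next two vectors are the noises of [Y] and of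
    [aux_state] alone. Their covariances with it, [A t] and [Q t], are the coefficients of the state
    in these observations, as [inner_residual_observation] demands. *)
Let noise_vec t : V := (0, A t *: delta t, Num.sqrt (Q t) *: delta t).
Let eps_vec t : V := (0, delta t, 0).
Let bar_vec t : V := (0, 0, Num.sqrt (Q t) *: delta t).

Let Blin := inner_linear joint_comb_linear gaussian_joint_comb.
Let BC := innerC P joint_comb.
Let Bge0 v : 0 <= B v v.
Proof. by rewrite (inner_norm gaussian_joint_comb); exact: (inner_ge0 gaussian_joint_comb). Qed.

Let D_ge0 t : (1 <= t <= N)%N -> 0 <= D t.
Proof. by move=> /andP[t1 _]; rewrite addr_ge0 ?sqr_ge0 ?Q_ge0. Qed.

Let delta_sum a b t r : (1 <= r <= N)%N ->
  \sum_(1 <= s < N.+1) (a *: delta t) s * (b *: delta r) s = a * b * (t == r)%:R.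
Proof.
move=> rN; transitivity (\sum_(1 <= s < N.+1) (s == r)%:R * (a * b * delta t s)).
  by apply: eq_bigr => s _; rewrite -[(a *: _) s]/(a * delta t s) -[(b *: _) s]/(b *
    delta r s) /delta; ring.
by rewrite sum_delta// /delta eq_sym.
Qed.

Let noise_at_of a b (f : nat -> V) : (forall t, f t = (0, a t *: delta t, b t *: delta t)) ->
  forall r, (1 <= r <= N)%N ->
  noise_at B N state_vec noise_vec r (A r * a r + Num.sqrt (Q r) * b r) (f r).
Proof.
move=> fE r rN; rewrite fE; split.
- by move=> t _; exact: inner_state_noise.
- move=> l lN lr; rewrite inner_noise !delta_sum//.
  by rewrite (negbTE lr) !mulr0 addr0.
- by rewrite inner_noise !delta_sum// eqxx !mulr1.
Qed.

Let noise_n r : (1 <= r <= N)%N -> noise_at B N state_vec noise_vec r (D r) (noise_vec r).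
Proof.
move=> rN; have := noise_at_of (fun t => erefl (noise_vec t)) rN.
have /andP[r1 _] := rN.
by rewrite -expr2 -[Num.sqrt _ * _]expr2 sqr_sqrtr ?Q_ge0.
Qed.

Let noise_eps r : (1 <= r <= N)%N -> noise_at B N state_vec noise_vec r (A r) (eps_vec r).
Proof.
move=> rN; have h t : eps_vec t = (0, 1 *: delta t, 0 *: delta t).
  by rewrite scale1r scale0r.
by have := noise_at_of h rN; rewrite mulr1 mulr0 addr0.
Qed.

Let noise_bar r : (1 <= r <= N)%N -> noise_at B N state_vec noise_vec r (Q r) (bar_vec r).
Proof.
move=> rN; have h t : bar_vec t = (0, 0 *: delta t, Num.sqrt (Q t) *: delta t).
  by rewrite scale0r.
have /andP[r1 _] := rN.
have := noise_at_of h rN.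
by rewrite mulr0 add0r -expr2 sqr_sqrtr ?Q_ge0.
Qed.

Let joint_comb_noise a b t w : (1 <= t <= N)%N ->
  joint_comb (0, a *: delta t, b *: delta t) w = a * eps t w + b * epsbar t w.
Proof.
move=> tN; rewrite /joint_comb /state_comb /noise_comb /= big1 ?add0r; last by move=> i _;
  rewrite mul0r.
have E c (f : nat -> R) : \sum_(1 <= s < N.+1) (c *: delta t) s * f s = c * f t.
  rewrite -(sum_delta (fun s => c * f s) tN); apply: eq_bigr => s _.
  by rewrite -[(c *: _) s]/(c * (s == t)%:R); ring.
by rewrite !E.
Qed.

Definition prediction_error (s k : nat) (w : T) : R := X s w - prediction s k w.

(** Transfers the abstract computation to random variables: the functions [nu] realise the vectors
    of [innovations_exist], both obeying the same recursion. Residuals at time [k] generate [E],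
    observations before [k] generate [F]. *)
Lemma prediction_error_facts k : (1 <= k <= N.+1)%N ->
  [/\ exists E F : set (set T), [/\ E `<=` measurable, F `<=` measurable,
        independent_sets P <<s E >> <<s F >>,
        forall s, (1 <= s <= N)%N -> measurable_wrt <<s E >> (prediction_error s k) &
        forall r, (1 <= r < k)%N -> measurable_wrt <<s F >> (obs A X eps r) /\
                                   measurable_wrt <<s F >> (aux_state r)],
      forall s, (1 <= s <= N)%N -> P.-integrable setT (EFin \o prediction_error s k) /\
        (\int[P]_w (prediction_error s k w)%:E = 0)%E,
      (k <= N)%N -> forall s, (1 <= s <= N)%N ->
        P.-integrable setT (fun w => (prediction_error k k w * prediction_error s k w)%:E) /\
        (\int[P]_w (prediction_error k k w * prediction_error s k w)%:E = (g s k)%:E)%E &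
      (k <= N)%N -> 0 <= g k k].
Proof.
move=> /andP[k1 kN].
have [nuv nuvE] := innovations_exist state_vec noise_vec D g.
have nuvE' l : (1 <= l <= N)%N -> nuv l = D l *: residual state_vec D g nuv l l + noise_vec l by [].
have resE s j w : (1 <= s <= N)%N -> (forall l, (1 <= l < j)%N -> joint_comb (nuv l) w = nu l w) ->
    joint_comb (residual state_vec D g nuv s j) w = prediction_error s j w.
  move=> sN h; rewrite /residual (gaussian_spaceB joint_comb_linear).
  rewrite joint_comb_state// (gaussian_space_sum joint_comb_linear) /prediction_error /prediction.
  rewrite opprD addrA; congr (_ - _); rewrite big_nat [in RHS]big_nat; apply: eq_bigr => l lj.
  by rewrite (gaussian_spaceZ joint_comb_linear) h.
have nuL l w : (1 <= l <= N)%N -> joint_comb (nuv l) w = nu l w.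
  elim/ltn_ind: l => l IH lN; have /andP[l1 lN'] := lN.
  rewrite nuvE joint_comb_linear resE//; last first.
    move=> i /andP[i1 il]; apply: IH => //.
    by rewrite i1 (leq_trans (ltnW il)).
  rewrite /noise_vec joint_comb_noise// nuE// /prediction_error /obs /aux_state /observation_gain.
  by ring.
have resE' s w : (1 <= s <= N)%N -> joint_comb (residual state_vec D g nuv s k) w =
  prediction_error s k w.
  move=> sN; apply: resE => // l /andP[l1 lk]; apply: nuL.
  by rewrite l1 -ltnS (leq_trans lk).
split.
- pose z i := residual state_vec D g nuv i.+1 k.
  (* Even indices are the centred [Y], odd ones the centred [aux_state], both at time i/2 + 1; so 2
     (k - 1) coordinates cover the times before [k]. *)
  pose v i := if odd i then Q (i./2).+1 *: state_vec (i./2).+1 + bar_vec (i./2).+1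
              else A (i./2).+1 *: state_vec (i./2).+1 + eps_vec (i./2).+1.
  have mL u : measurable_fun setT (joint_comb u) by exact: (measurable_gaussian_space
    gaussian_joint_comb).
  exists (rectangles (fun i => joint_comb (z i)) N),
    (rectangles (fun i => joint_comb (v i)) (k.-1).*2).
  split.
  + exact: rectangles_measurable.
  + exact: rectangles_measurable.
  + apply: (gaussian_space_independent joint_comb_linear gaussian_joint_comb) => i j iN jk.
    have jk' : (1 <= (j./2).+1 < k)%N.
      by rewrite /= -[k]prednK// ltnS -ltn_double (leq_ltn_trans _ jk)// -[leqRHS](odd_double_half
        j) leq_addl.
    have jN : (1 <= (j./2).+1 <= N)%N by have /andP[_ h] := jk'; exact: leq_trans h kN.
    have iN' : (1 <= i.+1 <= N)%N by [].
    rewrite /v; case: ifP => _.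
    * exact: (inner_residual_observation Blin BC Bge0 D_ge0 (fun t s => @inner_state t s) noise_n
        gE nuvE' kN iN' jk' (noise_bar jN)).
    * exact: (inner_residual_observation Blin BC Bge0 D_ge0 (fun t s => @inner_state t s) noise_n
        gE nuvE' kN iN' jk' (noise_eps jN)).
  + move=> s /andP[s1 sN]; apply: measurable_wrt_sigma => C mC; apply: sub_sigma_algebra.
    have := @rectangles_preimage _ T R (fun i => joint_comb (z i)) N s.-1 C.
    rewrite /z prednK// => /(_ sN mC); congr rectangles.
    by apply/funext => w; rewrite /preimage /= resE'// s1.
  + move=> r /andP[r1 rk].
    have rN : (1 <= r <= N)%N by rewrite r1 -ltnS (leq_trans rk).
    have mv i : (i < (k.-1).*2)%N ->
        measurable_wrt <<s rectangles (fun i => joint_comb (v i)) (k.-1).*2 >> (joint_comb (v i)).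
      move=> ik; apply: measurable_wrt_sigma => C mC; apply: sub_sigma_algebra.
      exact: (@rectangles_preimage _ T R (fun i => joint_comb (v i))).
    have rk' : (r.-1.*2.+1 < (k.-1).*2)%N.
      by rewrite -doubleS leq_double prednK// -ltnS prednK.
    have obsE w : joint_comb (v r.-1.*2) w + A r * m r = obs A X eps r w.
      rewrite /v odd_double doubleK prednK// joint_comb_linear joint_comb_state//.
      have -> : eps_vec r = (0, 1 *: delta r, 0 *: delta r) by rewrite scale1r scale0r.
      by rewrite joint_comb_noise// /obs; ring.
    have auxE w : joint_comb (v r.-1.*2.+1) w + Q r * m r = aux_state r w.
      rewrite /v /= odd_double /= uphalf_double prednK// joint_comb_linear joint_comb_state//.
      have -> : bar_vec r = (0, 0 *: delta r, Num.sqrt (Q r) *: delta r) by rewrite scale0r.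
      by rewrite joint_comb_noise// /aux_state; ring.
    rewrite -(funext obsE) -(funext auxE); split.
      by apply: measurable_wrtD; [apply: mv; exact: ltnW|exact: measurable_wrt_cst].
    by apply: measurable_wrtD; [exact: mv|exact: measurable_wrt_cst].
- move=> s sN; rewrite -(funext (fun w => resE' s w sN)).
  by have [h1 h2 _ _ _] := gaussian_joint_comb (residual state_vec D g nuv s k).
- move=> kN' s sN; have kok : (1 <= k <= N)%N by rewrite k1.
  have E : (fun w => (prediction_error k k w * prediction_error s k w)%:E) =
      (fun w => (joint_comb (residual state_vec D g nuv k k) w *
                 joint_comb (residual state_vec D g nuv s k) w)%:E).
    by apply/funext => w; rewrite -(resE' k w kok) -(resE' s w sN).
  rewrite E.
  split; first exact: (integrable_inner gaussian_joint_comb).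
  rewrite (integral_inner gaussian_joint_comb); congr EFin.
  exact: (inner_residuals Blin BC Bge0 D_ge0 (fun t s => @inner_state t s) noise_n gE nuvE' kok sN).
- move=> kN'; have kok : (1 <= k <= N)%N by rewrite k1.
  exact: (riccati_diag_ge0 Blin BC Bge0 D_ge0 (fun t s => @inner_state t s) noise_n gE nuvE' kok).
Qed.

End observation_space.

Lemma integral_affine_sum d (T : measurableType d) (R : realType) (P : probability T R)
    n (c : R) (a be : nat -> R) (b : nat -> T -> R) :
  (forall s, (1 <= s < n)%N -> P.-integrable setT (EFin \o b s) /\
                               (\int[P]_w (b s w)%:E = (be s)%:E)%E) ->
  P.-integrable setT (EFin \o (fun w => c + \sum_(1 <= s < n) a s * b s w)) /\
  (\int[P]_w (c + \sum_(1 <= s < n) a s * b s w)%:E =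
   (c + \sum_(1 <= s < n) a s * be s)%:E)%E.
Proof.
have base k : (k <= 1)%N ->
    P.-integrable setT (EFin \o (fun w => c + \sum_(1 <= s < k) a s * b s w)) /\
    (\int[P]_w (c + \sum_(1 <= s < k) a s * b s w)%:E =
     (c + \sum_(1 <= s < k) a s * be s)%:E)%E.
  move=> k1; have -> : (fun w => c + \sum_(1 <= s < k) a s * b s w) = cst c.
    by apply/funext => w; rewrite big_geq ?addr0.
  under eq_integral do rewrite big_geq// addr0.
  rewrite big_geq// addr0; split; first exact: finite_measure_integrable_cst.
  exact: integral_probability_cst.
case: n => [_|n]; first exact: base.
elim: n => [_|n IH ib]; first exact: base.
have [|i1 e1] := IH; first by move=> s /andP[s1 sn]; apply: ib; rewrite s1 ltnW.
have [i2 e2] := ib n.+1 (ltnSn _).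
have E1 w : c + \sum_(1 <= s < n.+2) a s * b s w =
    (c + \sum_(1 <= s < n.+1) a s * b s w) + a n.+1 * b n.+1 w.
  by rewrite big_nat_recr//= addrA.
under eq_integral do rewrite E1.
rewrite (funext E1); split.
  rewrite (_ : _ \o _ = (fun w => (c + \sum_(1 <= s < n.+1) a s * b s w)%:E +
    (a n.+1)%:E * (b n.+1 w)%:E)%E)//.
  exact: (integrableD measurableT i1 (integrableZl measurableT _ i2)).
have /= -> := integralDZ (a n.+1) i1 i2.
by rewrite e2 e1 -EFinM -EFinD [in RHS]big_nat_recr//= addrA.
Qed.

(** * Freezing the coefficients of a linear combination *)

Section bilinear_freezing.
Context d (T : measurableType d) (R : realType) (P : probability T R).
Variables (E F : set (set T)) (mE : E `<=` measurable) (mF : F `<=` measurable).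
Hypothesis iEF : independent_sets P <<s E >> <<s F >>.

Lemma is_cond_exp_sum n (a0 : T -> R) (a b : nat -> T -> R) (be : nat -> R) :
  measurable_wrt <<s E >> a0 ->
  (forall s, (1 <= s < n)%N -> measurable_wrt <<s E >> (a s)) ->
  (forall s, (1 <= s < n)%N -> measurable_wrt <<s F >> (b s)) ->
  (forall s, (1 <= s < n)%N -> P.-integrable setT (EFin \o b s) /\
                               (\int[P]_w (b s w)%:E = (be s)%:E)%E) ->
  is_cond_exp P <<s E >> (fun w => a0 w + \sum_(1 <= s < n) a s w * b s w)
                         (fun w => a0 w + \sum_(1 <= s < n) a s w * be s).
Proof.
move=> ma0 ma mb ib.
(* Repeating the range inside the sum confines measurability to the indices where it is assumed. *)
pose f (z : g_sigma_algebraType E * g_sigma_algebraType F) : R :=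
  a0 z.1 + \sum_(s <- index_iota 1 n | (1 <= s < n)%N) a s z.1 * b s z.2.
have fE w w' : f (w, w') = a0 w + \sum_(1 <= s < n) a s w * b s w'.
  by rewrite /f /= -big_nat.
have m1 (u : T -> R) : measurable_wrt <<s E >> u -> measurable_fun setT
    (fun z : g_sigma_algebraType E * g_sigma_algebraType F => u z.1).
  by move=> /measurable_wrtP mu; exact: (measurableT_comp mu measurable_fst).
have m2 (u : T -> R) : measurable_wrt <<s F >> u -> measurable_fun setT
    (fun z : g_sigma_algebraType E * g_sigma_algebraType F => u z.2).
  by move=> /measurable_wrtP mu; exact: (measurableT_comp mu measurable_snd).
have mf : measurable_fun setT f.
  apply: measurable_funD; first exact: m1.
  rewrite (_ : (fun z => _) = (fun z : g_sigma_algebraType E * g_sigma_algebraType F =>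
      \sum_(s <- index_iota 1 n) (if (1 <= s < n)%N then a s z.1 * b s z.2 else 0))); last first.
    by apply/funext => z; rewrite big_mkcond.
  apply: measurable_sum => s; case sn: (1 <= s < n)%N; last exact: measurable_cst.
  by apply: measurable_funM; [apply: m1; exact: ma|apply: m2; exact: mb].
have intf w : P.-integrable setT (fun w' => (f (w, w'))%:E) /\
    (\int[P]_w' (f (w, w'))%:E = (a0 w + \sum_(1 <= s < n) a s w * be s)%:E)%E.
  have -> : (fun w' => (f (w, w'))%:E) =
      (EFin \o (fun w' => a0 w + \sum_(1 <= s < n) a s w * b s w')).
    by apply/funext => w'; rewrite fE.
  exact: integral_affine_sum.
have := is_cond_exp_freezing mE mF iEF mf (fun w => (intf w).1) (fun w => (intf w).2).
by under eq_fun do rewrite fE.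
Qed.

End bilinear_freezing.

Lemma sum_triangle (R : realType) (F : nat -> nat -> R) t :
  \sum_(1 <= l < t) \sum_(1 <= s < l) F l s = \sum_(1 <= s < t) \sum_(s.+1 <= l < t) F l s.
Proof.
case: t => [|t]; first by rewrite !big_geq.
elim: t => [|t IH]; first by rewrite !big_geq.
rewrite big_nat_recr//= IH [RHS]big_nat_recr//= [X in _ = _ + X]big_geq// addr0 -big_split /=.
by apply: eq_big_nat => s /andP[_ st]; rewrite [RHS]big_nat_recr.
Qed.

Lemma ae_all_from1 d (T : measurableType d) (R : realType) (P : probability T R)
    (S : nat -> T -> Prop) :
  (forall t, (1 <= t)%N -> {ae P, forall w, S t w}) ->
  {ae P, forall w, forall t, (1 <= t)%N -> S t w}.
Proof.
move=> h; apply: ae_foralln => t; case: (leqP 1 t) => [t1|t0].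
  by apply: filterS (h t t1) => w.
exact: aeW.
Qed.

Theorem theorem3 (d : measure_display) (T : measurableType d) (R : realType)
    (P : probability T R)
    (X eps epsbar : nat -> {RV P >-> R})
    (m : nat -> R) (K : nat -> nat -> R) (A Q : nat -> R)
    (h : nat -> T -> R)
    (X_gaussian : gaussian_sequence X)
    (X_mean : forall t, (1 <= t)%N -> 'E_P[X t]%E = (m t)%:E)
    (X_cov : forall t s, (1 <= t)%N -> (1 <= s)%N ->
       covariance P (X t) (X s) = (K t s)%:E)
    (eps_iid : iid_std_normal eps)
    (eps_indep : independent_sets P
       <<s events (fun t => X t) times_from1 >>
       <<s events (fun t => eps t) times_from1 >>)
    (epsbar_iid : iid_std_normal epsbar)
    (epsbar_indep : independent_sets P
       <<s events (fun t => X t) times_from1 `|`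
           events (fun t => eps t) times_from1 >>
       <<s events (fun t => epsbar t) times_from1 >>)
    (Q_ge0 : forall t, (1 <= t)%N -> 0 <= Q t)
    (h_adapted : forall t, (1 <= t)%N ->
       measurable_wrt <<s events (obs A X eps) (times_upto t) >> (h t)) :
  let Y := obs A X eps in
  let Y2 := aux_obs Q h X epsbar in
  let xi := aux_sum h X Y2 in
  let Ybar t := <<s events Y (times_upto t) `|` events Y2 (times_upto t) >> in
  let pibar t (eta : T -> R) := cond_exp P (Ybar t) eta in
  let predX t := pibar t.-1 (X t) in
  let gammabar t := 'E_P[(fun w => (X t w - predX t w) ^+ 2)%R]%E in
  let gammabar_Xxi t :=
    if t == 1%N then cst 0
    else pibar t.-1 (fun w =>
      (X t w - predX t w) * (xi t.-1 w - pibar t.-1 (xi t.-1) w)) in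
  let Zh t w := predX t w - gammabar_Xxi t w in
  exists gam : nat -> nat -> R,
    let denom s := 1 + (A s ^+ 2 + Q s) * fine (gammabar s) in
    let Zh_equation (Z : nat -> T -> R) :=
      forall t, (1 <= t)%N -> {ae P, forall w,
        Z t w = m t
          + \sum_(1 <= l < t) gam t l * (Q l / denom l) * (h l w - Z l w)
          + \sum_(1 <= l < t) gam t l * (A l / denom l)
                                * (Y l w - A l * Z l w)} in
    [/\ error_cov_equation K A Q gam /\
        (forall gam', error_cov_equation K A Q gam' ->
           forall t s, (1 <= s <= t)%N -> gam' t s = gam t s),
        forall t, (1 <= t)%N -> {ae P, forall w,
          predX t w = m t + \sum_(1 <= s < t) gam t s / denom s *
            (A s * (Y s w - A s * predX s w)
             + (Y2 s w - Q s * (predX s w - h s w)))},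
        forall t, (1 <= t)%N -> gammabar t = (gam t t)%:E &
        Zh_equation Zh /\
        (forall Z, Zh_equation Z ->
           forall t, (1 <= t)%N -> {ae P, forall w, Z t w = Zh t w})].
Proof.
move=> Y Y2 xi Ybar pibar predX gammabar gammabar_Xxi Zh.
pose D := observation_gain A Q.
have [g gE] := riccati_exists K D.
pose W := aux_state X epsbar Q.
have [nu nuE0] : exists nu : nat -> T -> R, forall l, nu l =
    fun w => A l * Y l w + W l w - D l * prediction m A Q g nu l l w.
  apply: (@strong_recursion (T -> R) (fun=> 0)
    (fun l nu w => A l * Y l w + W l w - D l * prediction m A Q g nu l l w)).
  move=> t f f' ff'; apply/funext => w; congr (_ - _ * (_ + _)).
  by apply: eq_big_nat => l /andP[_ lt]; rewrite ff'.
pose p := prediction m A Q g nu; pose e := prediction_error X m A Q g nu.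
pose den l := 1 + D l * g l l.
have facts N k : (1 <= k <= N.+1)%N -> _ :=
  @prediction_error_facts _ _ _ P X eps epsbar m K X_gaussian X_mean X_cov eps_iid
    eps_indep epsbar_iid epsbar_indep N A Q Q_ge0 g nu gE
    (fun l w _ => congr1 (fun f => f w) (nuE0 l)) k.
have WE s w : W s w = Y2 s w + Q s * h s w.
  by rewrite /Y2 /aux_obs /W /aux_state; ring.
have mm (f : T -> R) : measurable_fun setT f -> measurable_wrt <<s measurable >> f.
  move=> mf; apply: measurable_wrt_sigma => B mB; apply: sub_sigma_algebra.
  by rewrite -[X in measurable X]setTI; exact: mf.
have mm' (f : T -> R) : measurable_wrt <<s measurable >> f -> measurable_fun setT f.
  exact: measurable_wrt_sub.
have mX s : measurable_fun setT (X s : T -> R) by exact: measurable_funPT.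
have mY s : measurable_fun setT (Y s).
  by apply: measurable_funD; [apply: measurable_funM|].
(* Used for three sigma-algebras: the ambient one, that of all observations before [k], and the one
   generated by the Gaussian observations. *)
have hS (E : set (set T)) r : (1 <= r)%N ->
    (forall i, (1 <= i <= r)%N -> measurable_wrt <<s E >> (Y i)) ->
    measurable_wrt <<s E >> (h r).
  move=> r1 YE; apply: (measurable_wrtS _ (h_adapted r r1)); apply: sigma_sub.
  by move=> _ [t tr [B mB <-]]; apply: (YE t tr); exists B.
have mh s : (1 <= s)%N -> measurable_fun setT (h s).
  by move=> s1; apply: mm'; apply: hS => // i _; exact: mm.
have mY2 s : (1 <= s)%N -> measurable_fun setT (Y2 s).
  move=> s1; apply: measurable_funD; apply: measurable_funM => //.
  by apply: measurable_funB => //; exact: mh.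
(* Everything at time [k] comes from the facts with horizon [k]. The sign of [g k k] is part of the
   claim because the denominators depend on it. *)
have main k : (1 <= k)%N ->
    [/\ measurable_fun setT (predX k), {ae P, forall w, predX k w = p k k w},
        gammabar k = (g k k)%:E, 0 <= g k k &
        {ae P, forall w, gammabar_Xxi k w = \sum_(1 <= s < k) g s k * Y2 s w}].
  move=> k1.
  have kk : (1 <= k <= k.+1)%N by rewrite k1 leqnSn.
  have [[E [F [mE mF iEF eE dF]]] e0 ee gk0] := facts k k kk.
  have {}ee := ee (leqnn k); have {}gk0 := gk0 (leqnn k).
  pose G := events Y (times_upto k.-1) `|` events Y2 (times_upto k.-1).
  have upto r : (1 <= r < k)%N -> times_upto k.-1 r.
    by move=> /andP[r1 rk]; rewrite /times_upto /= r1 -ltnS prednK.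
  have upto' r : times_upto k.-1 r -> (1 <= r < k)%N.
    by rewrite /times_upto /= => /andP[r1 rk]; rewrite r1 /= -[k]prednK.
  have YG r : (1 <= r < k)%N -> measurable_wrt <<s G >> (Y r).
    move=> rk; apply: (measurable_wrt_events _ (upto _ rk)).
    by apply: subset_trans (@sub_sigma_algebra _ _ _); exact: subsetUl.
  have Y2G r : (1 <= r < k)%N -> measurable_wrt <<s G >> (Y2 r).
    move=> rk; apply: (measurable_wrt_events _ (upto _ rk)).
    by apply: subset_trans (@sub_sigma_algebra _ _ _); exact: subsetUr.
  have hGF (E' : set (set T)) r : (forall i, (1 <= i < k)%N -> measurable_wrt <<s E' >> (Y i)) ->
      (1 <= r < k)%N -> measurable_wrt <<s E' >> (h r).
    move=> YE /andP[r1 rk]; apply: hS => // i /andP[i1 ir]; apply: YE.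
    by rewrite i1 (leq_ltn_trans ir).
  have hG r := hGF G r YG.
  have mG : G `<=` measurable.
    rewrite subUset; split; apply: events_measurable => t; first by [].
    by move=> /upto' /andP[t1 _]; exact: mY2.
  (* The actual observations are functions of the Gaussian ones, since Y2 = W - Q h with [h] adapted
     to [Y]; independence from the residuals is thus inherited by [G]. *)
  have GF : G `<=` <<s F >>.
    have YF r : (1 <= r < k)%N -> measurable_wrt <<s F >> (Y r) by move=> rk; have [] := dF r rk.
    rewrite subUset; split => _ [t /upto' tk [B mB <-]].
      by apply: (YF t tk); exists B.
    have Y2F : measurable_wrt <<s F >> (Y2 t).
      have -> : Y2 t = fun w => W t w - Q t * h t w.
        by apply/funext => w; rewrite WE addrK.
      apply: measurable_wrtB; first by have [] := dF t tk.
      by apply: measurable_wrtZ; exact: hGF.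
    by apply: Y2F; exists B.
  have iGE : independent_sets P <<s G >> <<s E >>.
    apply: independent_setsC; apply: (independent_setsS _ _ iEF) => //.
    exact: sigma_sub.
  have nuG l : (1 <= l < k)%N -> measurable_wrt <<s G >> (nu l).
    elim/ltn_ind: l => l IH lk; have /andP[l1 lk'] := lk; rewrite nuE0.
    apply: measurable_wrtB.
      apply: measurable_wrtD; first by apply: measurable_wrtZ; exact: YG.
      rewrite (funext (WE l)); apply: measurable_wrtD; first exact: Y2G.
      by apply: measurable_wrtZ; exact: hG.
    apply: measurable_wrtZ; apply: measurable_wrtD; first exact: measurable_wrt_cst.
    apply: measurable_wrt_sum => i /andP[i1 il]; apply: measurable_wrtZ; apply: IH => //.
    by rewrite i1 (ltn_trans il).
  have pG s : measurable_wrt <<s G >> (p s k).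
    apply: measurable_wrtD; first exact: measurable_wrt_cst.
    by apply: measurable_wrt_sum => l lk; apply: measurable_wrtZ; exact: nuG.
  have okS s : (1 <= s < k)%N -> (1 <= s <= k)%N.
    by move=> /andP[s1 sk]; rewrite s1 ltnW.
  have okk : (1 <= k <= k)%N by rewrite k1 leqnn.
  (* The freezing lemma with the single term s = 1: the state is its predictor, known from the past,
     plus an independent centred residual. *)
  have condX : is_cond_exp P <<s G >> (X k) (p k k).
    have := @is_cond_exp_sum _ _ _ P G E mG mE iGE 2 (p k k) (fun _ _ => 1) (fun _ => e k k)
      (fun=> 0)
      (pG k) (fun _ _ => @measurable_wrt_cst _ _ _ G 1) (fun _ _ => eE k okk) (fun _ _ => e0 k okk).
    have -> : (fun w => p k k w + \sum_(1 <= s < 2) 1 * e k k w) = X k.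
      by apply/funext => w; rewrite big_nat1 mul1r /e /prediction_error addrC subrK.
    have -> // : (fun w => p k k w + \sum_(1 <= s < 2) 1 * 0) = p k k.
    by apply/funext => w; rewrite big_nat1 mulr0 addr0.
  have [predG predE] : _ /\ {ae P, forall w, predX k w = p k k w} :=
    cond_exp_ae mG (mX k) (mX k) (aeW P (fun w => erefl (X k w))) condX.
  have mpred : measurable_fun setT (predX k) by exact: measurable_wrt_sub predG.
  have me s : measurable_fun setT (e s k).
    by apply: measurable_funB => //; exact: measurable_wrt_sub (pG s).
  split => //.
  - have [_ eeE] := ee k okk.
    rewrite /gammabar unlock -eeE; apply: ae_eq_integral => //.
    + by apply/measurable_EFinP; apply: measurable_funX; exact: measurable_funB.
    + by apply/measurable_EFinP; exact: measurable_funM.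
    + by apply: filterS predE => w pw _; rewrite /= pw expr2.
  rewrite /gammabar_Xxi; case: eqP => [->|/eqP kn1].
    by apply: aeW => w; rewrite big_geq.
  have kE : k.-1.+1 = k by rewrite prednK.
  (* The first sum is known from the past and the second is linear in the residuals; hence the error
     of xi is the second sum. *)
  have xiE w : xi k.-1 w = \sum_(1 <= s < k) (p s k w - h s w) * Y2 s w +
      \sum_(1 <= s < k) Y2 s w * e s k w.
    rewrite /xi /aux_sum kE -big_split; apply: eq_bigr => s _ /=.
    by rewrite /e /prediction_error -/(p s k w); ring.
  have mxi : measurable_fun setT (xi k.-1).
    apply: mm'; apply: measurable_wrt_sum; rewrite kE => s /andP[s1 _].
    by apply: measurable_wrtM; apply: mm; [apply: measurable_funB => //; exact: mh|exact: mY2].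
  have condxi : is_cond_exp P <<s G >> (xi k.-1) (fun w => \sum_(1 <= s < k) (p s k w - h s w) *
    Y2 s w).
    have := @is_cond_exp_sum _ _ _ P G E mG mE iGE k
      (fun w => \sum_(1 <= s < k) (p s k w - h s w) * Y2 s w) Y2 (fun s => e s k) (fun=> 0).
    have a0G : measurable_wrt <<s G >> (fun w => \sum_(1 <= s < k) (p s k w - h s w) * Y2 s w).
      apply: measurable_wrt_sum => s sk; apply: measurable_wrtM; last exact: Y2G.
      by apply: measurable_wrtB; [exact: pG|exact: hG].
    move=> /(_ a0G Y2G (fun s sk => eE s (okS s sk)) (fun s sk => e0 s (okS s sk))).
    rewrite -(funext xiE).
    have -> // : (fun w => \sum_(1 <= s < k) (p s k w - h s w) * Y2 s w +
      \sum_(1 <= s < k) Y2 s w * 0) =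
      fun w => \sum_(1 <= s < k) (p s k w - h s w) * Y2 s w.
    by apply/funext => w; rewrite [X in _ + X]big1 ?addr0// => s _; rewrite mulr0.
  have [xiG pxiE] : _ /\ {ae P, forall w, pibar k.-1 (xi k.-1) w =
      \sum_(1 <= s < k) (p s k w - h s w) * Y2 s w} :=
        cond_exp_ae mG mxi mxi (aeW P (fun w => erefl (xi k.-1 w))) condxi.
  have mpxi : measurable_fun setT (pibar k.-1 (xi k.-1)) by exact: measurable_wrt_sub xiG.
  (* The product of the two errors once the versions are replaced: past coefficients Y2_s times
     products of residuals of mean [g s k]. The leading 0 matches the shape of the freezing
     lemma. *)
  pose eta w := 0 + \sum_(1 <= s < k) Y2 s w * (e k k w * e s k w).
  have meta : measurable_fun setT eta.
    apply: measurable_funD; first exact: measurable_cst.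
    apply: mm'; apply: measurable_wrt_sum => s /andP[s1 _]; apply: mm.
    by apply: measurable_funM; [exact: mY2|exact: measurable_funM].
  have condeta : is_cond_exp P <<s G >> eta (fun w => 0 + \sum_(1 <= s < k) Y2 s w * g s k).
    apply: (@is_cond_exp_sum _ _ _ P G E mG mE iGE k (fun=> 0) Y2
      (fun s w => e k k w * e s k w) (fun s => g s k)) => //.
    - exact: measurable_wrt_cst.
    - by move=> s sk; apply: measurable_wrtM; apply: eE => //; exact: okS.
    - by move=> s sk; apply: ee; exact: okS.
  have meta0 : measurable_fun setT (fun w =>
      (X k w - predX k w) * (xi k.-1 w - pibar k.-1 (xi k.-1) w)).
    by apply: measurable_funM; exact: measurable_funB.
  have etaE : {ae P, forall w,
      (X k w - predX k w) * (xi k.-1 w - pibar k.-1 (xi k.-1) w) = eta w}.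
    apply: filterS2 predE pxiE => w pw pxw.
    rewrite pw pxw xiE addrAC subrr add0r /eta add0r mulr_sumr.
    by apply: eq_bigr => s _; rewrite -[X k w - p k k w]/(e k k w) mulrCA.
  have [_ E1] := cond_exp_ae mG meta0 meta etaE condeta.
  apply: filterS E1 => w Ew; rewrite -[LHS]/(cond_exp P <<s G >> _ w) Ew add0r.
  by apply: eq_bigr => s _; rewrite mulrC.
have gnn s : (1 <= s)%N -> 0 <= g s s by move=> s1; have [] := main s s1.
have D_ge0 s : (1 <= s)%N -> 0 <= D s by move=> s1; rewrite addr_ge0 ?sqr_ge0 ?Q_ge0.
have den0 s : (1 <= s)%N -> den s != 0.
  by move=> s1; rewrite gt_eqF// /den ltr_wpDr// mulr_ge0 ?D_ge0 ?gnn.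
have Ksym i j : (1 <= i)%N -> (1 <= j)%N -> K i j = K j i.
  by move=> i1 j1; apply: EFin_inj; rewrite -!X_cov// covarianceC.
(* An everywhere defined version of [Zh]: the equation is proved for it pointwise, and exceptional
   sets enter only at the end. *)
pose zz t w := p t t w - \sum_(1 <= s < t) g s t * Y2 s w.
have pE t w : p t t w = m t + \sum_(1 <= s < t) g t s / den s *
    (A s * (Y s w - A s * p s s w) + (Y2 s w - Q s * (p s s w - h s w))).
  rewrite {1}/p /prediction; congr (_ + _); apply: eq_bigr => s _.
  rewrite -/(den s) nuE0 WE -/(p s s w) /D /observation_gain; congr (_ * _); ring.
have zzE t w : (1 <= t)%N -> zz t w = m t
    + \sum_(1 <= l < t) g t l * (Q l / den l) * (h l w - zz l w)
    + \sum_(1 <= l < t) g t l * (A l / den l) * (Y l w - A l * zz l w).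
  move=> t1.
  (* Inserting the definition of [zz], the terms in [p] rebuild the prediction except for its Y2
     part, which is subtracted; the corrections carry A_l^2 + Q_l, hence the double sum with
     [D l]. *)
  have -> : m t + \sum_(1 <= l < t) g t l * (Q l / den l) * (h l w - zz l w)
    + \sum_(1 <= l < t) g t l * (A l / den l) * (Y l w - A l * zz l w) =
    p t t w - \sum_(1 <= s < t) g t s / den s * Y2 s w
     + \sum_(1 <= l < t) \sum_(1 <= s < l) g t l * g s l * (D l / den l) * Y2 s w.
    rewrite pE -!addrA; congr (_ + _); rewrite -sumrN -!big_split /=.
    apply: eq_bigr => l _; rewrite {1 2}/zz.
    have -> : \sum_(1 <= s < l) g t l * g s l * (D l / den l) * Y2 s w =
        g t l * (D l / den l) * \sum_(1 <= s < l) g s l * Y2 s w.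
      by rewrite mulr_sumr; apply: eq_bigr => s _; ring.
    by rewrite /D /observation_gain; ring.
  (* After exchanging the sums, the coefficients of each Y2_s are compared; their equality is
     [riccati_transpose]. *)
  rewrite sum_triangle /zz; move: (p t t w) => pt; rewrite -addrA; congr (_ + _).
  rewrite -!sumrN -big_split /=; apply: eq_big_nat => s /andP[s1 st].
  rewrite (@riccati_transpose _ K D g s t)//; last by rewrite s1.
  by rewrite mulrBl opprB addrC mulr_suml.
have predE : {ae P, forall w, forall t, (1 <= t)%N -> predX t w = p t t w}.
  by apply: ae_all_from1 => t t1; have [] := main t t1.
have ZhE : {ae P, forall w, forall t, (1 <= t)%N -> Zh t w = zz t w}.
  apply: ae_all_from1 => t t1; have [_ h1 _ _ h2] := main t t1.
  by apply: filterS2 h1 h2 => w pw gw; rewrite /Zh /zz pw gw.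
exists g => denom Zh_equation.
have denE s : (1 <= s)%N -> denom s = den s.
  by move=> s1; rewrite /denom; have [_ _ -> _ _] := main s s1.
have ZhZ : Zh_equation Zh.
  move=> t t1; apply: filterS ZhE => w Zw; rewrite Zw// zzE//.
  congr (_ + _ + _); apply: eq_big_nat => l /andP[l1 _]; rewrite denE// Zw//.
split.
- split; first by move=> t s _; exact: gE.
  by move=> gam' gam'E; apply: (@riccati_unique _ K D) => //; move=> t s _; exact: gE.
- move=> t t1; apply: filterS predE => w pw; rewrite pw// pE; congr (_ + _).
  by apply: eq_big_nat => s /andP[s1 _]; rewrite denE// pw.
- by move=> t t1; have [] := main t t1.
- split => // Z Zeq t t1.
  (* On a common event of full probability both equations hold at all times, and their right sides
     involve the unknown only at times l < t, so induction on [t] gives uniqueness. *)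
  have Zall := ae_all_from1 Zeq; have Zhall := ae_all_from1 ZhZ.
  apply: filterS2 Zall Zhall => w Zw Zhw.
  elim/ltn_ind: t t1 => t IH t1; rewrite Zw// Zhw//.
  by congr (_ + _ + _); apply: eq_big_nat => l /andP[l1 lt]; rewrite IH.
Qed.
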